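(* Let $x^A=x_1^{\alpha_1}\cdots x_N^{\alpha_N}$ with $\alpha_i\ge0$, $\mathbb{R}^N_*=\{x\in\mathbb{R}^N:x_i>0\text{ whenever }\alpha_i>0\}$, and $d\mu_A=\frac{x^Ae^{-|x|^2/2}}{\int_{\mathbb{R}^N_*}x^Ae^{-|x|^2/2}dx}\,dx$ on $\mathbb{R}^N_*$. For all $u\in X_A$, $$\int_{\mathbb{R}^N_*}|\nabla u|^2d\mu_A-\int_{\mathbb{R}^N_*}\left|u-\int_{\mathbb{R}^N_*}u\,d\mu_A\right|^2d\mu_A\ge\frac12\int_{\mathbb{R}^N_*}\left|\nabla\left[u-\left(\int_{\mathbb{R}^N_*}\Big(u-\int_{\mathbb{R}^N_*}u\,d\mu_A\Big)x\,d\mu_A\right)\cdot x\right]\right|^2d\mu_A,$$ where $\int(\cdot)x\,d\mu_A\in\mathbb{R}^N$ denotes the vector of integrals against the coordinates. If $x^A$ is partial, then equality is attained by some non-linear function $u\in X_A$.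
   Context: $N_*$ is the set of $u\in C_0^\infty(\overline{\mathbb{R}^N_*})$ with $\nabla u\cdot\vec\eta=0$ on $\partial\mathbb{R}^N_*$ ($\vec\eta$ the outer normal). $X_A$ is the completion of $N_*$ under the norm $\left(\int|u|^2d\mu_A\right)^{1/2}+\left(\int|\nabla u|^2d\mu_A\right)^{1/2}$. The monomial weight $x^A$ is called full if $\alpha_i>0$ for all $i$, and partial otherwise. *)

(* Defs.v *)
From HB Require Import structures.
From mathcomp Require Import all_boot all_order all_algebra.
From mathcomp Require Import all_classical all_reals all_analysis.
Set Implicit Arguments. Unset Strict Implicit. Unset Printing Implicit Defensive.
Import Order.TTheory GRing.Theory Num.Theory.
Import numFieldNormedType.Exports.
Local Open Scope classical_set_scope.
Local Open Scope ring_scope.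

Section Defs.
Variable R : realType.

(* ---- N-dimensional Lebesgue integral as iterated 1-D Lebesgue integrals
   (mathcomp-analysis has no Lebesgue measure on R^N; by Tonelli/Fubini this
   agrees with the product Lebesgue integral on measurable functions that are
   nonnegative or integrable). ---- *)
Fixpoint iint (n : nat) : ('rV[R]_n -> \bar R) -> \bar R :=
  match n return ('rV[R]_n -> \bar R) -> \bar R with
  | 0 => fun f => f 0
  | n'.+1 => fun f =>
      (\int[@lebesgue_measure R]_t
         iint (fun y : 'rV[R]_n' => f (row_mx (const_mx t : 'rV[R]_1) y)))%E
  end.

Variable N : nat.

Definition coord (x : 'rV[R]_N) (i : 'I_N) : R := x ord0 i.

Definition RNstar (alpha : 'I_N -> R) : set 'rV[R]_N :=
  [set x | forall i, 0 < alpha i -> 0 < coord x i].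
Definition RNstar_cl (alpha : 'I_N -> R) : set 'rV[R]_N :=
  [set x | forall i, 0 < alpha i -> 0 <= coord x i].

Definition sqnorm (x : 'rV[R]_N) : R := \sum_i coord x i ^+ 2.
Definition weight (alpha : 'I_N -> R) (x : 'rV[R]_N) : R :=
  (\prod_i (if 0 < alpha i then powR (coord x i) (alpha i) else 1))
  * expR (- sqnorm x / 2).

Definition wint (alpha : 'I_N -> R) (h : 'rV[R]_N -> R) : \bar R :=
  iint (fun x => (\1_(RNstar alpha) x * weight alpha x * h x)%:E).

Definition ZA (alpha : 'I_N -> R) : R := fine (wint alpha (fun=> 1)).
Definition muA (alpha : 'I_N -> R) (h : 'rV[R]_N -> R) : \bar R :=
  (wint alpha h * ((ZA alpha)^-1)%:E)%E.

Definition evec (i : 'I_N) : 'rV[R]_N := delta_mx ord0 i.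
Definition pder (s : seq 'I_N) (f : 'rV[R]_N -> R) : 'rV[R]_N -> R :=
  foldr (fun i g => fun x => 'D_(evec i) g x) f s.
Definition smooth (f : 'rV[R]_N -> R) : Prop :=
  forall s : seq 'I_N, continuous (pder s f) /\
    forall (i : 'I_N) (x : 'rV[R]_N), derivable (pder s f) x (evec i).
Definition grad (f : 'rV[R]_N -> R) (x : 'rV[R]_N) : 'rV[R]_N :=
  \row_i 'D_(evec i) f x.
Definition sqnormv (v : 'rV[R]_N) : R := \sum_i v ord0 i ^+ 2.
Definition dotv (v w : 'rV[R]_N) : R := \sum_i v ord0 i * w ord0 i.

(* N_* : C_0^infty functions on the closure of R^N_* (restrictions of smooth
   compactly supported functions on R^N) with zero normal derivative on the
   boundary (outer normal on the face {x_i = 0} is -e_i). *)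
Definition Nstar (alpha : 'I_N -> R) (f : 'rV[R]_N -> R) : Prop :=
  [/\ smooth f,
      exists M : R, forall x, M < `|x| -> f x = 0 &
      forall (i : 'I_N) x, 0 < alpha i -> RNstar_cl alpha x ->
        coord x i = 0 -> 'D_(evec i) f x = 0].

(* measurability w.r.t. the Borel (= product) sigma-algebra of R^N, seen on
   N-tuples *)
Definition rv_of_tuple (t : N.-tuple R) : 'rV[R]_N := \row_i tnth t i.
Definition rmeasurable (f : 'rV[R]_N -> R) : Prop :=
  measurable_fun [set: N.-tuple R] (f \o rv_of_tuple).

(* X_A : completion of N_* under the H^1(mu_A) norm, represented concretely
   as pairs (u, g) (function, gradient) in L^2(mu_A) x L^2(mu_A)^N that are
   limits of some sequence in N_* in that norm. *)
Definition XA (alpha : 'I_N -> R) (u : 'rV[R]_N -> R)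
    (g : 'rV[R]_N -> 'rV[R]_N) : Prop :=
  [/\ rmeasurable u, (forall i, rmeasurable (fun x => g x ord0 i)),
      (muA alpha (fun x => (u x ^+ 2)%R) < +oo)%E,
      (muA alpha (fun x => sqnormv (g x)) < +oo)%E &
      exists phi : nat -> 'rV[R]_N -> R,
        (forall n, Nstar alpha (phi n)) /\
        (fun n => muA alpha (fun x => (phi n x - u x) ^+ 2)) @ \oo --> 0%E /\
        (fun n => muA alpha (fun x => sqnormv (grad (phi n) x - g x)))
          @ \oo --> 0%E].

Definition rmuA (alpha : 'I_N -> R) (h : 'rV[R]_N -> R) : R :=
  fine (muA alpha h).

Definition cvec (alpha : 'I_N -> R) (u : 'rV[R]_N -> R) : 'rV[R]_N :=
  \row_i rmuA alpha (fun x => (u x - rmuA alpha u) * coord x i).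

End Defs.

(* Main.v *)
(* The core is the inequality
     Var f <= 1/2 E|grad f|^2 + 1/2 sum_(alpha_i = 0) (E x_i f)^2,
   applied to u + c.x with c = cvec u; since Var(c.x) >= sum_(alpha_i = 0) c_i^2, expanding it gives the theorem.
   In dimension one, x^2 - (a+1) is an eigenfunction of eigenvalue 2 of the operator of x^a e^(-x^2/2), and Barta's trick (completing a square with its logarithmic derivative) gives E h'^2 >= 2 E h^2 for every h vanishing at its nodes. The inequality then tensorizes: conditioning on x_1, set F(t) = E[f | x_1 = t] and G_j(t) = E[x_j f | x_1 = t]; the one-dimensional inequality handles F, and the variances of the G_j are absorbed by Bessel's inequality for the derivative of f along x_1.
   Equality when alpha_i = 0 is attained by the Hermite polynomial x_i^2 - 1, which is approximated in N_* by its products with the cutoffs prod_j exp(1 - 1/(1 - b x_j^2)) as b -> 0; the Neumann condition holds because these are even in x_j for j <> i. *)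
Require Import Defs.
From HB Require Import structures.
From mathcomp Require Import all_boot all_order all_algebra.
From mathcomp Require Import all_classical all_reals all_analysis.
From mathcomp Require Import measurable_realfun ring lra.
Import Order.TTheory GRing.Theory Num.Theory.
Import numFieldNormedType.Exports.
Local Open Scope classical_set_scope.
Local Open Scope ring_scope.

Set Implicit Arguments. Unset Strict Implicit. Unset Printing Implicit Defensive.

(** * The monomial Gaussian probability on the line *)

Section MonomialGaussian.
Context {R : realType}.
Implicit Types (a t x : R) (k : nat).
Local Notation mu := (@lebesgue_measure R).

(** The extra sum in the core inequality pays for the directions of eigenvalue 1: for [f = x_i] with
    zero exponent, both the variance and E|grad f|^2 equal 1, so the bound with 1/2 alone fails. The
    linear function is added to [u] although the theorem subtracts it, because E|grad(u + c.x)|^2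
    then yields the cross term c.E[grad u] with the sign that the theorem requires. The constants
    survive tensorization because the G_j enter with the coefficient 1/2 of the inequality in the
    remaining variables, so a Poincare inequality with constant 1 is enough for them, while F' and
    the G_j' are Fourier coefficients of one function, the derivative along x_1. Neither u + c.x nor
    the conditional expectations have compact support. Before the passage to the limit in [XA],
    everything therefore takes place among C^1 functions of polynomial growth, a class stable under
    slicing, conditioning and adding linear functions. Integrals in the statement are iterated
    Lebesgue integrals; the analysis uses a product probability [Pn], identified with them for
    nonnegative and for integrable functions. *)

Definition mono_gauss a t : R :=
  (if 0 < a then (if 0 < t then t `^ a else 0) else 1) * expR (- t ^+ 2 / 2).

Lemma mono_gauss_ge0 a t : 0 <= mono_gauss a t.
Proof.
rewrite /mono_gauss mulr_ge0 ?expR_ge0//; case: ifP => // _.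
by case: ifP => // _; exact: powR_ge0.
Qed.

Lemma measurable_mono_gauss a : measurable_fun setT (mono_gauss a).
Proof.
apply: measurable_funM; last first.
  apply: measurableT_comp => //; apply: measurable_funM => //.
  by apply: measurableT_comp => //; exact: exprn_measurable.
by case: (0 < a) => //; apply: measurable_fun_ifT => //; exact: measurable_fun_ltr.
Qed.

Lemma le1_oneDsqr x : 1 <= 1 + x ^+ 2.
Proof. by rewrite lerDl sqr_ge0. Qed.

Lemma normr_le_oneDsqr x : `|x| <= 1 + x ^+ 2.
Proof.
rewrite -[x ^+ 2]real_normK ?num_real//.
have := sqr_ge0 (`|x| - 1); have := normr_ge0 x; nra.
Qed.

(** Half of the Gaussian exponent absorbs all powers; the other half is the density of variance 2,
    whose integrability is known. *)
Lemma mono_gauss_poly_le a k : exists2 C : R, 0 <= C & forall t,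
  mono_gauss a t * (1 + t ^+ 2) ^+ k <= C * normal_pdf 0 (Num.sqrt 2) t.
Proof.
have [m am] : exists m : nat, a <= m%:R.
  have [m /ltW am] : exists m : nat, `|a| < m%:R.
    by exists (Num.bound `|a|); exact: archi_boundP.
  by exists m; rewrite (le_trans _ am)// ler_norm.
have dle t : mono_gauss a t <= (1 + t ^+ 2) ^+ m * expR (- t ^+ 2 / 2).
  rewrite /mono_gauss ler_wpM2r ?expR_ge0//.
  have o1 := le1_oneDsqr t.
  case: ifPn => [a0|_]; last by rewrite exprn_ege1.
  case: ifPn => [t0|_]; last by rewrite exprn_ge0// (le_trans _ o1).
  rewrite -powR_mulrn ?(le_trans _ o1)//.
  apply: (@le_trans _ _ ((1 + t ^+ 2) `^ a)); last by rewrite ler_powR.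
  apply: ge0_ler_powR; rewrite ?nnegrE.
  - exact: ltW.
  - exact: ltW.
  - exact: le_trans o1.
  - by rewrite (le_trans (ler_norm _))// normr_le_oneDsqr.
(* The successor keeps [j] nonzero, as it becomes a denominator. *)
pose j := (m + k).+1.
have s20 : Num.sqrt 2 != 0 :> R by rewrite sqrtr_eq0 -ltNge.
have pk := normal_peak_gt0 s20.
(* This is the [j]-th power of 1 + t^2 <= 4j exp((1 + t^2) / (4j)), with exp(t^2 / 4) left to the
   Gaussian. *)
pose C0 : R := (4 * j%:R) ^+ j * expR (1 / 4).
have C00 : 0 <= C0 by rewrite mulr_ge0 ?expR_ge0// exprn_ge0// mulr_ge0.
exists (C0 / normal_peak (Num.sqrt 2)); first by rewrite divr_ge0// ltW.
move=> t; rewrite normal_pdfE// mulrA divfK ?gt_eqF//.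
rewrite /normal_fun subr0 sqr_sqrtr// -mulr_natr.
apply: (@le_trans _ _ ((1 + t ^+ 2) ^+ j * expR (- t ^+ 2 / 2))).
  have o1 := le1_oneDsqr t.
  apply: (@le_trans _ _ ((1 + t ^+ 2) ^+ m * expR (- t ^+ 2 / 2) * (1 + t ^+ 2) ^+ k)).
    by rewrite ler_wpM2r// exprn_ge0// (le_trans _ o1).
  rewrite mulrAC -exprD ler_wpM2r ?expR_ge0//.
  exact: ler_weXn2l.
have -> : expR (- t ^+ 2 / 2) = expR (- t ^+ 2 / 4) * expR (- t ^+ 2 / (2 * 2)) :> R.
  by rewrite -expRD; congr expR; field.
rewrite mulrA ler_wpM2r ?expR_ge0//.
rewrite /C0 -ler_pdivrMr ?expR_gt0// -mulrA -expRN -expRD.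
have -> : - t ^+ 2 / 4 - 1 / 4 = - ((1 + t ^+ 2) / 4) by field.
rewrite expRN ler_pdivrMr ?expR_gt0//.
have j0 : 0 < j%:R :> R by rewrite ltr0n.
have -> : (1 + t ^+ 2) / 4 = ((1 + t ^+ 2) / (4 * j%:R)) * j%:R.
  by field; rewrite gt_eqF.
rewrite expRM_natr -exprMn.
rewrite lerXn2r// ?nnegrE ?addr_ge0 ?sqr_ge0 ?mulr_ge0 ?expR_ge0//.
rewrite mulrC -ler_pdivrMr ?mulr_gt0//.
by rewrite (le_trans _ (expR_ge1Dx _))// lerDr.
Qed.

Lemma integrable_mono_gauss_poly a k :
  mu.-integrable setT (fun t => (mono_gauss a t * (1 + t ^+ 2) ^+ k)%:E).
Proof.
have [C C0 hC] := mono_gauss_poly_le a k.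
apply: (@le_integrable _ _ _ mu setT _ _ (fun t => (C * normal_pdf 0 (Num.sqrt 2) t)%:E)) => //.
- apply/measurable_EFinP; apply: measurable_funM; first exact: measurable_mono_gauss.
  apply: measurable_funX; apply: measurable_funD => //; exact: measurable_funX.
- move=> t _; rewrite /= lee_fin !ger0_norm//.
    by rewrite mulr_ge0// normal_pdf_ge0.
  by rewrite mulr_ge0 ?mono_gauss_ge0// exprn_ge0// (le_trans _ (le1_oneDsqr t)).
- under eq_fun do rewrite EFinM.
  by apply: integrableZl => //; exact: integrable_normal_pdf.
Qed.

Lemma integrable_mono_gauss a : mu.-integrable setT (EFin \o mono_gauss a).
Proof.
have := integrable_mono_gauss_poly a 0.
by under eq_fun do rewrite expr0 mulr1.
Qed.

Definition mono_gauss_mass a : R := \int[mu]_t mono_gauss a t.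

Lemma mono_gauss_massE a :
  (\int[mu]_t (mono_gauss a t)%:E = (mono_gauss_mass a)%:E)%E.
Proof.
by rewrite fineK//; apply: integrable_fin_num => //; exact: integrable_mono_gauss.
Qed.

(** On [1, 2] the power is at least 1 and the Gaussian at least exp(-2), whatever the sign of
    [a]. *)
Lemma mono_gauss_mass_gt0 a : 0 < mono_gauss_mass a.
Proof.
pose c : R := expR (- 2).
have h : ((\int[mu]_(t in `[1%R, 2%R]) c%:E) <= (mono_gauss_mass a)%:E)%E.
  rewrite -mono_gauss_massE.
  apply: (@le_trans _ _ (\int[mu]_(t in `[1%R, 2%R]) (mono_gauss a t)%:E)%E); last first.
    apply: ge0_subset_integral => //.
    - by apply/measurable_EFinP; exact: measurable_mono_gauss.
    - by move=> t _; rewrite lee_fin mono_gauss_ge0.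
  apply: ge0_le_integral => //.
  - by move=> t _; rewrite lee_fin expR_ge0.
  - by apply/measurable_EFinP; apply: measurable_funTS; exact: measurable_mono_gauss.
  - move=> t /=; rewrite in_itv/= => /andP[t1 t2]; rewrite lee_fin /mono_gauss.
    rewrite -[c]mul1r ler_pM ?expR_ge0//.
      case: ifPn => // a0; rewrite (lt_le_trans _ t1)//.
      by rewrite -[leLHS](powRr0 t) ler_powR// ltW.
    by rewrite ler_expR mulNr lerN2; nra.
rewrite -lte_fin (lt_le_trans _ h)// integral_cst//= lebesgue_measure_itv/= lte_fin ltr1n.
by rewrite -EFinB -EFinM lte_fin mulr_gt0 ?expR_gt0// subr_gt0 ltr1n.
Qed.

Definition mono_gauss_pdf a t := mono_gauss a t / mono_gauss_mass a.

Lemma mono_gauss_pdf_ge0 a t : 0 <= mono_gauss_pdf a t.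
Proof. by rewrite divr_ge0 ?mono_gauss_ge0// ltW// mono_gauss_mass_gt0. Qed.

Lemma measurable_mono_gauss_pdf a : measurable_fun setT (mono_gauss_pdf a).
Proof. by apply: measurable_funM => //; exact: measurable_mono_gauss. Qed.

Definition nu a : set R -> \bar R :=
  fun V => (\int[mu]_(x in V) (mono_gauss_pdf a x)%:E)%E.

Section nu_measure.
Variable a : R.

Let nu0 : nu a set0 = 0%E.
Proof. by rewrite /nu integral_set0. Qed.

Let nu_ge0 A : (0 <= nu a A)%E.
Proof. by apply: integral_ge0 => x _; rewrite lee_fin mono_gauss_pdf_ge0. Qed.

Let nu_sigma_additive : semi_sigma_additive (nu a).
Proof.
move=> /= F mF tF mUF; rewrite /nu; apply: cvg_toP.
  apply: ereal_nondecreasing_is_cvgn => m n mn.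
  apply: lee_sum_nneg_natr => // k _ _.
  by apply: integral_ge0 => /= x Fkx; rewrite lee_fin mono_gauss_pdf_ge0.
rewrite ge0_integral_bigcup//=.
- apply: measurable_funTS; apply: measurableT_comp => //.
  exact: measurable_mono_gauss_pdf.
- by move=> x _; rewrite lee_fin mono_gauss_pdf_ge0.
Qed.

HB.instance Definition _ := isMeasure.Build _ _ _ (nu a)
  nu0 nu_ge0 nu_sigma_additive.

Let nu_setT : nu a [set: _] = 1%:E.
Proof.
rewrite /nu /mono_gauss_pdf; under eq_integral do rewrite EFinM.
rewrite integralZr//; last exact: integrable_mono_gauss.
by rewrite mono_gauss_massE -EFinM divff// gt_eqF// mono_gauss_mass_gt0.
Qed.

HB.instance Definition _ := @Measure_isProbability.Build _ _ R (nu a) nu_setT.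

(* [measurableTypeR R], which carries Lebesgue measure, and [R] have the same measurable sets but are distinct structures. *)
Definition nu_borel : set (measurableTypeR R) -> \bar R := nu a.
HB.instance Definition _ := isMeasure.Build _ (measurableTypeR R) R nu_borel
  nu0 nu_ge0 nu_sigma_additive.

HB.instance Definition _ := @Measure_isProbability.Build _ (measurableTypeR R) R nu_borel nu_setT.

Let nu_dominated : nu_borel `<< mu.
Proof.
apply/null_content_dominatesP => A mA A0; rewrite /= /nu_borel /nu null_set_integral//.
by apply/measurable_EFinP; apply: measurable_funTS; exact: measurable_mono_gauss_pdf.
Qed.

(** The change of variables speaks of an abstract Radon-Nikodym derivative. The explicit density
    agrees with it almost everywhere, since both have the same integral over every measurable
    set. *)
Let mono_gauss_pdf_density :
  ae_eq mu setT (Radon_Nikodym_SigmaFinite.f nu_borel mu) (EFin \o mono_gauss_pdf a).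
Proof.
apply: integral_ae_eq => //.
- exact: Radon_Nikodym_SigmaFinite.f_integrable.
- by apply/measurable_EFinP; exact: measurable_mono_gauss_pdf.
- by move=> A _ mA; rewrite -Radon_Nikodym_SigmaFinite.f_integral.
Qed.

Lemma ge0_integral_nu_borel (f : R -> \bar R) :
  measurable_fun setT f -> (forall x, 0 <= f x)%E ->
  (\int[nu_borel]_x f x = \int[mu]_x ((mono_gauss_pdf a x)%:E * f x))%E.
Proof.
move=> mf f0; rewrite -(Radon_Nikodym_SigmaFinite.change_of_variables nu_dominated)//.
apply: ae_eq_integral => //.
- apply: emeasurable_funM => //; apply: measurable_int.
  exact: Radon_Nikodym_SigmaFinite.f_integrable.
- apply: emeasurable_funM => //.
  by apply/measurable_EFinP; exact: measurable_mono_gauss_pdf.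
- by apply: filterS mono_gauss_pdf_density => x /= px xT; rewrite px// muleC.
Qed.

(** The identity map between the two measurable structures pushes [nu_borel] forward to [nu a]. *)
Lemma ge0_integral_nu (f : R -> \bar R) :
  measurable_fun setT f -> (forall x, 0 <= f x)%E ->
  (\int[nu a]_x f x = \int[mu]_x ((mono_gauss_pdf a x)%:E * f x))%E.
Proof.
move=> mf f0; rewrite -ge0_integral_nu_borel//.
have mid : measurable_fun setT (id : measurableTypeR R -> R) by exact: measurable_id.
rewrite -(ge0_integral_pushforward mid nu_borel measurableT mf (fun x _ => f0 x)).
exact: eq_measure_integral.
Qed.

Lemma integral_nu (f : R -> \bar R) : measurable_fun setT f ->
  (\int[nu a]_x f x = \int[mu]_x ((mono_gauss_pdf a x)%:E * f x))%E.
Proof.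
move=> mf; rewrite integralE [RHS]integralE.
rewrite !ge0_integral_nu//; [|exact: measurable_funeneg|exact: measurable_funepos].
have p0 x : (0 <= (mono_gauss_pdf a x)%:E)%E by rewrite lee_fin mono_gauss_pdf_ge0.
congr (_ - _)%E; apply: eq_integral => x _.
- by rewrite !funeposE maxe_pMr// mule0.
- by rewrite !funenegE -muleN maxe_pMr// mule0.
Qed.

Lemma integrable_nu (f : R -> R) : measurable_fun setT f ->
  mu.-integrable setT (fun x => (mono_gauss_pdf a x * f x)%:E) ->
  (nu a).-integrable setT (EFin \o f).
Proof.
move=> mf /integrableP[mpf pf]; apply/integrableP; split.
  exact/measurable_EFinP.
rewrite ge0_integral_nu//; last first.
  by apply: measurableT_comp => //; exact/measurable_EFinP.
apply: le_lt_trans pf; rewrite le_eqVlt; apply/orP; left; apply/eqP.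
apply: eq_integral => x _.
by rewrite /= normrM (ger0_norm (mono_gauss_pdf_ge0 _ _)).
Qed.

End nu_measure.

(** Growth is measured by powers of a quantity that is at least 1: they increase with the exponent,
    so bounds for sums and products need no case analysis. *)
Definition pbound1 (f : R -> R) := exists (K : R) k, forall t, `|f t| <= K * (1 + t ^+ 2) ^+ k.

Lemma integrable_pdf_pbound1 a f : measurable_fun setT f -> pbound1 f ->
  mu.-integrable setT (fun x => (mono_gauss_pdf a x * f x)%:E).
Proof.
move=> mf [K [k fK]].
apply: (@le_integrable _ _ _ mu setT measurableT _ (fun t =>
    (K / mono_gauss_mass a * (mono_gauss a t * (1 + t ^+ 2) ^+ k))%:E)).
- apply/measurable_EFinP; apply: measurable_funM => //.
  exact: measurable_mono_gauss_pdf.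
- move=> t _; rewrite /= lee_fin.
  apply: le_trans (ler_norm _).
  rewrite normrM (ger0_norm (mono_gauss_pdf_ge0 _ _)) /mono_gauss_pdf.
  apply: (@le_trans _ _ (mono_gauss a t / mono_gauss_mass a * (K * (1 + t ^+ 2) ^+ k))).
    by rewrite ler_wpM2l// mono_gauss_pdf_ge0.
  by rewrite le_eqVlt; apply/orP; left; apply/eqP; ring.
- under eq_fun do rewrite EFinM.
  by apply: integrableZl => //; exact: integrable_mono_gauss_poly.
Qed.

Lemma integrable_nu_pbound1 a f : measurable_fun setT f -> pbound1 f ->
  (nu a).-integrable setT (EFin \o f).
Proof. by move=> mf bf; apply: integrable_nu => //; exact: integrable_pdf_pbound1. Qed.

Lemma Rintegral_nu a f : measurable_fun setT f ->
  \int[nu a]_x f x = \int[mu]_x (mono_gauss_pdf a x * f x).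
Proof.
move=> mf; by rewrite /Rintegral integral_nu//; exact/measurable_EFinP.
Qed.

Lemma pbound1_cst c : pbound1 (fun=> c).
Proof. by exists `|c|, 0 => t; rewrite expr0 mulr1. Qed.

Lemma pbound1_id : pbound1 id.
Proof. by exists 1, 1 => t; rewrite expr1 mul1r normr_le_oneDsqr. Qed.

Lemma pbound1P f : pbound1 f ->
  exists (K : R) k, 0 <= K /\ forall t, `|f t| <= K * (1 + t ^+ 2) ^+ k.
Proof.
move=> [K [k fK]]; exists K, k; split => //.
by have := fK 0; rewrite expr0n/= addr0 expr1n mulr1; apply: le_trans.
Qed.

Lemma pbound1M f g : pbound1 f -> pbound1 g -> pbound1 (fun t => f t * g t).
Proof.
move=> [K [k fK]] [L [l gL]]; exists (K * L), (k + l)%N => t.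
by rewrite normrM exprD mulrACA ler_pM.
Qed.

Lemma pbound1D f g : pbound1 f -> pbound1 g -> pbound1 (fun t => f t + g t).
Proof.
move=> /pbound1P[K [k [K0 fK]]] /pbound1P[L [l [L0 gL]]].
exists (K + L), (k + l)%N => t.
rewrite (le_trans (ler_normD _ _))// mulrDl lerD//.
- rewrite (le_trans (fK t))// ler_wpM2l// ler_weXn2l ?leq_addr//.
  exact: le1_oneDsqr.
- rewrite (le_trans (gL t))// ler_wpM2l// ler_weXn2l ?leq_addl//.
  exact: le1_oneDsqr.
Qed.

Lemma pbound1X f n : pbound1 f -> pbound1 (fun t => f t ^+ n).
Proof.
move=> [K [k fK]]; exists (K ^+ n), (k * n)%N => t.
by rewrite normrX exprM -exprMn lerXn2r// nnegrE ?(le_trans _ (fK t)).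
Qed.
End MonomialGaussian.

(** * The one-dimensional inequality *)

Section Barta.
Context {R : realType}.
Implicit Types (a t x : R) (k : nat).
Local Notation mu := (@lebesgue_measure R).
Local Notation p := mono_gauss_pdf.

(** The fundamental theorem of calculus applies on compact intervals and leaves boundary terms [e_].
    Dominated convergence, with majorant |psi|, lets the lower bound survive the exhaustion. *)
Lemma exhaustion_ge0 (I : set R) (psi : R -> R) (a_ b_ e_ : nat -> R) :
  measurable I -> mu.-integrable I (EFin \o psi) ->
  (forall n, `[a_ n, b_ n]%classic `<=` I) ->
  (forall x, I x -> \forall n \near \oo, x \in `[a_ n, b_ n]) ->
  e_ @ \oo --> (0 : R) ->
  (forall n, - e_ n <= \int[mu]_(x in `[a_ n, b_ n]) psi x) ->
  0 <= \int[mu]_(x in I) psi x.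
Proof.
move=> mI ipsi abI cov e0 epsi.
pose f_ n := EFin \o (psi \_ `[a_ n, b_ n]%classic).
have mpsi : measurable_fun I (EFin \o psi) by exact: measurable_int ipsi.
have [] // := @dominated_convergence _ _ _ mu I mI f_ (EFin \o psi)
    (fun x => `|(psi x)%:E|%E).
- move=> n; rewrite /f_ -restrict_EFin; apply/(measurable_restrict _ _ _) => //.
  exact: measurable_funS mpsi.
- apply: aeW => x Ix; apply: cvg_near_cst.
  near=> n; rewrite /f_ /= patchE mem_set//=.
  by near: n; exact: cov.
- exact: integrable_abse.
- by apply: aeW => x n Ix; rewrite /f_ /= lee_fin patchE; case: ifPn; rewrite ?normr0.
have fin : (\int[mu]_(x in I) (EFin \o psi) x)%E \is a fin_num.
  exact: integrable_fin_num.
move=> _ _; rewrite -(fineK fin) => /fine_cvgP[_ cv].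
rewrite /Rintegral; apply: (@ler_cvg_to _ _ _ _ (fun n => - e_ n) _ 0 _ _ cv).
- by rewrite -oppr0; exact: cvgN.
- near=> n; apply: le_trans (epsi n) _.
  rewrite /= /Rintegral /f_ [X in fine X <= _]integral_mkcond.
  rewrite le_eqVlt; apply/orP; left; apply/eqP; congr fine.
  rewrite [RHS]integral_mkcond; apply: eq_integral => x _ /=.
  rewrite restrict_EFin /= !patchE; case: ifPn => // xab.
  - have Ix : I x by apply: (abI n); rewrite inE in xab.
    by rewrite mem_set//= patchE xab.
  - by case: ifPn => //= _; rewrite patchE (negbTE xab).
Unshelve. all: by end_near. Qed.

Definition mono_supp a t := 0 < a -> 0 < t.

(** For [a = 0] the formula is right at [t = 0] too, because the quotient [0 / 0] is 0. *)
Lemma is_derive_mono_gauss_pdf a t : 0 <= a -> mono_supp a t ->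
  is_derive t 1 (p a) ((a / t - t) * p a t).
Proof.
move=> a0 at0; rewrite /p /mono_gauss.
have dE : is_derive t 1 (fun t => expR (- t ^+ 2 / 2)) (- t * expR (- t ^+ 2 / 2)).
  apply: is_derive_eq.
  by rewrite /GRing.scale/=; field.
have [a1|a1] := ltP 0 a.
  have t0 := at0 a1.
  apply: (@near_eq_is_derive _ _ _ (fun t => t `^ a * expR (- t ^+ 2 / 2) / mono_gauss_mass a)).
  - near=> u; rewrite ifT//.
    near: u; exact: lt_nbhsr.
  - have d1 := is_derive1_powR a t0.
    apply: is_derive_eq.
    rewrite ifT// /GRing.scale/=.
    rewrite -(mulr_powRB1 (ltW t0) a1).
    by field; rewrite !gt_eqF// mono_gauss_mass_gt0.
have a00 : a = 0 by apply/eqP; rewrite eq_le a1 a0.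
apply: is_derive_eq.
rewrite a00 /GRing.scale/= mul0r; field.
by rewrite !gt_eqF// mono_gauss_mass_gt0.
Unshelve. all: by end_near. Qed.

Definition C1pb1 (f f' : R -> R) :=
  [/\ forall t, is_derive t 1 f (f' t), continuous f', pbound1 f & pbound1 f'].

Lemma C1pb1_continuous f f' : C1pb1 f f' -> continuous f.
Proof.
move=> [df _ _ _] x; apply: differentiable_continuous.
by apply/derivable1_diffP; have := df x; case.
Qed.

Lemma C1pb1_meas f f' : C1pb1 f f' -> measurable_fun setT f.
Proof. by move=> /C1pb1_continuous/continuous_measurable_fun. Qed.

Lemma C1pb1_meas' f f' : C1pb1 f f' -> measurable_fun setT f'.
Proof. by move=> [_ /continuous_measurable_fun]. Qed.

(** The flux whose values at the ends of an interval are the boundary terms of Barta's trick. *)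
Definition barta a (h : R -> R) t := h t ^+ 2 * (2 * t / (t ^+ 2 - (a + 1))) * p a t.
Definition barta' a (h h' : R -> R) t :=
  let th := 2 * t / (t ^+ 2 - (a + 1)) in
  p a t * (2 * h t * h' t * th - h t ^+ 2 * th ^+ 2 - 2 * h t ^+ 2).

(* [x^2 - (a+1)] is an eigenfunction of eigenvalue 2, so [2x / (x^2 - (a+1))] is its logarithmic derivative and solves the Riccati equation which makes this derivative close up. *)
Lemma is_derive_barta a h h' t : 0 <= a -> C1pb1 h h' -> mono_supp a t ->
  t ^+ 2 != a + 1 -> is_derive t 1 (barta a h) (barta' a h h' t).
Proof.
move=> a0 [dh _ _ _] st tc.
have c0 : t ^+ 2 - (a + 1) != 0 by rewrite subr_eq0.
have dp := is_derive_mono_gauss_pdf a0 st.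
have dht := dh t.
have dq : is_derive t 1 (fun t => t ^+ 2 - (a + 1)) (2 * t).
  by apply: is_derive_eq; rewrite /GRing.scale/=; ring.
have dV := @is_deriveV _ (fun t => t ^+ 2 - (a + 1)) _ _ _ c0 dq.
apply: is_derive_eq.
rewrite /barta' /GRing.scale/=.
(* The term [a / t] in the derivative of the density makes 0 a special point; it lies in the support
   only for [a = 0]. *)
have [t0|t0] := eqVneq t 0; last by field; rewrite t0 c0.
have a00 : a = 0.
  apply/eqP; rewrite eq_le a0 andbT leNgt; apply/negP => /st.
  by rewrite t0 ltxx.
rewrite t0 a00.
have -> : 0 ^+ 2 - (0 + 1) = -1 :> R by ring.
by rewrite invrN1 mul0r; ring.
Qed.

(** The difference is the completed square [p a t * (h' t - h t * th) ^+ 2]. *)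
Lemma barta'_le a h h' t : barta' a h h' t <= p a t * (h' t ^+ 2 - 2 * h t ^+ 2).
Proof.
rewrite /barta'/=; set th := _ / _; rewrite ler_wpM2l ?mono_gauss_pdf_ge0//.
rewrite lerD2r; have := sqr_ge0 (h' t - h t * th); nra.
Qed.

Lemma continuous_mono_gauss_pdf a t : 0 <= a -> mono_supp a t ->
  {for t, continuous (p a)}.
Proof.
move=> a0 st; apply: differentiable_continuous; apply/derivable1_diffP.
by case: (is_derive_mono_gauss_pdf a0 st).
Qed.

Lemma continuous_barta' a h h' t : 0 <= a -> C1pb1 h h' -> mono_supp a t ->
  t ^+ 2 != a + 1 -> {for t, continuous (barta' a h h')}.
Proof.
move=> a0 hh st tc.
have ch := C1pb1_continuous hh; have [_ ch' _ _] := hh.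
have cth : {for t, continuous (fun t => 2 * t / (t ^+ 2 - (a + 1)))}.
  apply: cvgM.
    by apply: cvgM; [exact: cvg_cst|exact: cvg_id].
  apply: cvgV; first by rewrite subr_eq0.
  apply: cvgB; last exact: cvg_cst.
  exact: exprn_continuous.
have sq (f : R -> R) : {for t, continuous f} -> {for t, continuous (fun x => f x ^+ 2)}.
  move=> cf; rewrite (_ : (fun x => f x ^+ 2) = (fun x => f x * f x)); last first.
    by apply/funext => x; rewrite expr2.
  exact: cvgM.
apply: cvgM; first exact: continuous_mono_gauss_pdf.
apply: cvgB.
  apply: cvgB.
    apply: cvgM => //; apply: cvgM; last exact: ch'.
    by apply: cvgM; [exact: cvg_cst|exact: ch].
  by apply: cvgM; [exact: (sq h (ch t))|exact: (sq _ cth)].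
apply: cvgM; first exact: cvg_cst.
exact: (sq h (ch t)).
Qed.

(** The logarithmic derivative has a simple pole at a node, while h^2 has a double zero there. *)
Lemma barta_cvg_node a h h' z : 0 <= a -> C1pb1 h h' -> mono_supp a z ->
  z ^+ 2 = a + 1 -> h z = 0 -> barta a h x @[x --> z^'] --> 0.
Proof.
move=> a0 hh sz zc hz.
have [dh _ _ _] := hh.
have z0 : z != 0.
  by apply/eqP => z0; move: zc; rewrite z0 expr0n/= => /eqP; rewrite lt_eqF// ltr_wpDl.
(* With h(x) = g(x) (x - z) the pole cancels exactly, leaving one factor x - z in a continuous
   expression. *)
have /is_derive1_caratheodory[g [hg cg gz]] := dh z.
have -> : 0 = g z ^+ 2 * (z - z) * (2 * z / (z + z)) * p a z.
  by rewrite subrr mulr0 !mul0r.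
have zz0 : z + z != 0 by rewrite -mulr2n mulrn_eq0.
have : g x ^+ 2 * (x - z) * (2 * x / (x + z)) * p a x @[x --> z^'] -->
   g z ^+ 2 * (z - z) * (2 * z / (z + z)) * p a z.
  apply: cvg_within_filter; apply: cvgM; last exact: continuous_mono_gauss_pdf.
  apply: cvgM; last first.
    apply: cvgM.
      by apply: cvgM; [exact: cvg_cst|exact: cvg_id].
    apply: cvgV => //.
    by apply: cvgD; [exact: cvg_id|exact: cvg_cst].
  apply: cvgM; first by under eq_fun do rewrite expr2; exact: cvgM.
  by apply: cvgB; [exact: cvg_id|exact: cvg_cst].
apply: cvg_trans; apply: near_eq_cvg; near=> x.
have xz : x - z != 0.
  rewrite subr_eq0; near: x; exact: nbhs_dnbhs_neq.
have xz' : x + z != 0.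
  near: x; apply: nbhs_dnbhs.
  have : (x + z) @[x --> z] --> z + z by apply: cvgD; [exact: cvg_id|exact: cvg_cst].
  by move/cvgr_neq0; apply.
rewrite /barta -zc.
have -> : h x = g x * (x - z) by rewrite -hg hz subr0.
have -> : x ^+ 2 - z ^+ 2 = (x - z) * (x + z) by ring.
by field; rewrite xz xz'.
Unshelve. all: by end_near. Qed.

(** The flux at the ends need only be bounded on the useful side by null sequences: at a node it
    tends to 0, at 0 or at infinity its sign is enough. *)
Lemma barta_interval a h h' (I : set R) (a_ b_ ea eb : nat -> R) :
  0 <= a -> C1pb1 h h' -> measurable I ->
  (forall x, I x -> mono_supp a x /\ x ^+ 2 != a + 1) ->
  (forall n, a_ n < b_ n) ->
  (forall n, `[a_ n, b_ n]%classic `<=` I) ->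
  (forall x, I x -> \forall n \near \oo, x \in `[a_ n, b_ n]) ->
  ea @ \oo --> (0 : R) -> eb @ \oo --> (0 : R) ->
  (forall n, barta a h (a_ n) <= ea n) -> (forall n, eb n <= barta a h (b_ n)) ->
  0 <= \int[mu]_(x in I) (p a x * (h' x ^+ 2 - 2 * h x ^+ 2)).
Proof.
move=> a0 hh mI IU ab abI cov ea0 eb0 Ba Bb.
have [dh ch' bh bh'] := hh.
have int : mu.-integrable setT (fun x => (p a x * (h' x ^+ 2 - 2 * h x ^+ 2))%:E).
  apply: integrable_pdf_pbound1.
    apply: measurable_funB.
      by apply: measurable_funX; exact: C1pb1_meas' hh.
    apply: measurable_funM => //.
    by apply: measurable_funX; exact: C1pb1_meas hh.
  apply: pbound1D; first exact: pbound1X.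
  have -> : (fun t => - (2 * h t ^+ 2)) = (fun t => (- 2) * h t ^+ 2).
    by apply/funext => t; rewrite mulNr.
  by apply: pbound1M; [exact: pbound1_cst|exact: pbound1X].
have iI (J : set R) : measurable J -> mu.-integrable J (fun x => (p a x * (h' x ^+ 2 - 2 * h x ^+ 2))%:E).
  by move=> mJ; apply: integrableS int.
apply: (@exhaustion_ge0 I _ a_ b_ (fun n => ea n - eb n)) => //.
- exact: iI.
- by rewrite -[X in _ --> X](subrr 0); apply: cvgB.
move=> n.
have inU x : x \in `[a_ n, b_ n] -> mono_supp a x /\ x ^+ 2 != a + 1.
  by move=> xab; apply: IU; apply: (abI n).
have inb x : x \in `]a_ n, b_ n[ -> x \in `[a_ n, b_ n].
  by rewrite !in_itv/= => /andP[/ltW -> /ltW ->].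
have dB x : x \in `[a_ n, b_ n] -> is_derive x 1 (barta a h) (barta' a h h' x).
  by move=> /inU[? ?]; exact: is_derive_barta.
have cB x : x \in `[a_ n, b_ n] -> {for x, continuous (barta a h)}.
  move=> /dB[d _]; apply: differentiable_continuous; exact/derivable1_diffP.
have aab : a_ n \in `[a_ n, b_ n] by rewrite in_itv/= lexx ltW.
have bab : b_ n \in `[a_ n, b_ n] by rewrite in_itv/= lexx ltW.
have cB' : {within `[a_ n, b_ n], continuous (barta' a h h')}.
  apply: continuous_in_subspaceT => x; rewrite inE/= => /inU[? ?].
  exact: continuous_barta'.
have := @continuous_FTC2 R (barta' a h h') (barta a h) _ _ (ab n) cB'.
have h1 : derivable_oo_LRcontinuous (barta a h) (a_ n) (b_ n).
  split.
  - by move=> x /inb/dB[].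
  - by apply: cvg_at_right_filter; exact: cB.
  - by apply: cvg_at_left_filter; exact: cB.
have h2 : {in `]a_ n, b_ n[, (barta a h)^`()%classic =1 barta' a h h'}.
  by move=> x /inb/dB[_ <-]; rewrite derive1E.
move=> /(_ h1 h2) FTC.
apply: (@le_trans _ _ (barta a h (b_ n) - barta a h (a_ n))).
  by rewrite opprB lerB.
rewrite -lee_fin /Rintegral fineK; last first.
  by apply: integrable_fin_num => //; exact: iI.
rewrite EFinB -FTC; apply: le_integral => //.
- by apply: continuous_compact_integrable => //; exact: segment_compact.
- exact: iI.
- by move=> x _; rewrite lee_fin barta'_le.
Qed.

End Barta.

(** * Gluing the nodal intervals *)

Section BartaPoincare.
Context {R : realType}.
Implicit Types (a t x : R) (k : nat).
Local Notation mu := (@lebesgue_measure R).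
Local Notation p := mono_gauss_pdf.

(** At most 1/3, so that an interval shortened at both ends by this fraction of its length keeps a
    positive length. *)
Let u (n : nat) : R := harmonic n / 3.

Let u_gt0 n : 0 < u n.
Proof. by rewrite divr_gt0// harmonic_gt0. Qed.

Let u_le n : u n <= 3^-1.
Proof. by rewrite ler_pdivrMr// mulVf// invf_le1// ler1n. Qed.

Let u_cvg (c : R) : (fun n => c * u n) @ \oo --> (0 : R).
Proof.
rewrite -[X in _ --> X](mulr0 c); apply: cvgM; first exact: cvg_cst.
rewrite -[X in _ --> X](mul0r 3^-1); apply: cvgM; [exact: cvg_harmonic|exact: cvg_cst].
Qed.

Let u_small (c e : R) : 0 < e -> \forall n \near \oo, c * u n <= e.
Proof. by move=> e0; apply: (cvgr_le 0) => //; exact: u_cvg. Qed.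

Let n_large (M : R) : \forall n \near \oo, M <= n.+1%:R.
Proof.
near=> n; rewrite (@le_trans _ _ n%:R)// ?ler_nat//.
by near: n; exact: nbhs_infty_ger.
Unshelve. all: by end_near. Qed.

Let seq_node a h h' z c : 0 <= a -> C1pb1 h h' -> mono_supp a z ->
  z ^+ 2 = a + 1 -> h z = 0 -> c != 0 ->
  (fun n => barta a h (z + c * u n)) @ \oo --> (0 : R).
Proof.
move=> a0 hh sz zc hz c0.
have /cvgr_dnbhsP := barta_cvg_node a0 hh sz zc hz; apply; split.
  by move=> n; rewrite -subr_eq0 addrAC subrr add0r mulf_neq0// gt_eqF.
rewrite -[X in _ --> X]addr0; apply: cvgD; [exact: cvg_cst|exact: u_cvg].
Qed.

Lemma barta_poincare a h h' : 0 <= a -> C1pb1 h h' ->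
  (forall z, mono_supp a z -> z ^+ 2 = a + 1 -> h z = 0) ->
  2 * \int[nu a]_x (h x ^+ 2) <= \int[nu a]_x (h' x ^+ 2).
Proof.
move=> a0 hh hz.
pose s := Num.sqrt (a + 1).
have a10 : 0 < a + 1 by rewrite ltr_wpDl.
have s0 : 0 < s by rewrite sqrtr_gt0.
have s2 : s ^+ 2 = a + 1 by rewrite sqr_sqrtr// ltW.
(* The left end of the middle nodal interval: the edge of the support if [a > 0], otherwise the
   second node. *)
pose l := if 0 < a then 0 else - s.
have ls : l < s.
  by rewrite /l; case: ifP => // _; rewrite (lt_trans _ s0)// oppr_lt0.
have ls0 : 0 < s - l by rewrite subr_gt0.
have sl : - s <= l by rewrite /l; case: ifP => // _; rewrite oppr_le0 ltW.
have ss : mono_supp a s by [].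
have hs0 : h s = 0 by apply: hz.
pose psi x := p a x * (h' x ^+ 2 - 2 * h x ^+ 2).
have mh : measurable_fun setT h by exact: C1pb1_meas hh.
have mh' : measurable_fun setT h' by exact: C1pb1_meas' hh.
have [dh ch' bh bh'] := hh.
have int : mu.-integrable setT (EFin \o psi).
  apply: integrable_pdf_pbound1.
    apply: measurable_funB; first exact: measurable_funX.
    by apply: measurable_funM => //; exact: measurable_funX.
  apply: pbound1D; first exact: pbound1X.
  have -> : (fun t => - (2 * h t ^+ 2)) = (fun t => (- 2) * h t ^+ 2).
    by apply/funext => t; rewrite mulNr.
  by apply: pbound1M; [exact: pbound1_cst|exact: pbound1X].
have iJ (J : set R) : measurable J -> mu.-integrable J (EFin \o psi).
  by move=> mJ; apply: integrableS int.
have c0 n : (fun=> 0 : R) @ \oo --> (0 : R) by move=> ?; exact: cvg_cst.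
(* Beyond [s] the flux is nonnegative, so 0 bounds it from below at the far end. *)
have I3 : 0 <= \int[mu]_(x in `]s, +oo[) psi x.
  apply: (@barta_interval _ a h h' _ (fun n => s + u n) (fun n => s + n.+1%:R)
    (fun n => barta a h (s + 1 * u n)) (fun=> 0)) => //.
  - move=> x /=; rewrite in_itv/= andbT => sx; split.
      by move=> _; exact: lt_trans sx.
    by rewrite -s2 gt_eqF// ltr_pXn2r// ?nnegrE ltW// (lt_trans s0).
  - move=> n; rewrite ltrD2l (le_lt_trans (u_le n))// (@lt_le_trans _ _ 1)//.
      by rewrite invf_lt1// ltr1n.
    by rewrite ler1n.
  - move=> n x /=; rewrite !in_itv/= andbT => /andP[+ _]; apply: lt_le_trans.
    by rewrite ltrDl.
  - move=> x /=; rewrite in_itv/= andbT => sx.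
    near=> n; rewrite in_itv/= -lerBrDl -[x <= _]lerBlDl; apply/andP; split.
      rewrite -[u n]mul1r; near: n; apply: u_small; by rewrite subr_gt0.
    by near: n; exact: n_large.
  - by apply: seq_node hh _ _ _ _ => //; rewrite oner_neq0.
  - exact: cvg_cst.
  - by move=> n; rewrite mul1r.
  - move=> n; rewrite /barta mulr_ge0 ?mono_gauss_pdf_ge0// mulr_ge0 ?sqr_ge0//.
    have n0 : 0 < n.+1%:R :> R by rewrite ltr0n.
    by rewrite divr_ge0// ?subr_ge0 -?s2; nra.
(* If [a > 0], the end 0 is no node, but between 0 and [s] the eigenfunction is negative and the
   flux nonpositive, which is the sign required at a left end. *)
have I2 : 0 <= \int[mu]_(x in `]l, s[) psi x.
  apply: (@barta_interval _ a h h' _ (fun n => l + (s - l) * u n) (fun n => s + - (s - l) * u n)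
    (fun n => if 0 < a then 0 else barta a h (l + (s - l) * u n))
    (fun n => barta a h (s + - (s - l) * u n))) => //.
  - move=> x /=; rewrite in_itv/= => /andP[lx xs]; split.
      by move=> a1; move: lx; rewrite /l a1.
    rewrite -s2 -subr_eq0 subr_sqr mulf_neq0//; first by rewrite subr_eq0 lt_eqF.
    by rewrite gt_eqF// -ltrBlDr sub0r (le_lt_trans sl).
  - move=> n; rewrite mulNr; have := u_le n; have := u_gt0 n; nra.
  - move=> n x /=; rewrite !in_itv/= mulNr => /andP[lx xs].
    have := u_gt0 n => un; apply/andP; split; nra.
  - move=> x /=; rewrite in_itv/= => /andP[lx xs].
    near=> n.
    have h1 : (s - l) * u n <= x - l by near: n; apply: u_small; rewrite subr_gt0.
    have h2 : (s - l) * u n <= s - x by near: n; apply: u_small; rewrite subr_gt0.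
    by rewrite in_itv/= mulNr; apply/andP; split; lra.
  - case: (ltP 0 a) => a1; first exact: cvg_cst.
    have sl' : mono_supp a l by move=> /(le_lt_trans a1); rewrite ltxx.
    have l2 : l ^+ 2 = a + 1 by rewrite /l ltNge a1/= sqrrN.
    by apply: seq_node hh _ _ _ _ => //; [exact: hz|rewrite gt_eqF].
  - by apply: seq_node hh _ _ _ _ => //; rewrite oppr_eq0 gt_eqF.
  - move=> n; case: ifPn => // a1; rewrite /barta.
    rewrite mulr_le0_ge0 ?mono_gauss_pdf_ge0// mulr_ge0_le0 ?sqr_ge0//.
    have l0 : l = 0 by rewrite /l a1.
    have un := u_gt0 n; have un3 := u_le n.
    rewrite l0 subr0 add0r mulr_ge0_le0//.
      by rewrite mulr_ge0// mulr_ge0 ?ltW.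
    rewrite invr_le0 subr_le0 -s2 exprMn ler_piMr ?sqr_ge0//.
    by rewrite expr_le1 ?ltW// (le_lt_trans un3)// invf_lt1// ltr1n.
(* For [a > 0] the density vanishes here; for [a = 0] this mirrors the interval beyond [s]. *)
have I1 : 0 <= \int[mu]_(x in `]-oo, l]) psi x.
  have [a1|a1] := ltP 0 a.
    rewrite (_ : \int[mu]_(x in _) _ = 0)//.
    under eq_Rintegral.
      move=> x; rewrite inE/= in_itv/= /l a1 => x0.
      rewrite /psi /mono_gauss_pdf /mono_gauss a1 ltNge x0/= !mul0r.
      over.
    by rewrite Rintegral_cst// mul0r.
  have sl' : mono_supp a l by move=> /(le_lt_trans a1); rewrite ltxx.
  have lE : l = - s by rewrite /l ltNge a1.
  have l2 : l ^+ 2 = a + 1 by rewrite lE sqrrN.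
  rewrite -Rintegral_itv_bndo_bndc; last exact: iJ.
  apply: (@barta_interval _ a h h' _ (fun n => l - n.+1%:R) (fun n => l + - 1 * u n)
    (fun=> 0) (fun n => barta a h (l + - 1 * u n))) => //.
  - move=> x /=; rewrite in_itv/= => xl; split.
      by move=> /(le_lt_trans a1); rewrite ltxx.
    rewrite -s2 -subr_eq0 subr_sqr mulf_neq0//.
      by rewrite subr_eq0 lt_eqF// (lt_trans xl).
    by rewrite lt_eqF// -ltrBrDr sub0r -lE.
  - move=> n; rewrite ltrD2l mulN1r ltrN2 (le_lt_trans (u_le n))// (@lt_le_trans _ _ 1)//.
      by rewrite invf_lt1// ltr1n.
    by rewrite ler1n.
  - move=> n x /=; rewrite !in_itv/= => /andP[_]; move/le_lt_trans; apply.
    by rewrite mulN1r ltrBlDr ltrDl.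
  - move=> x /=; rewrite in_itv/= => xl.
    near=> n.
    have h1 : 1 * u n <= l - x by near: n; apply: u_small; rewrite subr_gt0.
    have h2 : l - x <= n.+1%:R by near: n; exact: n_large.
    by rewrite in_itv/=; apply/andP; split; lra.
  - exact: cvg_cst.
  - by apply: seq_node hh _ _ _ _ => //; rewrite ?oppr_eq0 ?oner_neq0//; exact: hz.
  - move=> n; rewrite /barta mulr_le0_ge0 ?mono_gauss_pdf_ge0//.
    rewrite mulr_ge0_le0 ?sqr_ge0//.
    have l0 : l < 0 by rewrite lE oppr_lt0.
    have n0 : 0 < n.+1%:R :> R by rewrite ltr0n.
    rewrite mulr_le0_ge0//; first by nra.
    by rewrite invr_ge0 subr_ge0 -l2; nra.
have : 0 <= \int[mu]_x psi x.
  have e1 := @Rintegral_itvB _ psi (BInfty R true) (BInfty R false) l.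
  have e2 := @Rintegral_itvB _ psi (BRight l) (BInfty R false) s.
  move: e1 e2; rewrite set_itvNyy => /(_ int isT isT) /eqP; rewrite subr_eq => /eqP ->.
  move=> /(_ (iJ _ _)) e2.
  have {}e2 : \int[mu]_(t in `]l, +oo[) psi t - \int[mu]_(t in `]l, s]) psi t
     = \int[mu]_(x in `]s, +oo[) psi x.
    by apply: e2 => //; rewrite bnd_simp ltW.
  move/eqP : e2; rewrite subr_eq => /eqP ->.
  rewrite -(@Rintegral_itv_bndo_bndc _ (BRight l) s); last exact: iJ.
  by rewrite !addr_ge0.
rewrite -subr_ge0 => /le_trans; apply.
rewrite (Rintegral_nu a (f := fun x => h' x ^+ 2)); last exact: measurable_funX.
rewrite (Rintegral_nu a (f := fun x => h x ^+ 2)); last exact: measurable_funX.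
have i1 : mu.-integrable setT (fun x => (p a x * h' x ^+ 2)%:E).
  by apply: integrable_pdf_pbound1; [exact: measurable_funX|exact: pbound1X].
have i2 : mu.-integrable setT (fun x => (p a x * h x ^+ 2)%:E).
  by apply: integrable_pdf_pbound1; [exact: measurable_funX|exact: pbound1X].
rewrite -RintegralZl// -RintegralB//; last first.
  by have := integrableZl measurableT 2 i2; apply: eq_integrable => // x _; rewrite -EFinM.
rewrite le_eqVlt; apply/orP; left; apply/eqP; apply: eq_Rintegral => x _.
by rewrite /psi; ring.
Unshelve. all: by end_near. Qed.

End BartaPoincare.

(** * Expectations on the line, Gaussian integration by parts and the one-dimensional core
    inequality *)

Section GaussianLine.
Context {R : realType}.
Implicit Types (a t x : R) (k : nat).
Local Notation mu := (@lebesgue_measure R).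
Local Notation p := mono_gauss_pdf.

Definition pbm1 (f : R -> R) := measurable_fun setT f /\ pbound1 f.

Lemma pbm1_cst c : pbm1 (fun=> c).
Proof. by split; [exact: measurable_cst|exact: pbound1_cst]. Qed.

Lemma pbm1_id : pbm1 id.
Proof. by split; [exact: measurable_id|exact: pbound1_id]. Qed.

Lemma pbm1M f g : pbm1 f -> pbm1 g -> pbm1 (fun t => f t * g t).
Proof. by move=> [? ?] [? ?]; split; [exact: measurable_funM|exact: pbound1M]. Qed.

Lemma pbm1D f g : pbm1 f -> pbm1 g -> pbm1 (fun t => f t + g t).
Proof. by move=> [? ?] [? ?]; split; [exact: measurable_funD|exact: pbound1D]. Qed.

Lemma pbm1X f n : pbm1 f -> pbm1 (fun t => f t ^+ n).
Proof. by move=> [? ?]; split; [exact: measurable_funX|exact: pbound1X]. Qed.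

Lemma pbm1Z c f : pbm1 f -> pbm1 (fun t => c * f t).
Proof. by move=> mf; apply: pbm1M => //; exact: pbm1_cst. Qed.

Lemma pbm1_integrable a f : pbm1 f -> (nu a).-integrable setT (EFin \o f).
Proof. by move=> [? ?]; exact: integrable_nu_pbound1. Qed.

Lemma C1pb1_pbm1 f f' : C1pb1 f f' -> pbm1 f.
Proof. by move=> h; split; [exact: C1pb1_meas h|case: h]. Qed.

Lemma C1pb1_pbm1' f f' : C1pb1 f f' -> pbm1 f'.
Proof. by move=> h; split; [exact: C1pb1_meas' h|case: h]. Qed.

Lemma Rintegral_prob_cst d (T : measurableType d) (P : probability T R) (c : R) :
  \int[P]_x c = c.
Proof.
transitivity (c * fine (P setT)); first exact: Rintegral_cst.
by rewrite probability_setT mulr1.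
Qed.

Definition E1 a (f : R -> R) := \int[nu a]_x f x.

Lemma E1D a f g : pbm1 f -> pbm1 g -> E1 a (fun x => f x + g x) = E1 a f + E1 a g.
Proof. by move=> ? ?; rewrite /E1 RintegralD//; exact: pbm1_integrable. Qed.

Lemma E1Z a c f : pbm1 f -> E1 a (fun x => c * f x) = c * E1 a f.
Proof. by move=> ?; rewrite /E1 RintegralZl//; exact: pbm1_integrable. Qed.

Lemma E1_cst a c : E1 a (fun=> c) = c.
Proof. exact: Rintegral_prob_cst. Qed.

Lemma E1_ge0 a f : (forall x, 0 <= f x) -> 0 <= E1 a f.
Proof. by move=> f0; exact: Rintegral_ge0. Qed.

Lemma E1_le a f g : pbm1 f -> pbm1 g -> (forall x, f x <= g x) -> E1 a f <= E1 a g.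
Proof. by move=> ? ? fg; apply: le_Rintegral => //; exact: pbm1_integrable. Qed.

Lemma E1_sqrD a f c d : pbm1 f ->
  E1 a (fun x => (c + d * f x) ^+ 2) = c ^+ 2 + 2 * c * d * E1 a f + d ^+ 2 * E1 a (fun x => f x ^+ 2).
Proof.
move=> mf; have mf2 := pbm1X 2 mf.
have m1 := pbm1Z (2 * c * d) mf; have m2 := pbm1Z (d ^+ 2) mf2.
have mc := pbm1_cst (c ^+ 2).
rewrite -!E1Z// -[X in _ = X + _ + _](E1_cst a) -!E1D//.
  by congr E1; apply/funext => x; ring.
exact: pbm1D.
Qed.

Lemma E1_sqr_ge a f : pbm1 f -> E1 a f ^+ 2 <= E1 a (fun x => f x ^+ 2).
Proof.
move=> mf.
have : 0 <= E1 a (fun x => (- E1 a f + 1 * f x) ^+ 2) by apply: E1_ge0 => x; exact: sqr_ge0.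
by rewrite E1_sqrD//; lra.
Qed.

Lemma C1pb1_affine f f' c d : C1pb1 f f' ->
  C1pb1 (fun x => f x + (c + d * x)) (fun x => f' x + d).
Proof.
move=> hf; have [df cf' bf bf'] := hf; split.
- move=> t; have := df t => dft.
  by apply: is_derive_eq; rewrite /GRing.scale/=; ring.
- by move=> x; apply: cvgD; [exact: cf'|exact: cvg_cst].
- apply: pbound1D => //; apply: pbound1D; first exact: pbound1_cst.
  by apply: pbound1M; [exact: pbound1_cst|exact: pbound1_id].
- by apply: pbound1D => //; exact: pbound1_cst.
Qed.

(** It makes the boundary terms of the integration by parts vanish at infinity. *)
Lemma mono_gauss_pdf_decay a f : pbound1 f -> exists2 C : R, 0 <= C &
  forall t, `|f t * p a t| <= C / (1 + t ^+ 2).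
Proof.
move=> /pbound1P[K [k [K0 fK]]].
have [C C0 hC] := mono_gauss_poly_le a k.+1.
have s20 : Num.sqrt 2 != 0 :> R by rewrite sqrtr_eq0 -ltNge.
have m0 := mono_gauss_mass_gt0 a.
exists (K / mono_gauss_mass a * (C * normal_peak (Num.sqrt 2))).
  by rewrite mulr_ge0// ?divr_ge0 ?(ltW m0)// mulr_ge0// normal_peak_ge0.
move=> t.
have o0 : 0 < 1 + t ^+ 2 by rewrite ltr_pwDl// sqr_ge0.
rewrite ler_pdivlMr// normrM (ger0_norm (mono_gauss_pdf_ge0 _ _)) /mono_gauss_pdf.
apply: (@le_trans _ _ (K / mono_gauss_mass a * (mono_gauss a t * (1 + t ^+ 2) ^+ k.+1))).
  apply: (@le_trans _ _ (K * (1 + t ^+ 2) ^+ k * (mono_gauss a t / mono_gauss_mass a) * (1 + t ^+ 2))).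
    by rewrite ler_wpM2r ?(ltW o0)// ler_wpM2r// divr_ge0 ?mono_gauss_ge0// ltW.
  by rewrite le_eqVlt; apply/orP; left; apply/eqP; rewrite (exprS _ k); ring.
rewrite ler_wpM2l// ?divr_ge0 ?(ltW m0)//.
rewrite (le_trans (hC t))// ler_wpM2l//; exact: normal_pdf_ub.
Qed.

(** The derivative of f p is p (f' - x f). Exhaustion yields one inequality only; replacing [f] by
    its opposite gives the other. *)
Lemma gauss_ibp_ge f f' : C1pb1 f f' -> E1 0 (fun x => x * f x) <= E1 0 f'.
Proof.
move=> hf; have [df cf' bf bf'] := hf.
have mf := C1pb1_pbm1 hf; have mf' := C1pb1_pbm1' hf.
have mxf : pbm1 (fun x => x * f x) by apply: pbm1M => //; exact: pbm1_id.
have mNxf : pbm1 (fun x => (-1) * (x * f x)) by apply: pbm1M => //; exact: pbm1_cst.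
rewrite -subr_ge0 -mulN1r -E1Z// -E1D// /E1.
set psi := fun x : R => _; have mpsi : pbm1 psi by exact: pbm1D.
rewrite Rintegral_nu; last by case: mpsi.
have ipsi : mu.-integrable setT (EFin \o (fun x => p 0 x * psi x)).
  by case: mpsi => ? ?; exact: integrable_pdf_pbound1.
have [C C0 hC] := mono_gauss_pdf_decay 0 bf.
have s0 t : mono_supp 0 t by rewrite /mono_supp ltxx.
have dB x : is_derive x 1 (fun x => f x * p 0 x) (p 0 x * psi x).
  have dfx := df x; have dpx := is_derive_mono_gauss_pdf (lexx 0) (s0 x).
  by apply: is_derive_eq; rewrite /GRing.scale/= mul0r /psi; ring.
have cf := C1pb1_continuous hf.
have cp x : {for x, continuous (p 0)} by exact: continuous_mono_gauss_pdf.
have cB x : {for x, continuous (fun x => f x * p 0 x)}.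
  by apply: cvgM; [exact: cf|exact: cp].
apply: (@exhaustion_ge0 _ setT _ (fun n => - n.+1%:R) (fun n => n.+1%:R)
  (fun n => 2 * C * harmonic n)) => //.
- move=> x _; near=> n.
  have h : `|x| <= n.+1%:R.
    rewrite (@le_trans _ _ n%:R)// ?ler_nat//.
    by near: n; exact: nbhs_infty_ger.
  by rewrite in_itv/= -ler_norml.
- rewrite -[X in _ --> X](mulr0 (2 * C)); apply: cvgM; first exact: cvg_cst.
  exact: cvg_harmonic.
move=> n.
have n0 : 0 < n.+1%:R :> R by rewrite ltr0n.
have ab : - n.+1%:R < n.+1%:R :> R by lra.
have cB' : {within `[- n.+1%:R, n.+1%:R], continuous (fun x => p 0 x * psi x)}.
  apply: continuous_subspaceT => x; apply: cvgM; first exact: cp.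
  apply: cvgD; first exact: cf'.
  apply: cvgM; first exact: cvg_cst.
  by apply: cvgM; [exact: cvg_id|exact: cf].
have h1 : derivable_oo_LRcontinuous (fun x => f x * p 0 x) (- n.+1%:R) n.+1%:R.
  split.
  - by move=> x _; case: (dB x).
  - by apply: cvg_at_right_filter; exact: cB.
  - by apply: cvg_at_left_filter; exact: cB.
have h2 : {in `]- n.+1%:R, n.+1%:R[, (fun x => f x * p 0 x)^`()%classic =1 (fun x => p 0 x * psi x)}.
  by move=> x _; rewrite derive1E; case: (dB x).
have FTC := continuous_FTC2 ab cB' h1 h2.
rewrite /Rintegral FTC/=.
have bd (e : R) : e ^+ 2 = n.+1%:R ^+ 2 -> `|f e * p 0 e| <= C * harmonic n.
  move=> e2; rewrite (le_trans (hC e))// ler_wpM2l// e2 /harmonic lef_pV2 ?posrE//.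
    rewrite (@le_trans _ _ (n.+1%:R ^+ 2))// ?lerDr//.
    by rewrite expr2 ler_peMl ?(ltW n0)// ler1n.
have /ler_normlP[b1 _] := bd n.+1%:R erefl.
have /ler_normlP[_ b2] := bd (- n.+1%:R) (sqrrN _).
have -> : 2 * C / n.+1%:R = C * harmonic n + C * harmonic n.
  by rewrite /harmonic/= -mulrA mulr_natl mulr2n.
by rewrite opprD lerD// ?lerN2// lerNl.
Unshelve. all: by end_near. Qed.

Lemma gauss_ibp f f' : C1pb1 f f' -> E1 0 f' = E1 0 (fun x => x * f x).
Proof.
move=> hf; apply/eqP; rewrite eq_le gauss_ibp_ge// andbT.
have [df cf' bf bf'] := hf.
have mf := C1pb1_pbm1 hf; have mf' := C1pb1_pbm1' hf.
have hN : C1pb1 (fun x => - 1 * f x) (fun x => - 1 * f' x).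
  split.
  - move=> t; have := df t => dft.
    by apply: is_derive_eq; rewrite /GRing.scale/= ?mulr0 ?addr0.
  - by move=> x; apply: cvgM; [exact: cvg_cst|exact: cf'].
  - by apply: pbound1M => //; exact: pbound1_cst.
  - by apply: pbound1M => //; exact: pbound1_cst.
have mxf : pbm1 (fun x => x * f x) by apply: pbm1M => //; exact: pbm1_id.
have := gauss_ibp_ge hN; rewrite E1Z//.
under [X in E1 _ X]eq_fun do rewrite mulrCA.
by rewrite E1Z// !mulN1r lerN2.
Qed.

Lemma C1pb1X n : C1pb1 (fun x : R => x ^+ n.+1) (fun x => n.+1%:R * x ^+ n).
Proof.
split.
- move=> t; rewrite (_ : (fun x => x ^+ n.+1) = id ^+ n.+1); last first.
    by apply/funext => x; rewrite exprfctE.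
  by apply: is_derive_eq; rewrite /GRing.scale/= mulr1.
- move=> x; apply: cvgM; first exact: cvg_cst.
  exact: exprn_continuous.
- by apply: pbound1X; exact: pbound1_id.
- by apply: pbound1M; [exact: pbound1_cst|apply: pbound1X; exact: pbound1_id].
Qed.

Lemma E1_gauss1 : E1 0 id = 0 :> R.
Proof.
have h : C1pb1 (fun=> 1 : R) (fun=> 0).
  split.
  - by move=> t; exact: is_derive_cst.
  - by move=> x; exact: cvg_cst.
  - exact: pbound1_cst.
  - exact: pbound1_cst.
have := gauss_ibp h; rewrite E1_cst => e; rewrite [RHS]e.
by congr E1; apply/funext => x; rewrite mulr1.
Qed.

Lemma E1_gaussX n : E1 0 (fun x : R => x ^+ n.+2) = n.+1%:R * E1 0 (fun x => x ^+ n).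
Proof.
rewrite -E1Z; last by apply: pbm1X; exact: pbm1_id.
rewrite (gauss_ibp (C1pb1X n)).
by congr E1; apply/funext => x; rewrite -exprS.
Qed.

Lemma E1_gauss2 : E1 0 (fun x : R => x ^+ 2) = 1.
Proof. by rewrite E1_gaussX (_ : (fun x : R => x ^+ 0) = fun=> 1)// E1_cst mulr1. Qed.

(** The functions 1 and x are orthonormal for the Gaussian. [poincare1] takes the affine function
    that interpolates at the nodes, [bessel1] the one nearest in L^2. *)
Lemma E1_sqr_subr_affine f c d : pbm1 f ->
  E1 0 (fun x => (f x + (- c + - d * x)) ^+ 2) = E1 0 (fun x => f x ^+ 2) +
    (c ^+ 2 + d ^+ 2 - 2 * c * E1 0 f - 2 * d * E1 0 (fun x => x * f x)).
Proof.
move=> mf; have mid := pbm1_id; have mcst := pbm1_cst.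
have mxf : pbm1 (fun x => x * f x) by exact: pbm1M.
transitivity (E1 0 (fun x => f x ^+ 2 + (((- c + - d * x) ^+ 2) + (((- 2 * c) * f x) + (- 2 * d) * (x * f x))))).
  by congr E1; apply/funext => x; ring.
have m1 : pbm1 (fun x => (-2 * c) * f x) by exact: pbm1M.
have m2 : pbm1 (fun x => (-2 * d) * (x * f x)) by exact: pbm1M.
have m3 : pbm1 (fun x => (-c + -d * x) ^+ 2).
  by apply: pbm1X; apply: pbm1D => //; exact: pbm1M.
rewrite E1D//; [|exact: pbm1X|by apply: pbm1D => //; exact: pbm1D].
rewrite E1D//; last exact: pbm1D.
rewrite E1D// !E1Z// E1_sqrD// E1_gauss1 E1_gauss2; ring.
Qed.

(* [h] must vanish where [x^2 = a + 1] on the support: for [a > 0] subtract the value of [f] at the only node, for [a = 0] the affine function interpolating [f] at the nodes [1] and [-1]. *)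
Lemma poincare1 a f f' : 0 <= a -> C1pb1 f f' ->
  E1 a (fun x => f x ^+ 2) <= E1 a f ^+ 2 + 2^-1 * E1 a (fun x => f' x ^+ 2)
    + 2^-1 * (if a == 0 then E1 a (fun x => x * f x) ^+ 2 else 0).
Proof.
move=> a0 hf.
have mf := C1pb1_pbm1 hf; have mf' := C1pb1_pbm1' hf.
have [a_0|aN0] := eqVneq a 0; last first.
  pose s := Num.sqrt (a + 1).
  have := C1pb1_affine (- f s) 0 hf => hh.
  have : 2 * \int[nu a]_x ((f x + (- f s + 0 * x)) ^+ 2) <= \int[nu a]_x ((f' x + 0) ^+ 2).
    apply: (barta_poincare a0 hh) => z sz z2.
    have z0 : 0 < z by apply: sz; rewrite lt_neqAle eq_sym aN0.
    have -> : z = s by rewrite /s -z2 sqrtr_sqr gtr0_norm.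
    by rewrite mul0r addr0 subrr.
  rewrite (_ : (fun x => (f' x + 0) ^+ 2) = (fun x => f' x ^+ 2)); last first.
    by apply/funext => x; rewrite addr0.
  rewrite (_ : (fun x => (f x + (- f s + 0 * x)) ^+ 2) = (fun x => (- f s + 1 * f x) ^+ 2)); last first.
    by apply/funext => x; rewrite mul0r addr0 mul1r addrC.
  have := E1_sqrD a (- f s) 1 mf; rewrite /E1 => ->.
  (* The mean is the constant nearest to [f], so the value at the node can only do worse, by this
     square. *)
  have := sqr_ge0 (E1 a f - f s); rewrite /E1; nra.
rewrite a_0.
pose A := (f 1 + f (- 1)) / 2; pose B := (f 1 - f (- 1)) / 2.
have := C1pb1_affine (- A) (- B) hf => hh.
have : 2 * \int[nu 0]_x ((f x + (- A + - B * x)) ^+ 2) <= \int[nu 0]_x ((f' x + - B) ^+ 2).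
  apply: (barta_poincare (lexx 0) hh) => z _ /eqP; rewrite add0r sqrf_eq1.
  by move=> /orP[/eqP->|/eqP->]; rewrite /A /B; field.
have -> : \int[nu 0]_x ((f' x + - B) ^+ 2) =
   B ^+ 2 - 2 * B * E1 0 f' + E1 0 (fun x => f' x ^+ 2).
  transitivity (E1 0 (fun x => (- B + 1 * f' x) ^+ 2)).
    by congr E1; apply/funext => x; ring.
  by rewrite E1_sqrD//; ring.
rewrite [X in 2 * X](E1_sqr_subr_affine A B mf).
rewrite (gauss_ibp hf).
(* Integration by parts has turned E f' into E[x f]; what is left over is twice the first square
   plus the second. *)
have := sqr_ge0 (E1 0 f - A); have := sqr_ge0 (E1 0 (fun x => x * f x) - B); nra.
Qed.

(** For [a = 0] the extra term is (E[x f])^2 = (E f')^2 by integration by parts, hence at most E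
    f'^2. *)
Lemma poincare1_weak a f f' : 0 <= a -> C1pb1 f f' ->
  E1 a (fun x => f x ^+ 2) <= E1 a f ^+ 2 + E1 a (fun x => f' x ^+ 2).
Proof.
move=> a0 hf; apply: le_trans (poincare1 a0 hf) _.
have mf' := C1pb1_pbm1' hf.
have := E1_sqr_ge a mf'.
have := E1_ge0 a (fun x => sqr_ge0 (f' x)).
case: eqVneq => [->|_]; last by lra.
by rewrite -(gauss_ibp hf); lra.
Qed.

End GaussianLine.

(** * Product measures *)

Section ProductMeasure.
Context {R : realType}.
Implicit Types (t : R) (n k : nat).

Definition cons_tuple n (w : R * n.-tuple R) : n.+1.-tuple R := [tuple of w.1 :: w.2].

Lemma measurable_cons_tuple n : measurable_fun setT (@cons_tuple n).
Proof. exact: measurable_cons. Qed.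

HB.instance Definition _ n :=
  isMeasurableFun.Build _ _ _ _ (@cons_tuple n) (@measurable_cons_tuple n).

(** The law of independent coordinates, built head first as in [iint], so that Fubini for a pair is
    conditioning on the first coordinate. *)
Fixpoint Pn n : ('I_n -> R) -> probability (n.-tuple R) R :=
  match n return ('I_n -> R) -> probability (n.-tuple R) R with
  | 0 => fun _ => \d_([tuple])
  | n'.+1 => fun al =>
      distribution ((nu (al ord0) : probability R R) \x Pn (fun i : 'I_n' => al (lift ord0 i)))%E
        (@cons_tuple n')
  end.

Definition cons_rv n t (y : 'rV[R]_n) : 'rV[R]_n.+1 := row_mx (const_mx t : 'rV[R]_1) y.

Lemma cons_rv0 n t (y : 'rV[R]_n) : cons_rv t y ord0 ord0 = t.
Proof.
rewrite /cons_rv /row_mx mxE; case: splitP => [j _|k /= e //].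
by rewrite mxE.
Qed.

Lemma cons_rvS n t (y : 'rV[R]_n) j : cons_rv t y ord0 (lift ord0 j) = y ord0 j.
Proof.
rewrite /cons_rv /row_mx mxE; case: splitP => [k /= e|k /= e].
  by have := ltn_ord k; rewrite -e.
by congr (y _ _); apply/val_inj; move: e; rewrite /= /bump/= !add1n => -[].
Qed.

Lemma rv_of_cons_tuple n w :
  rv_of_tuple (@cons_tuple n w) = cons_rv w.1 (rv_of_tuple w.2).
Proof.
apply/rowP => i; rewrite mxE; case: (unliftP ord0 i) => [j|] ->.
  by rewrite cons_rvS mxE tnthS.
by rewrite cons_rv0 tnth0.
Qed.

Lemma rmeasurable_EFin n (f : 'rV[R]_n -> R) : rmeasurable f ->
  measurable_fun setT (fun s : n.-tuple R => (f (rv_of_tuple s))%:E).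
Proof. by move=> mf; apply: (measurableT_comp _ mf). Qed.

Section Fubini.
Variables (n : nat) (al : 'I_n.+1 -> R).
Let al' := fun i : 'I_n => al (lift ord0 i).

Lemma ge0_integral_PnS (f : 'rV[R]_n.+1 -> \bar R) :
  measurable_fun setT (f \o @rv_of_tuple R n.+1) -> (forall x, 0 <= f x)%E ->
  (\int[Pn al]_s f (rv_of_tuple s) =
   \int[nu (al ord0)]_t \int[Pn al']_s f (cons_rv t (rv_of_tuple s)))%E.
Proof.
move=> mf f0.
have mf' : measurable_fun setT ((f \o @rv_of_tuple R n.+1) \o @cons_tuple n).
  by apply: measurableT_comp.
have f0' w : (0 <= ((f \o @rv_of_tuple R n.+1) \o @cons_tuple n) w)%E by exact: f0.
transitivity (\int[(nu (al ord0) : probability R R) \x Pn al']_w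
    ((f \o @rv_of_tuple R n.+1) \o @cons_tuple n) w)%E.
  by apply: ge0_integral_distribution => // s; exact: f0.
rewrite (fubini_tonelli1 _ mf' f0').
by apply: eq_integral => t _; apply: eq_integral => s _; rewrite /= rv_of_cons_tuple.
Qed.

Lemma integral_PnS (f : 'rV[R]_n.+1 -> \bar R) :
  (Pn al).-integrable setT (f \o @rv_of_tuple R n.+1) ->
  (\int[Pn al]_s f (rv_of_tuple s) =
   \int[nu (al ord0)]_t \int[Pn al']_s f (cons_rv t (rv_of_tuple s)))%E.
Proof.
move=> fi; have mf := measurable_int _ fi.
have mf' : measurable_fun setT ((f \o @rv_of_tuple R n.+1) \o @cons_tuple n).
  by apply: measurableT_comp.
have fi' : ((nu (al ord0) : probability R R) \x Pn al')%E.-integrable setT ((f \o @rv_of_tuple R n.+1) \o @cons_tuple n).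
  apply/integrableP; split => //.
  case/integrableP : fi => _; rewrite [X in (X < _)%E]/= ge0_integral_distribution//.
  exact: measurableT_comp.
transitivity (\int[(nu (al ord0) : probability R R) \x Pn al']_w
    ((f \o @rv_of_tuple R n.+1) \o @cons_tuple n) w)%E.
  exact: integral_distribution.
rewrite -(integral12_prod_meas1 fi').
by apply: eq_integral => t _; apply: eq_integral => s _; rewrite /= rv_of_cons_tuple.
Qed.

Lemma measurable_integral_PnS (f : 'rV[R]_n.+1 -> \bar R) :
  (Pn al).-integrable setT (f \o @rv_of_tuple R n.+1) ->
  measurable_fun setT (fun t => \int[Pn al']_s f (cons_rv t (rv_of_tuple s)))%E.
Proof.
move=> fi; have mf := measurable_int _ fi.
have mf' : measurable_fun setT ((f \o @rv_of_tuple R n.+1) \o @cons_tuple n).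
  by apply: measurableT_comp.
have fi' : ((nu (al ord0) : probability R R) \x Pn al')%E.-integrable setT ((f \o @rv_of_tuple R n.+1) \o @cons_tuple n).
  apply/integrableP; split => //.
  case/integrableP : fi => _; rewrite [X in (X < _)%E]/= ge0_integral_distribution//.
  exact: measurableT_comp.
have := measurable_fubini_F fi'.
congr measurable_fun; apply/funext => t.
by apply: eq_integral => s _; rewrite /= rv_of_cons_tuple.
Qed.

End Fubini.

Lemma rmeasurable_slice n (f : 'rV[R]_n.+1 -> R) t : rmeasurable f ->
  rmeasurable (fun y => f (cons_rv t y)).
Proof.
rewrite /rmeasurable => mf.
have -> : (fun y => f (cons_rv t y)) \o @rv_of_tuple R n =
   (f \o @rv_of_tuple R n.+1) \o (fun s => cons_tuple (t, s)).
  by apply/funext => s /=; rewrite rv_of_cons_tuple.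
apply: measurableT_comp => //.
by apply: measurableT_comp.
Qed.

Lemma rmeasurable_coord n i : rmeasurable (fun x : 'rV[R]_n => x ord0 i).
Proof.
rewrite /rmeasurable (_ : _ \o _ = (@tnth n R)^~ i); first exact: measurable_tnth.
by apply/funext => s /=; rewrite mxE.
Qed.

(** A product rather than 1 + |x|^2: it splits when a coordinate is added, so its moments and those
    of its slices follow by induction. *)
Definition polyw n (x : 'rV[R]_n) : R := \prod_i (1 + x ord0 i ^+ 2).

Lemma polyw_ge1 n (x : 'rV[R]_n) : 1 <= polyw x.
Proof.
rewrite /polyw; elim/big_ind: _ => // [a b a1 b1|i _]; last exact: le1_oneDsqr.
by rewrite -[1]mulr1 ler_pM.
Qed.

Lemma polyw_cons n t (y : 'rV[R]_n) : polyw (cons_rv t y) = (1 + t ^+ 2) * polyw y.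
Proof.
rewrite /polyw big_ord_recl cons_rv0; congr (_ * _).
by apply: eq_bigr => j _; rewrite cons_rvS.
Qed.

Lemma rmeasurable_polyw n k : rmeasurable (fun x : 'rV[R]_n => polyw x ^+ k).
Proof.
rewrite /rmeasurable (_ : _ \o _ = fun s : n.-tuple R => (\prod_i (1 + tnth s i ^+ 2)) ^+ k).
  apply: measurable_funX; apply: measurable_prod => i _.
  apply: measurable_funD => //; apply: measurable_funX; exact: measurable_tnth.
by apply/funext => s /=; congr (_ ^+ _); apply: eq_bigr => i _; rewrite mxE.
Qed.

Lemma integrable_polyw n (al : 'I_n -> R) k :
  (Pn al).-integrable setT (fun s => (polyw (rv_of_tuple s) ^+ k)%:E).
Proof.
have p0 m (x : 'rV[R]_m) l : 0 <= polyw x ^+ l.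
  by rewrite exprn_ge0// (le_trans _ (polyw_ge1 x)).
elim: n al => [|n IH] al; apply/integrableP; split.
- by apply: (@rmeasurable_EFin _ (fun x => polyw x ^+ k)); exact: rmeasurable_polyw.
- under eq_integral do rewrite /= /polyw big_ord0 expr1n normr1.
  by rewrite integral_cst// mul1e (le_lt_trans (probability_le1 _ _))// ltry.
- by apply: (@rmeasurable_EFin _ (fun x => polyw x ^+ k)); exact: rmeasurable_polyw.
under eq_integral do rewrite /= ger0_norm//.
rewrite (@ge0_integral_PnS _ al (fun x => (polyw x ^+ k)%:E)); last 2 first.
- by apply: (@rmeasurable_EFin _ (fun x => polyw x ^+ k)); exact: rmeasurable_polyw.
- by move=> x; rewrite lee_fin.
under eq_integral.
  move=> t _; under eq_integral do rewrite polyw_cons exprMn EFinM.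
  rewrite ge0_integralZl//; last 3 first.
  - by apply: (@rmeasurable_EFin _ (fun x => polyw x ^+ k)); exact: rmeasurable_polyw.
  - by move=> s _; rewrite lee_fin.
  - by rewrite lee_fin exprn_ge0// (le_trans _ (le1_oneDsqr t)).
  over.
have fin := integrable_fin_num measurableT (IH (fun i : 'I_n => al (lift ord0 i))).
have -> : (\int[nu (al ord0)]_t (((1 + t ^+ 2) ^+ k)%:E * \int[Pn (fun i : 'I_n => al (lift ord0 i))]_s (polyw (rv_of_tuple s) ^+ k)%:E) =
  \int[nu (al ord0)]_t (((1 + t ^+ 2) ^+ k * fine (\int[Pn (fun i : 'I_n => al (lift ord0 i))]_s (polyw (rv_of_tuple s) ^+ k)%:E))%R)%:E)%E.
  by apply: eq_integral => t _; rewrite EFinM fineK.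
apply: integrable_lty => //.
set c := fine _; suff : pbm1 (fun t : R => (1 + t ^+ 2) ^+ k * c) by exact: pbm1_integrable.
apply: pbm1M; last exact: pbm1_cst.
apply: pbm1X; apply: pbm1D; first exact: pbm1_cst.
by apply: pbm1X; exact: pbm1_id.
Qed.

Definition pbound n (f : 'rV[R]_n -> R) := exists (K : R) k, forall x, `|f x| <= K * polyw x ^+ k.

Definition pbm n (f : 'rV[R]_n -> R) := rmeasurable f /\ pbound f.

Lemma pboundP n (f : 'rV[R]_n -> R) : pbound f ->
  exists (K : R) k, 0 <= K /\ forall x, `|f x| <= K * polyw x ^+ k.
Proof.
move=> [K [k fK]]; exists K, k; split => //.
have := fK 0; rewrite [polyw _]big1 => [|i _]; last by rewrite mxE expr0n addr0.
by rewrite expr1n mulr1; apply: le_trans.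
Qed.

Section pbm_closure.
Variable n : nat.
Implicit Types f g : 'rV[R]_n -> R.

Lemma pbm_cst (c : R) : pbm (fun _ : 'rV[R]_n => c).
Proof.
split; first exact: measurable_cst.
by exists `|c|, 0%N => t; rewrite expr0 mulr1.
Qed.

Lemma pbm_coord i : pbm (fun x : 'rV[R]_n => x ord0 i).
Proof.
split; first exact: rmeasurable_coord.
exists 1, 1%N => x; rewrite expr1 mul1r (le_trans (normr_le_oneDsqr _))//.
rewrite /polyw (bigD1 i)//= ler_peMr// ?(le_trans _ (le1_oneDsqr _))//.
elim/big_ind: _ => // [a b a1 b1|j _]; last exact: le1_oneDsqr.
by rewrite -[1]mulr1 ler_pM.
Qed.

Lemma pbmM f g : pbm f -> pbm g -> pbm (fun x => f x * g x).
Proof.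
move=> [mf [K [k fK]]] [mg [L [l gL]]]; split; first exact: measurable_funM.
exists (K * L), (k + l)%N => t.
by rewrite normrM exprD mulrACA ler_pM.
Qed.

Lemma pbmZ c f : pbm f -> pbm (fun x => c * f x).
Proof. by move=> mf; apply: pbmM => //; exact: pbm_cst. Qed.

Lemma pbmD f g : pbm f -> pbm g -> pbm (fun x => f x + g x).
Proof.
move=> [mf /pboundP[K [k [K0 fK]]]] [mg /pboundP[L [l [L0 gL]]]].
split; first exact: measurable_funD.
exists (K + L), (k + l)%N => t.
rewrite (le_trans (ler_normD _ _))// mulrDl lerD//.
- rewrite (le_trans (fK t))// ler_wpM2l// ler_weXn2l ?leq_addr//.
  exact: polyw_ge1.
- rewrite (le_trans (gL t))// ler_wpM2l// ler_weXn2l ?leq_addl//.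
  exact: polyw_ge1.
Qed.

Lemma pbmX f k : pbm f -> pbm (fun x => f x ^+ k).
Proof.
move=> [mf [K [l fK]]]; split; first exact: measurable_funX.
exists (K ^+ k), (l * k)%N => t.
by rewrite normrX exprM -exprMn lerXn2r// nnegrE ?(le_trans _ (fK t)).
Qed.

Lemma pbm_sum (I : Type) (r : seq I) (f : I -> 'rV[R]_n -> R) :
  (forall i, pbm (f i)) -> pbm (fun x => \sum_(i <- r) f i x).
Proof.
move=> mf; elim: r => [|i r IH].
  rewrite (_ : (fun _ => _) = fun=> 0); first exact: pbm_cst.
  by apply/funext => x; rewrite big_nil.
rewrite (_ : (fun _ => _) = fun x => f i x + \sum_(j <- r) f j x); first exact: pbmD.
by apply/funext => x; rewrite big_cons.
Qed.

Lemma pbm_integrable (al : 'I_n -> R) f : pbm f ->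
  (Pn al).-integrable setT (fun s => (f (rv_of_tuple s))%:E).
Proof.
move=> [mf [K [k fK]]].
apply: (@le_integrable _ _ _ (Pn al) setT measurableT _ (fun s => (K * polyw (rv_of_tuple s) ^+ k)%:E)).
- exact/measurable_EFinP.
- by move=> s _; rewrite /= lee_fin (le_trans (fK _))// ler_norm.
- under eq_fun do rewrite EFinM.
  by apply: integrableZl => //; exact: integrable_polyw.
Qed.

Definition En (al : 'I_n -> R) f := \int[Pn al]_s f (rv_of_tuple s).

Variable al : 'I_n -> R.

Lemma EnE f : pbm f -> (\int[Pn al]_s (f (rv_of_tuple s))%:E)%E = (En al f)%:E.
Proof. by move=> mf; rewrite fineK//; apply: integrable_fin_num => //; exact: pbm_integrable. Qed.

Lemma EnD f g : pbm f -> pbm g -> En al (fun x => f x + g x) = En al f + En al g.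
Proof. by move=> ? ?; rewrite /En RintegralD//; exact: pbm_integrable. Qed.

Lemma EnZ c f : pbm f -> En al (fun x => c * f x) = c * En al f.
Proof. by move=> ?; rewrite /En RintegralZl//; exact: pbm_integrable. Qed.

Lemma En_cst c : En al (fun=> c) = c.
Proof. exact: Rintegral_prob_cst. Qed.

Lemma En_ge0 f : (forall x, 0 <= f x) -> 0 <= En al f.
Proof. by move=> f0; exact: Rintegral_ge0. Qed.

Lemma En_sum (I : Type) (r : seq I) (f : I -> 'rV[R]_n -> R) :
  (forall i, pbm (f i)) -> En al (fun x => \sum_(i <- r) f i x) = \sum_(i <- r) En al (f i).
Proof.
move=> mf; elim: r => [|i r IH].
  rewrite big_nil -[RHS]En_cst; congr En; apply/funext => x; by rewrite big_nil.
rewrite big_cons -IH -EnD//; last exact: pbm_sum.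
by congr En; apply/funext => x; rewrite big_cons.
Qed.

End pbm_closure.

Lemma pbm_slice n (f : 'rV[R]_n.+1 -> R) t : pbm f -> pbm (fun y => f (cons_rv t y)).
Proof.
move=> [mf [K [k fK]]]; split; first exact: rmeasurable_slice.
exists (K * (1 + t ^+ 2) ^+ k), k => y.
by rewrite (le_trans (fK _))// polyw_cons exprMn mulrA.
Qed.

Lemma pbm1_En_slice n (al : 'I_n -> R) (f : 'rV[R]_n.+1 -> R) : pbm f ->
  pbm1 (fun t => En al (fun y => f (cons_rv t y))).
Proof.
move=> mf.
(* Measurability of slice integrals is known for a product with one more factor; the exponent of
   that factor is arbitrary. *)
pose al1 (i : 'I_n.+1) := if unlift ord0 i is Some j then al j else 0.
have al1E : (fun i : 'I_n => al1 (lift ord0 i)) = al.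
  by apply/funext => i; rewrite /al1 liftK.
split.
  have := @measurable_integral_PnS n al1 (EFin \o f) (pbm_integrable al1 mf).
  rewrite al1E => h; apply: (measurableT_comp (f := fine) _ h).
  exact: fine_measurable.
have [_ /pboundP[K [k [K0 fK]]]] := mf.
exists (K * En al (fun y => polyw y ^+ k)), k => t.
have mW : pbm (fun y : 'rV[R]_n => polyw y ^+ k).
  split; first exact: rmeasurable_polyw.
  exists 1, k => y; rewrite mul1r ger0_norm// exprn_ge0//.
  by rewrite (le_trans _ (polyw_ge1 y)).
apply: (le_trans (le_normr_Rintegral measurableT _)).
  exact: (pbm_integrable al (pbm_slice t mf)).
rewrite mulrAC -EnZ//.
apply: le_Rintegral => //.
- have := pbm_integrable al (pbm_slice t mf).
  by move/integrable_abse.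
- by apply: (pbm_integrable al (f := fun y => _ * polyw y ^+ k)); exact: pbmZ.
- by move=> s _; rewrite (le_trans (fK _))// polyw_cons exprMn mulrA.
Qed.

Lemma EnS n (al : 'I_n.+1 -> R) (f : 'rV[R]_n.+1 -> R) : pbm f ->
  En al f = E1 (al ord0) (fun t => En (fun i : 'I_n => al (lift ord0 i)) (fun y => f (cons_rv t y))).
Proof.
move=> mf; rewrite /En /E1 {1}/Rintegral (@integral_PnS n al (EFin \o f)); last first.
  exact: pbm_integrable.
congr fine; apply: eq_integral => t _.
exact: (EnE _ (pbm_slice t mf)).
Qed.

Lemma E1_sum a (I : Type) (r : seq I) (f : I -> R -> R) :
  (forall i, pbm1 (f i)) ->
  pbm1 (fun x => \sum_(i <- r) f i x) /\
  E1 a (fun x => \sum_(i <- r) f i x) = \sum_(i <- r) E1 a (f i).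
Proof.
move=> mf; elim: r => [|i r [IH1 IH2]].
  rewrite (_ : (fun _ => _) = fun=> 0); last by apply/funext => x; rewrite big_nil.
  by rewrite big_nil E1_cst; split => //; exact: pbm1_cst.
rewrite (_ : (fun _ => _) = fun x => f i x + \sum_(j <- r) f j x); last first.
  by apply/funext => x; rewrite big_cons.
by rewrite big_cons -IH2 -E1D//; split => //; exact: pbm1D.
Qed.

End ProductMeasure.

(** * Tensorization *)

Section PoincareProduct.
Context {R : realType}.
Implicit Types (t : R) (n k : nat).

(** Each partial derivative is continuous along its own direction: this passes to slices and makes
    the derivative of a conditional expectation continuous. *)
Definition C1pb n (f : 'rV[R]_n -> R) (d : 'I_n -> 'rV[R]_n -> R) :=
  [/\ forall i x, is_derive x (evec R i) f (d i x),
      forall i x, continuous (fun t : R => d i (x + t *: evec R i)),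
      pbm f & forall i, pbm (d i)].

Lemma cons_rv_shift0 n t h (y : 'rV[R]_n) :
  cons_rv (h + t) y = h *: evec R ord0 + cons_rv t y.
Proof.
apply/rowP => i; rewrite [RHS]mxE [X in _ = X + _]mxE /evec.
case: (unliftP ord0 i) => [j|] ->.
  by rewrite !cons_rvS mxE/= mulr0 add0r.
by rewrite !cons_rv0 mxE/= mulr1.
Qed.

Lemma cons_rv_shiftS n t h (y : 'rV[R]_n) j :
  cons_rv t (h *: evec R j + y) = h *: evec R (lift ord0 j) + cons_rv t y.
Proof.
apply/rowP => i; rewrite [RHS]mxE [X in _ = X + _]mxE /evec.
case: (unliftP ord0 i) => [l|] ->.
  by rewrite !cons_rvS !mxE/= (inj_eq lift_inj).
by rewrite !cons_rv0 mxE/= mulr0 add0r.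
Qed.

Lemma is_derive_slice0 n (f : 'rV[R]_n.+1 -> R) t (y : 'rV[R]_n) l :
  is_derive (cons_rv t y) (evec R ord0) f l -> is_derive t 1 (fun t => f (cons_rv t y)) l.
Proof.
have e : (fun h => h^-1 *: (f (h *: evec R ord0 + cons_rv t y) - f (cons_rv t y))) =
  (fun h => h^-1 *: (f (cons_rv (h *: (1 : R) + t) y) - f (cons_rv t y))).
  by apply/funext => h; rewrite -cons_rv_shift0 /GRing.scale/= mulr1.
by case; rewrite /derivable /derive e => h1 h2; split.
Qed.

Lemma is_derive_sliceS n (f : 'rV[R]_n.+1 -> R) t (y : 'rV[R]_n) j l :
  is_derive (cons_rv t y) (evec R (lift ord0 j)) f l ->
  is_derive y (evec R j) (fun y => f (cons_rv t y)) l.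
Proof.
have e : (fun h => h^-1 *: (f (h *: evec R (lift ord0 j) + cons_rv t y) - f (cons_rv t y))) =
  (fun h => h^-1 *: (f (cons_rv t (h *: evec R j + y)) - f (cons_rv t y))).
  by apply/funext => h; rewrite -cons_rv_shiftS.
by case; rewrite /derivable /derive e => h1 h2; split.
Qed.

Lemma C1pb_slice n (f : 'rV[R]_n.+1 -> R) d t : C1pb f d ->
  C1pb (fun y => f (cons_rv t y)) (fun (j : 'I_n) y => d (lift ord0 j) (cons_rv t y)).
Proof.
move=> [df cd mf md]; split.
- by move=> i x; exact: is_derive_sliceS.
- move=> i x.
  have -> : (fun h : R => d (lift ord0 i) (cons_rv t (x + h *: evec R i))) =
      (fun h => d (lift ord0 i) (cons_rv t x + h *: evec R (lift ord0 i))).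
    by apply/funext => h; rewrite addrC cons_rv_shiftS addrC.
  exact: cd.
- exact: pbm_slice.
- by move=> i; exact: pbm_slice.
Qed.

(** Differentiation under the integral. The weight 1 gives the conditional mean of [f], a coordinate
    as weight gives its conditional first moments. *)
Lemma C1pb1_En_slice n (al : 'I_n -> R) (w : 'rV[R]_n -> R) (f : 'rV[R]_n.+1 -> R) d :
  pbm w -> C1pb f d ->
  C1pb1 (fun t => En al (fun y => w y * f (cons_rv t y)))
        (fun t => En al (fun y => w y * d ord0 (cons_rv t y))).
Proof.
move=> mw [df cd mf md].
have dslice t y : is_derive t 1 (fun t => w y * f (cons_rv t y)) (w y * d ord0 (cons_rv t y)).
  have := is_derive_slice0 (df ord0 (cons_rv t y)) => h.
  by apply: is_derive_eq; rewrite /GRing.scale/= ?mulr0 ?addr0.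
have mwf (g : 'rV[R]_n.+1 -> R) t : pbm g -> pbm (fun y => w y * g (cons_rv t y)).
  by move=> mg; apply: pbmM => //; exact: pbm_slice.
have mwf1 (g : 'rV[R]_n.+1 -> R) : pbm g -> pbm1 (fun t => En al (fun y => w y * g (cons_rv t y))).
  (* [w] is extended to be constant in the new first coordinate, so that the product becomes a slice
     of a single function. *)
  move=> mg; pose w' (x : 'rV[R]_n.+1) := w (\row_i x ord0 (lift ord0 i)).
  have w'E t y : w' (cons_rv t y) = w y.
    by congr w; apply/rowP => i; rewrite mxE cons_rvS.
  have mw' : pbm w'.
    have [rw [K [k wK]]] := mw; split.
      rewrite /rmeasurable (_ : _ \o _ = (w \o @rv_of_tuple R n) \o (fun s : n.+1.-tuple R => [tuple of behead s] : n.-tuple R)).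
        by apply: measurableT_comp => //; exact: measurable_behead.
      apply/funext => s /=; congr w; apply/rowP => i; rewrite !mxE.
      by rewrite [in LHS](tuple_eta s) tnthS.
    exists K, k => x; rewrite (le_trans (wK _))// ler_wpM2l//.
      have := wK 0; rewrite [polyw _]big1 => [|i _]; last by rewrite mxE expr0n addr0.
      by rewrite expr1n mulr1; apply: le_trans.
    have pw0 m (z : 'rV[R]_m) : 0 <= polyw z by exact: le_trans (polyw_ge1 z).
    apply: lerXn2r; rewrite ?nnegrE//.
    have -> : polyw x = (1 + x ord0 ord0 ^+ 2) * polyw (\row_i x ord0 (lift ord0 i)).
      by rewrite /polyw big_ord_recl; congr (_ * _); apply: eq_bigr => i _; rewrite mxE.
    by rewrite ler_peMl// le1_oneDsqr.
  have := pbm1_En_slice al (pbmM mw' mg).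
  by congr pbm1; apply/funext => t; congr En; apply/funext => y; rewrite w'E.
have [mwd /pboundP[L [l [L0 wL]]]] := mw.
have [_ /pboundP[K [k [K0 dK]]]] := md ord0.
have bound t y (M : R) : `|t| <= M ->
    `|w y * d ord0 (cons_rv t y)| <= L * polyw y ^+ l * (K * (1 + M ^+ 2) ^+ k * polyw y ^+ k).
  move=> tM; rewrite normrM ler_pM//.
  rewrite (le_trans (dK _))// -mulrA ler_wpM2l// polyw_cons exprMn ler_wpM2r//.
    by rewrite exprn_ge0// (le_trans _ (polyw_ge1 y)).
  have M0 : 0 <= M by rewrite (le_trans _ tM).
  have o0 (z : R) : 0 <= 1 + z ^+ 2 by exact: le_trans (le1_oneDsqr z).
  apply: lerXn2r; rewrite ?nnegrE//.
  by rewrite lerD2l -real_normK ?num_real// lerXn2r ?nnegrE.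
have mbound (M : R) : pbm (fun y : 'rV[R]_n => L * polyw y ^+ l * (K * (1 + M ^+ 2) ^+ k * polyw y ^+ k)).
  have mW j : pbm (fun y : 'rV[R]_n => polyw y ^+ j).
    split; first exact: rmeasurable_polyw.
    exists 1, j => y; rewrite mul1r ger0_norm// exprn_ge0//.
    by rewrite (le_trans _ (polyw_ge1 y)).
  by apply: pbmM; exact: pbmZ.
(* Domination is local: on this window around [t] the estimate [bound] holds uniformly with M = |t|
   + 1. *)
have tI (t : R) : `](- (`|t| + 1)), (`|t| + 1)[%classic t.
  rewrite /= in_itv/= -ltr_norml ltrDl//.
have nI (t u : R) : `](- (`|t| + 1)), (`|t| + 1)[%classic u -> `|u| <= `|t| + 1.
  by rewrite /= in_itv/= -ltr_norml => /ltW.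
split; last 2 first.
- by have [] := mwf1 _ mf.
- by have [] := mwf1 _ (md ord0).
- move=> t.
  pose F (u : R) (s : n.-tuple R) := w (rv_of_tuple s) * f (cons_rv u (rv_of_tuple s)).
  have partE u s : partial1of2 F u s = w (rv_of_tuple s) * d ord0 (cons_rv u (rv_of_tuple s)).
    by rewrite partial1of2E; have [_] := dslice u (rv_of_tuple s).
  have H1 (u : R) : `](- (`|t| + 1)), (`|t| + 1)[%classic u -> (Pn al).-integrable setT (EFin \o F u).
    by move=> _; exact: (pbm_integrable al (mwf _ u mf)).
  have H2 (u : R) s : `](- (`|t| + 1)), (`|t| + 1)[%classic u -> setT s -> derivable (F ^~ s) u 1.
    by move=> _ _; have [] := dslice u (rv_of_tuple s).
  pose G (s : n.-tuple R) := L * polyw (rv_of_tuple s) ^+ l * (K * (1 + (`|t| + 1) ^+ 2) ^+ k * polyw (rv_of_tuple s) ^+ k).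
  have G0 s : 0 <= G s.
    by apply: le_trans (bound t (rv_of_tuple s) (`|t| + 1) _); rewrite // lerDl.
  have iG : (Pn al).-integrable setT (EFin \o G).
    exact: (pbm_integrable al (mbound (`|t| + 1))).
  have Gb (u : R) s : `](- (`|t| + 1)), (`|t| + 1)[%classic u -> setT s -> `|partial1of2 F u s| <= G s.
    by move=> /nI tu _; rewrite partE; exact: bound.
  have h1 := derivable_under_integral measurableT (tI t) H1 H2 G0 iG Gb.
  have h2 := differentiation_under_integral measurableT (tI t) H1 H2 G0 iG Gb.
  split; first exact: h1.
  rewrite -derive1E [LHS]h2 /En; apply: eq_Rintegral => s _.
  exact: partE.
- move=> t.
  pose F (u : R) (s : n.-tuple R) := w (rv_of_tuple s) * d ord0 (cons_rv u (rv_of_tuple s)).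
  have H1 (u : R) : `](- (`|t| + 1)), (`|t| + 1)[%classic u -> (Pn al).-integrable setT (EFin \o F u).
    by move=> _; exact: (pbm_integrable al (mwf _ u (md ord0))).
  have H2 : {ae Pn al, forall s, setT s -> {in (`](- (`|t| + 1)), (`|t| + 1)[%classic : set R), continuous (F ^~ s)}}.
    apply: aeW => s _ u _; apply: cvgM; first exact: cvg_cst.
    have e : (fun u => d ord0 (cons_rv u (rv_of_tuple s))) =
       (fun u : R => d ord0 (cons_rv 0 (rv_of_tuple s) + u *: evec R ord0)).
      by apply/funext => v; rewrite addrC -cons_rv_shift0 addr0.
    have cc : continuous (fun u : R => d ord0 (cons_rv u (rv_of_tuple s))) by rewrite e; exact: cd.
    exact: cc.
  pose G (s : n.-tuple R) := L * polyw (rv_of_tuple s) ^+ l * (K * (1 + (`|t| + 1) ^+ 2) ^+ k * polyw (rv_of_tuple s) ^+ k).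
  have iG : (Pn al).-integrable setT (EFin \o G).
    exact: (pbm_integrable al (mbound (`|t| + 1))).
  have Gb (u : R) : `](- (`|t| + 1)), (`|t| + 1)[%classic u -> {ae Pn al, forall s, setT s -> `|F u s| <= G s}.
    by move=> /nI tu; apply: aeW => s _; exact: bound.
  have := continuity_under_integral measurableT H1 H2 iG Gb.
  by apply; rewrite inE; exact: tI.
Qed.

Lemma bessel1 a (f : R -> R) : pbm1 f ->
  E1 a f ^+ 2 + (if a == 0 then E1 a (fun x => x * f x) ^+ 2 else 0) <= E1 a (fun x => f x ^+ 2).
Proof.
move=> mf; case: eqVneq => [->|_]; last by rewrite addr0; exact: E1_sqr_ge.
set A := E1 0 f; set B := E1 0 (fun x => x * f x).
have : 0 <= E1 0 (fun x => (f x + (- A + - B * x)) ^+ 2).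
  by apply: E1_ge0 => x; exact: sqr_ge0.
rewrite (E1_sqr_subr_affine A B mf).
rewrite -/A -/B; lra.
Qed.

(* [1] and the coordinates of zero weight exponent are orthonormal. *)
Lemma bessel n (al : 'I_n -> R) f : pbm f ->
  En al f ^+ 2 + \sum_i (if al i == 0 then En al (fun x => x ord0 i * f x) ^+ 2 else 0)
    <= En al (fun x => f x ^+ 2).
Proof.
elim: n al f => [|n IH] al f mf.
  rewrite big_ord0 addr0.
  have -> : (fun x => f x ^+ 2) = fun=> f 0 ^+ 2 by apply/funext => x; rewrite [x]thinmx0.
  have -> : f = fun=> f 0 by apply/funext => x; rewrite [x in LHS]thinmx0.
  by rewrite !En_cst.
pose al' (i : 'I_n) := al (lift ord0 i).
have mxf i : pbm (fun x => x ord0 i * f x) by apply: pbmM => //; exact: pbm_coord.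
rewrite big_ord_recl !EnS//; last exact: pbmX.
rewrite -/al'.
pose A t := En al' (fun y => f (cons_rv t y)).
have mA : pbm1 A by exact: pbm1_En_slice.
pose B (i : 'I_n) t := En al' (fun y => y ord0 i * f (cons_rv t y)).
have BE i : B i = fun t => En al' (fun y => cons_rv t y ord0 (lift ord0 i) * f (cons_rv t y)).
  by apply/funext => t; congr En; apply/funext => y; rewrite cons_rvS.
have mB i : pbm1 (B i) by rewrite BE; exact: (pbm1_En_slice al' (mxf (lift ord0 i))).
have mB2 i : pbm1 (fun t => if al' i == 0 then B i t ^+ 2 else 0).
  by case: (al' i == 0); [exact: pbm1X|exact: pbm1_cst].
have [mS ES] := E1_sum (al ord0) (index_enum 'I_n) mB2.
(* Bessel on each slice. Then [bessel1] extracts from A the coefficients of 1 and x_1, and Jensen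
   handles each B_i. *)
apply: (@le_trans _ _ (E1 (al ord0) (fun t => A t ^+ 2 + \sum_i (if al' i == 0 then B i t ^+ 2 else 0)))); last first.
  apply: E1_le.
  - by apply: pbm1D => //; exact: pbm1X.
  - by apply: (pbm1_En_slice al' (f := fun x => f x ^+ 2)); exact: pbmX.
  - by move=> t; apply: IH; exact: pbm_slice.
rewrite E1D//; last exact: pbm1X.
rewrite ES addrA lerD//.
  have := bessel1 (al ord0) mA; congr (_ + _ <= _).
  case: ifP => // _; congr (E1 _ _ ^+ 2); apply/funext => t.
  rewrite -EnZ; last exact: pbm_slice.
  by congr En; apply/funext => y; rewrite cons_rv0.
apply: ler_sum => i _; rewrite -/(al' i); case: ifP => _; last by rewrite E1_cst.
by rewrite EnS// -/al' -BE; exact: E1_sqr_ge.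
Qed.

(** Both F'2 and sG' arrive with coefficient 1/2, which is why the last hypothesis can absorb them
    together into the energy D0 along x_1. *)
Let tensor_arith (e F2 sD sG f2 F'2 x2 sX sG' D0 : R) : e <= F2 + 2^-1 * sD + 2^-1 * sG ->
  F2 <= f2 + 2^-1 * F'2 + 2^-1 * x2 -> sG <= sX + sG' -> F'2 + sG' <= D0 ->
  e <= f2 + 2^-1 * (D0 + sD) + 2^-1 * (x2 + sX).
Proof. lra. Qed.

Theorem poincare_product n (al : 'I_n -> R) f d : (forall i, 0 <= al i) -> C1pb f d ->
  En al (fun x => f x ^+ 2) <= En al f ^+ 2 + 2^-1 * \sum_i En al (fun x => d i x ^+ 2)
   + 2^-1 * \sum_i (if al i == 0 then En al (fun x => x ord0 i * f x) ^+ 2 else 0).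
Proof.
elim: n al f d => [|n IH] al f d al0 hf; have [df cd mf md] := hf.
  rewrite !big_ord0 !mulr0 !addr0.
  have -> : (fun x => f x ^+ 2) = fun=> f 0 ^+ 2 by apply/funext => x; rewrite [x]thinmx0.
  have -> : f = fun=> f 0 by apply/funext => x; rewrite [x in LHS]thinmx0.
  by rewrite !En_cst.
pose al' (i : 'I_n) := al (lift ord0 i).
have mxf i : pbm (fun x => x ord0 i * f x) by apply: pbmM => //; exact: pbm_coord.
have md2 i : pbm (fun x => d i x ^+ 2) by exact: pbmX.
rewrite !big_ord_recl.
pose F t := En al' (fun y => f (cons_rv t y)).
pose F' t := En al' (fun y => d ord0 (cons_rv t y)).
pose G (i : 'I_n) t := En al' (fun y => y ord0 i * f (cons_rv t y)).
pose G' (i : 'I_n) t := En al' (fun y => y ord0 i * d ord0 (cons_rv t y)).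
have hF : C1pb1 F F'.
  have := C1pb1_En_slice al' (pbm_cst n 1) hf.
  by congr C1pb1; apply/funext => t; congr En; apply/funext => y; rewrite mul1r.
have hG i : C1pb1 (G i) (G' i).
  exact: (C1pb1_En_slice al' (pbm_coord i) hf).
have mF := C1pb1_pbm1 hF; have mF' := C1pb1_pbm1' hF.
have mG i := C1pb1_pbm1 (hG i); have mG' i := C1pb1_pbm1' (hG i).
have mG2 i : pbm1 (fun t => if al' i == 0 then G i t ^+ 2 else 0).
  by case: (al' i == 0); [exact: pbm1X|exact: pbm1_cst].
have mG'2 i : pbm1 (fun t => if al' i == 0 then G' i t ^+ 2 else 0).
  by case: (al' i == 0); [exact: pbm1X|exact: pbm1_cst].
pose D i t := En al' (fun y => d i (cons_rv t y) ^+ 2).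
have mD i : pbm1 (D i) by exact: (pbm1_En_slice al' (md2 i)).
have DE i : En al (fun x => d i x ^+ 2) = E1 (al ord0) (D i) by rewrite EnS.
have [mS1 ES1] := E1_sum (al ord0) (index_enum 'I_n) (fun i => mD (lift ord0 i)).
have [mS2 ES2] := E1_sum (al ord0) (index_enum 'I_n) mG2.
have [mS3 ES3] := E1_sum (al ord0) (index_enum 'I_n) mG'2.
have GE i : E1 (al ord0) (G i) = En al (fun x => x ord0 (lift ord0 i) * f x).
  rewrite (EnS al (mxf _)) -/al'; congr (E1 (al ord0) _); apply/funext => t.
  by congr (En al' _); apply/funext => y; rewrite cons_rvS.
have FE : E1 (al ord0) F = En al f by rewrite EnS.
have xFE : E1 (al ord0) (fun t => t * F t) = En al (fun x => x ord0 ord0 * f x).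
  rewrite (EnS al (mxf _)) -/al'; congr (E1 (al ord0) _); apply/funext => t.
  rewrite -EnZ; last exact: pbm_slice.
  by congr (En al' _); apply/funext => y; rewrite cons_rv0.
(* The induction hypothesis on each slice, averaged over the first coordinate. *)
have step1 : En al (fun x => f x ^+ 2) <= E1 (al ord0) (fun t => F t ^+ 2)
   + 2^-1 * \sum_(i < n) E1 (al ord0) (D (lift ord0 i))
   + 2^-1 * \sum_(i < n) (if al' i == 0 then E1 (al ord0) (fun t => G i t ^+ 2) else 0).
  have -> : \sum_(i < n) (if al' i == 0 then E1 (al ord0) (fun t => G i t ^+ 2) else 0) =
     \sum_(i < n) E1 (al ord0) (fun t => if al' i == 0 then G i t ^+ 2 else 0).
    by apply: eq_bigr => i _; case: ifP => // _; rewrite E1_cst.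
  have mF2 : pbm1 (fun t => F t ^+ 2) by exact: pbm1X.
  have mZ1 := pbm1Z 2^-1 mS1; have mZ2 := pbm1Z 2^-1 mS2.
  have mD1 := pbm1D mF2 mZ1.
  rewrite -ES1 -ES2 -!E1Z// -!E1D//.
  rewrite EnS; last exact: pbmX.
  apply: E1_le.
  - by apply: (pbm1_En_slice al' (f := fun x => f x ^+ 2)); exact: pbmX.
  - by apply: pbm1D; [apply: pbm1D; [exact: pbm1X|exact: pbm1Z]|exact: pbm1Z].
  - move=> t; apply: (IH al' _ _ _ (C1pb_slice t hf)).
    by move=> i; exact: al0.
have step2 := poincare1 (al0 ord0) hF.
(* Constant 1 is affordable here since [step1] already carries a factor 1/2; the sharp inequality
   would leave an additional squared moment. *)
have step3 : \sum_(i < n) (if al' i == 0 then E1 (al ord0) (fun t => G i t ^+ 2) else 0) <=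
   \sum_(i < n) (if al' i == 0 then En al (fun x => x ord0 (lift ord0 i) * f x) ^+ 2 else 0)
   + \sum_(i < n) E1 (al ord0) (fun t => if al' i == 0 then G' i t ^+ 2 else 0).
  rewrite -big_split/=; apply: ler_sum => i _; case: ifP => _; last by rewrite E1_cst addr0.
  by rewrite -GE; exact: poincare1_weak.
(* On a slice, F' and the G'_i are the coefficients of [d ord0] against 1 and the coordinates. *)
have step4 : E1 (al ord0) (fun t => F' t ^+ 2) +
    \sum_(i < n) E1 (al ord0) (fun t => if al' i == 0 then G' i t ^+ 2 else 0) <= E1 (al ord0) (D ord0).
  rewrite -ES3 -E1D//; last exact: pbm1X.
  apply: E1_le => //; first by apply: pbm1D => //; exact: pbm1X.
  by move=> t; apply: bessel; exact: pbm_slice.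
rewrite (eq_bigr (fun i => E1 (al ord0) (D (lift ord0 i)))); last by move=> i _; exact: DE.
rewrite DE.
move: step2; rewrite FE xFE => step2.
exact: tensor_arith step1 step2 step3 step4.
Qed.

End PoincareProduct.

(** * Iterated integrals against the weight *)

Section IteratedIntegral.
Context {R : realType}.
Implicit Types (t : R) (n k : nat).
Local Notation mu := (@lebesgue_measure R).

(** No sign or integrability is assumed: [integrable_wint] needs it for slices that may fail to be
    integrable on a null set of parameters. *)
Lemma measurable_iint n d (X : measurableType d) (F : X -> 'rV[R]_n -> \bar R) :
  measurable_fun setT (fun xs : X * n.-tuple R => F xs.1 (rv_of_tuple xs.2)) ->
  measurable_fun setT (fun x => iint (F x)).
Proof.
elim: n d X F => [|n IH] d X F mF.
  rewrite /=.
  have -> : (fun x => F x 0) = (fun xs : X * 0.-tuple R => F xs.1 (rv_of_tuple xs.2)) \o (fun x => (x, [tuple])).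
    by apply/funext => x /=; congr F; apply/rowP => -[].
  by apply: measurableT_comp.
pose G (xt : X * R) := iint (fun y => F xt.1 (cons_rv xt.2 y)).
have mG : measurable_fun setT G.
  apply: (IH _ _ (fun (xt : X * R) y => F xt.1 (cons_rv xt.2 y))).
  have -> : (fun xs : (X * R) * n.-tuple R => F xs.1.1 (cons_rv xs.1.2 (rv_of_tuple xs.2))) =
     (fun xs : X * n.+1.-tuple R => F xs.1 (rv_of_tuple xs.2)) \o
     (fun xs : (X * R) * n.-tuple R => (xs.1.1, cons_tuple (xs.1.2, xs.2))).
    by apply/funext => xs /=; rewrite rv_of_cons_tuple.
  apply: measurableT_comp => //; apply/measurable_fun_pairP; split => /=.
    exact: (measurableT_comp measurable_fst measurable_fst).
  apply: (measurableT_comp (@measurable_cons_tuple R n)).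
  apply/measurable_fun_pairP; split; last exact: measurable_snd.
  exact: (measurableT_comp measurable_snd measurable_fst).
have -> : (fun x => iint (F x)) = (fun x => \int[mu]_t G (x, t))%E by [].
(* Tonelli gives measurability for nonnegative functions, hence for the two parts separately. *)
have -> : (fun x => \int[mu]_t G (x, t))%E =
   (fun x => \int[mu]_t G^\+ (x, t) - \int[mu]_t G^\- (x, t))%E.
  apply/funext => x; rewrite integralE; congr (_ - _)%E; apply: eq_integral => t _.
    by rewrite !funeposE.
  by rewrite !funenegE.
apply: emeasurable_funB.
  apply: (measurable_fun_fubini_tonelli_F (m2 := mu) G^\+%E).
  - exact: measurable_funepos.
  - by move=> ?; exact: funepos_ge0.
apply: (measurable_fun_fubini_tonelli_F (m2 := mu) G^\-%E).
- exact: measurable_funeneg.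
- by move=> ?; exact: funeneg_ge0.
Qed.

Definition mono_gauss_prod n (al : 'I_n -> R) (x : 'rV[R]_n) : R :=
  \prod_i mono_gauss (al i) (x ord0 i).

(** The half-line condition is built into each factor, so outside the domain a single vanishing
    factor kills the product. *)
Lemma indic_weightE n (al : 'I_n -> R) x :
  \1_(RNstar al) x * weight al x = mono_gauss_prod al x.
Proof.
have expE : expR (- sqnorm x / 2) = \prod_i expR (- (x ord0 i) ^+ 2 / 2) :> R.
  by rewrite /sqnorm -sumrN mulr_suml expR_sum.
rewrite /mono_gauss_prod /weight expE /mono_gauss big_split/= mulrA; congr (_ * _).
rewrite indicE; case: (boolP (x \in RNstar al)) => [/set_mem xal|xal].
  rewrite mul1r; apply: eq_bigr => i _; case: ifP => // ai.
  by rewrite ifT//; exact: xal.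
rewrite mul0r; have [i [ai xi]] : exists i, 0 < al i /\ ~ 0 < x ord0 i.
  move: xal; rewrite notin_setE => /existsNP[i /not_implyP[ai xi]].
  by exists i.
by rewrite (bigD1 i)//= ai ifF ?mul0r//; apply/negP.
Qed.

Lemma mono_gauss_prod_cons n (al : 'I_n.+1 -> R) t y :
  mono_gauss_prod al (cons_rv t y) =
  mono_gauss (al ord0) t * mono_gauss_prod (fun i : 'I_n => al (lift ord0 i)) y.
Proof.
rewrite /mono_gauss_prod big_ord_recl cons_rv0; congr (_ * _).
by apply: eq_bigr => i _; rewrite cons_rvS.
Qed.

Definition mass_prod n (al : 'I_n -> R) : R := \prod_i mono_gauss_mass (al i).

Lemma mass_prod_gt0 n (al : 'I_n -> R) : 0 < mass_prod al.
Proof. by apply: prodr_gt0 => i _; exact: mono_gauss_mass_gt0. Qed.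

Lemma wintE n (al : 'I_n -> R) h : wint al h = iint (fun x => (mono_gauss_prod al x * h x)%:E).
Proof. by congr iint; apply/funext => x; rewrite indic_weightE. Qed.

Lemma wintS n (al : 'I_n.+1 -> R) h :
  (wint al h = \int[mu]_t wint (fun i : 'I_n => al (lift ord0 i))
    (fun y => (mono_gauss (al ord0) t * h (cons_rv t y))%R))%E.
Proof.
rewrite wintE /=; apply: eq_integral => t _; rewrite wintE; congr iint.
apply/funext => y; rewrite mono_gauss_prod_cons; congr (_%:E); ring.
Qed.

Lemma wint0 (al : 'I_0 -> R) h :
  wint al h = ((mass_prod al)%:E * \int[Pn al]_s (h (rv_of_tuple s))%:E)%E.
Proof.
rewrite wintE /= /mono_gauss_prod /mass_prod !big_ord0 mul1r mul1e.
have e : (fun s : 0.-tuple R => (h (rv_of_tuple s))%:E) = cst (h 0)%:E.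
  by apply/funext => s; rewrite [rv_of_tuple s]thinmx0.
by rewrite e integral_cst//= diracT mule1.
Qed.

Lemma ge0_wint n (al : 'I_n -> R) h : rmeasurable h -> (forall x, 0 <= h x) ->
  wint al h = ((mass_prod al)%:E * \int[Pn al]_s (h (rv_of_tuple s))%:E)%E.
Proof.
elim: n al h => [|n IH] al h mh h0; first exact: wint0.
pose al' (i : 'I_n) := al (lift ord0 i).
have Z'0 : (0 <= (mass_prod al')%:E)%E by rewrite lee_fin ltW// mass_prod_gt0.
rewrite wintS (@ge0_integral_PnS R n al (EFin \o h)); last 2 first.
- exact: rmeasurable_EFin.
- by move=> x; rewrite lee_fin.
rewrite -/al'.
pose X t := (\int[Pn al']_s (EFin \o h) (cons_rv t (rv_of_tuple s)))%E.
have mX : measurable_fun setT X.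
  apply: (measurable_fun_fubini_tonelli_F (m2 := Pn al')
    (fun ts : R * n.-tuple R => (h (cons_rv ts.1 (rv_of_tuple ts.2)))%:E)).
  - rewrite (_ : (fun _ => _) = (EFin \o h \o @rv_of_tuple R n.+1) \o @cons_tuple R n).
      apply: measurableT_comp; last exact: measurable_cons_tuple.
      exact: rmeasurable_EFin.
    by apply/funext => ts /=; rewrite rv_of_cons_tuple.
  - by move=> ?; rewrite lee_fin.
have X0 t : (0 <= X t)%E by apply: integral_ge0 => s _; rewrite lee_fin.
have -> : mass_prod al = mono_gauss_mass (al ord0) * mass_prod al' by rewrite /mass_prod big_ord_recl.
rewrite (ge0_integral_nu (al ord0) mX X0).
rewrite -ge0_integralZl//; last 3 first.
- apply: emeasurable_funM => //.
  by apply/measurable_EFinP; exact: measurable_mono_gauss_pdf.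
- by move=> t _; rewrite mule_ge0// lee_fin mono_gauss_pdf_ge0.
- by rewrite lee_fin mulr_ge0 ?ltW// ?mono_gauss_mass_gt0// mass_prod_gt0.
apply: eq_integral => t _; rewrite IH; last 2 first.
- by apply: measurable_funM => //; exact: rmeasurable_slice.
- by move=> y; rewrite mulr_ge0// mono_gauss_ge0.
under eq_integral do rewrite (EFinM (mono_gauss _ _)).
rewrite ge0_integralZl//; last 3 first.
- exact: (rmeasurable_EFin (rmeasurable_slice t mh)).
- by move=> s _; rewrite lee_fin.
- by rewrite lee_fin mono_gauss_ge0.
rewrite -/(X t) !muleA -!EFinM; congr (_%:E * _)%E.
rewrite /mono_gauss_pdf; field.
by rewrite gt_eqF// mono_gauss_mass_gt0.
Qed.

Lemma nu_pdf0 (a : R) : nu a [set t | mono_gauss_pdf a t = 0] = 0%E.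
Proof.
by rewrite /nu; apply: integral0_eq => t /= ->.
Qed.

(** The induction hypothesis applies only to integrable slices, that is, for almost every [t] under
    [nu]. The outer integral is a Lebesgue one, so it is first rewritten as an integral for [nu]. *)
Lemma integrable_wint n (al : 'I_n -> R) h : rmeasurable h ->
  (Pn al).-integrable setT (fun s => (h (rv_of_tuple s))%:E) ->
  wint al h = ((mass_prod al)%:E * \int[Pn al]_s (h (rv_of_tuple s))%:E)%E.
Proof.
elim: n al h => [|n IH] al h mh ih; first exact: wint0.
pose al' (i : 'I_n) := al (lift ord0 i).
rewrite wintS (@integral_PnS R n al (EFin \o h))// -/al'.
pose X t := (\int[Pn al']_s (EFin \o h) (cons_rv t (rv_of_tuple s)))%E.
have mX : measurable_fun setT X by exact: (@measurable_integral_PnS R n al (EFin \o h)).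
pose phi t := wint al' (fun y => mono_gauss (al ord0) t * h (cons_rv t y)).
have mphi : measurable_fun setT phi.
  have -> : phi = (fun t => iint (fun y => (mono_gauss_prod al' y * (mono_gauss (al ord0) t * h (cons_rv t y)))%:E)).
    by apply/funext => t; rewrite /phi wintE.
  apply: measurable_iint; apply/measurable_EFinP; apply: measurable_funM.
    rewrite /mono_gauss_prod; apply: measurable_prod => i _.
    apply: (measurableT_comp (measurable_mono_gauss (al' i))).
    rewrite (_ : (fun _ => _) = (fun s => tnth s i) \o snd).
      by apply: measurableT_comp => //; exact: measurable_tnth.
    by apply/funext => ts /=; rewrite mxE.
  apply: measurable_funM.
    by apply: (measurableT_comp (measurable_mono_gauss (al ord0))).
  rewrite (_ : (fun _ => _) = (h \o @rv_of_tuple R n.+1) \o @cons_tuple R n).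
    by apply: measurableT_comp => //; exact: measurable_cons_tuple.
  by apply/funext => ts /=; rewrite rv_of_cons_tuple.
(* Dividing by the density exhibits [phi] as density times [psi]. Where the density is 0, [phi] is 0
   as well. *)
pose psi t := (phi t * ((mono_gauss_pdf (al ord0) t)^-1)%:E)%E.
have mV : measurable_fun setT (fun t => ((mono_gauss_pdf (al ord0) t)^-1)%:E).
  apply/measurable_EFinP.
  rewrite (_ : (fun _ => _) = (fun x => x `^ (-1)) \o mono_gauss_pdf (al ord0)).
    exact: measurableT_comp (measurable_powR _) (measurable_mono_gauss_pdf _).
  by apply/funext => t /=; rewrite powR_inv1// mono_gauss_pdf_ge0.
have mpsi : measurable_fun setT psi by exact: emeasurable_funM.
have phiE t : phi t = ((mono_gauss_pdf (al ord0) t)%:E * psi t)%E.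
  have [p0|p0] := eqVneq (mono_gauss_pdf (al ord0) t) 0; last first.
    by rewrite /psi muleCA -EFinM divff// mule1.
  rewrite p0 mul0e /phi ge0_wint.
  - under eq_integral.
      move=> s _.
      have -> : mono_gauss (al ord0) t = 0.
        by apply/eqP; move/eqP: p0; rewrite /mono_gauss_pdf mulf_eq0 invr_eq0 (gt_eqF (mono_gauss_mass_gt0 _)) orbF.
      rewrite mul0r; over.
    by rewrite integral0 mule0.
  - by apply: measurable_funM => //; exact: rmeasurable_slice.
  - move=> y; have -> : mono_gauss (al ord0) t = 0.
      by apply/eqP; move/eqP: p0; rewrite /mono_gauss_pdf mulf_eq0 invr_eq0 (gt_eqF (mono_gauss_mass_gt0 _)) orbF.
    by rewrite mul0r.
have mcons : measurable_fun setT ((EFin \o h \o @rv_of_tuple R n.+1) \o @cons_tuple R n).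
  apply: measurableT_comp; last exact: measurable_cons_tuple.
  exact: rmeasurable_EFin.
have ihc : ((nu (al ord0) : probability R R) \x Pn al')%E.-integrable setT ((EFin \o h \o @rv_of_tuple R n.+1) \o @cons_tuple R n).
  apply/integrableP; split => //.
  case/integrableP : ih => mh' hoo.
  apply: le_lt_trans hoo; rewrite le_eqVlt; apply/orP; left; apply/eqP; apply: esym.
  by apply: ge0_integral_distribution => //; exact: measurableT_comp.
transitivity (\int[mu]_t ((mono_gauss_pdf (al ord0) t)%:E * psi t))%E.
  by apply: eq_integral => t _; rewrite -phiE.
rewrite -integral_nu//.
have iX : (nu (al ord0)).-integrable setT X.
  have := integrable_fubini_F ihc; congr (integrable _ _); apply/funext => t.
  by apply: eq_integral => s _; rewrite /= rv_of_cons_tuple.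
rewrite -integralZl//.
apply: ae_eq_integral => //.
  by apply: emeasurable_funM.
have A1 : {ae nu (al ord0), forall t, mono_gauss_pdf (al ord0) t != 0}.
  exists [set t | mono_gauss_pdf (al ord0) t = 0]; split.
  - rewrite -[X in measurable X]setTI.
    exact: (@measurable_mono_gauss_pdf R (al ord0) measurableT [set 0] (measurable_set1 0)).
  - exact: nu_pdf0.
  - by move=> t /= /negP; rewrite negbK => /eqP.
have A2 := ae_integrable1 ihc.
apply: filterS2 A1 A2 => t p0 it _.
have {}it : (Pn al').-integrable setT (fun s => (h (cons_rv t (rv_of_tuple s)))%:E).
  move: it; congr (integrable _ _); apply/funext => s.
  by rewrite /= rv_of_cons_tuple.
rewrite /psi /phi IH; last 2 first.
- by apply: measurable_funM => //; exact: rmeasurable_slice.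
- under eq_fun do rewrite (EFinM (mono_gauss _ _)).
  exact: integrableZl.
under eq_integral do rewrite (EFinM (mono_gauss _ _)).
rewrite integralZl//.
have -> : mass_prod al = mono_gauss_mass (al ord0) * mass_prod al' by rewrite /mass_prod big_ord_recl.
rewrite -/(X t) muleC !muleA -!EFinM; congr (_%:E * _)%E.
have m0 := mono_gauss_mass_gt0 (al ord0).
have p0' : mono_gauss (al ord0) t != 0.
  by move: p0; apply: contra => /eqP e; rewrite /mono_gauss_pdf e mul0r.
rewrite /mono_gauss_pdf; field.
by rewrite p0' gt_eqF.
Qed.

Lemma ZAE n (al : 'I_n -> R) : ZA al = mass_prod al.
Proof.
rewrite /ZA ge0_wint//; last exact: measurable_cst.
by have := EnE al (pbm_cst n 1); rewrite En_cst => ->; rewrite mule1.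
Qed.

Let muA_wint n (al : 'I_n -> R) h (I : \bar R) :
  wint al h = ((mass_prod al)%:E * I)%E -> muA al h = I.
Proof.
move=> e; rewrite /muA e ZAE muleAC -EFinM divff ?mul1e//.
by rewrite gt_eqF// mass_prod_gt0.
Qed.

Lemma ge0_muA n (al : 'I_n -> R) h : rmeasurable h -> (forall x, 0 <= h x) ->
  (muA al h = \int[Pn al]_s (h (rv_of_tuple s))%:E)%E.
Proof. by move=> mh h0; apply: muA_wint; exact: ge0_wint. Qed.

Lemma integrable_muA n (al : 'I_n -> R) h : rmeasurable h ->
  (Pn al).-integrable setT (fun s => (h (rv_of_tuple s))%:E) ->
  (muA al h = \int[Pn al]_s (h (rv_of_tuple s))%:E)%E.
Proof. by move=> mh h0; apply: muA_wint; exact: integrable_wint. Qed.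

End IteratedIntegral.

(** * Smooth compactly supported functions *)

Section SmoothFunctions.
Context {R : realType}.
Implicit Types (t : R) (n k : nat).

(** Rounding [t] down to the grid of step 1/(k+1) makes every preimage a countable union of
    rectangles; continuity in [t] gives pointwise convergence. *)
Lemma measurable_caratheodory d (T : measurableType d) (h : R * T -> R) :
  (forall q, measurable_fun setT (fun y => h (q, y))) ->
  (forall y, continuous (fun t => h (t, y))) -> measurable_fun setT h.
Proof.
move=> hm hc.
pose fl (k : nat) t : int := Num.floor (t * k.+1%:R).
pose h_ k (ty : R * T) := h ((fl k ty.1)%:~R / k.+1%:R, ty.2).
apply: (measurable_fun_cvg (h := h_)).
- move=> k _ A mA; rewrite setTI.
  have -> : h_ k @^-1` A = \bigcup_(z : int)
     ([set t | fl k t = z] `*` [set y | A (h (z%:~R / k.+1%:R, y))]).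
    apply/seteqP; split=> [[t y] /= H|[t y] [z _ [/= <- //]]].
    by exists (fl k t).
  apply: countable_bigcupT_measurable => [|z]; first exact: countableP.
  apply: measurableX.
  - have -> : [set t | fl k t = z] = `[z%:~R / k.+1%:R, (z + 1)%:~R / k.+1%:R[%classic.
      have k0 : 0 < k.+1%:R :> R by rewrite ltr0n.
      apply/seteqP; split=> t /=; rewrite in_itv/= ler_pdivrMr// ltr_pdivlMr//.
        by move=> <-; rewrite floor_le_tmp floorD1_gt.
      by move=> h'; exact: floor_def.
    exact: measurable_itv.
  - have := hm (z%:~R / k.+1%:R) measurableT A mA; rewrite setTI; exact.
- move=> [t y] _ /=; rewrite /h_/=.
  apply: (cvg_comp (fun k => (fl k t)%:~R / k.+1%:R) (fun t => h (t, y))); last exact: hc.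
  apply/cvgrPdist_le => e e0; near=> k.
  have k0 : 0 < k.+1%:R :> R by rewrite ltr0n.
  have ke : harmonic k <= e.
    near: k; apply: (cvgr_le 0) => //; exact: cvg_harmonic.
  apply: le_trans ke; rewrite /harmonic/=.
  have -> : t - (fl k t)%:~R / k.+1%:R = (t * k.+1%:R - (fl k t)%:~R) / k.+1%:R.
    by field; rewrite gt_eqF.
  rewrite normrM (ger0_norm (_ : 0 <= k.+1%:R^-1)) ?invr_ge0//.
  rewrite ler_piMl ?invr_ge0// ger0_norm ?subr_ge0 ?floor_le_tmp//.
  by rewrite lerBlDr addrC -[1]/(1%:~R) -intrD ltW// floorD1_gt.
Unshelve. all: by end_near. Qed.

(** Measurability refers to the product sigma-algebra on tuples, where coordinates can be peeled off
    one at a time; separate continuity is what each peeling uses. *)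
Lemma rmeasurable_directional n (f : 'rV[R]_n -> R) :
  (forall i x, continuous (fun t : R => f (x + t *: evec R i))) -> rmeasurable f.
Proof.
elim: n f => [|n IH] f fc.
  rewrite /rmeasurable (_ : _ \o _ = cst (f 0)); first exact: measurable_cst.
  by apply/funext => s /=; congr f; apply/rowP => -[].
rewrite /rmeasurable (_ : _ \o _ =
  (fun ts : R * n.-tuple R => f (cons_rv ts.1 (rv_of_tuple ts.2))) \o
  (fun s : n.+1.-tuple R => (thead s, [tuple of behead s] : n.-tuple R))); last first.
  apply/funext => s /=; congr f; apply/rowP => i; rewrite mxE.
  case: (unliftP ord0 i) => [j|] ->; last by rewrite cons_rv0.
  by rewrite cons_rvS mxE {1}(tuple_eta s) tnthS.
apply: measurableT_comp.
  apply: measurable_caratheodory => [q|s] /=.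
    apply: (IH (fun y => f (cons_rv q y))) => i x.
    have -> : (fun h : R => f (cons_rv q (x + h *: evec R i))) =
      (fun h => f (cons_rv q x + h *: evec R (lift ord0 i))).
      by apply/funext => h; rewrite addrC cons_rv_shiftS addrC.
    exact: fc.
  have -> : (fun t : R => f (cons_rv t (rv_of_tuple s))) =
    (fun t => f (cons_rv 0 (rv_of_tuple s) + t *: evec R ord0)).
    by apply/funext => h; rewrite addrC -cons_rv_shift0 addr0.
  exact: fc.
apply/measurable_fun_pairP; split; last exact: measurable_behead.
exact: measurable_tnth.
Qed.

Lemma continuous_directional n (f : 'rV[R]_n -> R) : continuous f ->
  forall i x, continuous (fun t : R => f (x + t *: evec R i)).
Proof.
move=> fc i x t; apply: (cvg_comp (fun t : R => x + t *: evec R i) f); last exact: fc.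
by apply: cvgD; [exact: cvg_cst|exact: scalel_continuous].
Qed.

Lemma continuous_rmeasurable n (f : 'rV[R]_n -> R) : continuous f -> rmeasurable f.
Proof. by move=> /continuous_directional; exact: rmeasurable_directional. Qed.

Lemma coord_le_norm n (x : 'rV[R]_n) i : `|x ord0 i| <= `|x|.
Proof.
rewrite [leRHS]mx_normrE.
exact: (le_bigmax _ (fun ij : 'I_1 * 'I_n => `|x ij.1 ij.2|) (ord0, i)).
Qed.

Lemma compact_support_pbm n (f : 'rV[R]_n -> R) : continuous f ->
  (exists M, forall x, M < `|x| -> f x = 0) -> pbm f.
Proof.
move=> cf [M fM]; split; first exact: continuous_rmeasurable.
(* The norm is the sup norm, so the ball that contains the support is this box. *)
pose A := [set v : 'rV[R]_n | forall i, `[- M, M]%classic (v ord0 i)].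
have cA : compact A.
  by apply: (@rV_compact R n (fun=> `[- M, M]%classic)) => i; exact: segment_compact.
have /compact_bounded[K [_ KA]] : compact (f @` A).
  by apply: continuous_compact => //; exact: continuous_subspaceT.
exists (`|K| + 1), 0%N => x; rewrite expr0 mulr1.
have [Ax|nAx] := pselect (A x).
  apply: (KA (`|K| + 1)); last by exists x.
  by rewrite (le_lt_trans (ler_norm _))// ltrDl.
rewrite fM ?normr0 ?addr_ge0//.
move: nAx => /existsNP[i]; rewrite /= in_itv/= -ler_norml => /negP.
by rewrite -ltNge => /lt_le_trans; apply; exact: coord_le_norm.
Qed.

Lemma derive_support n (f : 'rV[R]_n -> R) v M : (forall x, M < `|x| -> f x = 0) ->
  forall x, M < `|x| -> 'D_v f x = 0.
Proof.
move=> fM x Mx.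
rewrite (@near_eq_derive _ _ _ _ (cst 0)); first by rewrite derive_cst.
near=> y; apply: fM; near: y.
by apply: (cvgr_gt `|x|) => //; exact: norm_continuous.
Unshelve. all: by end_near. Qed.

Lemma smooth_compact_C1pb n (f : 'rV[R]_n -> R) : smooth f ->
  (exists M, forall x, M < `|x| -> f x = 0) ->
  C1pb f (fun i => 'D_(evec R i) f).
Proof.
move=> sf [M fM].
have [cf df] := sf [::].
have cd i : continuous ('D_(evec R i) f) by have [] := sf [:: i].
split.
- by move=> i x; split; [exact: df|].
- by move=> i x; exact: (continuous_directional (cd i)).
- by apply: compact_support_pbm => //; exists M.
- move=> i; apply: compact_support_pbm => //.
  by exists M; exact: derive_support.
Qed.

Lemma is_derive_directional n (f : 'rV[R]_n -> R) x i l :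
  is_derive (0 : R) 1 (fun t => f (x + t *: evec R i)) l -> is_derive x (evec R i) f l.
Proof.
have e : (fun h : R => h^-1 *: (f (x + (h *: 1 + 0) *: evec R i) - f (x + 0 *: evec R i))) =
  (fun h : R => h^-1 *: (f (h *: evec R i + x) - f x)).
  apply/funext => h; rewrite scale0r !addr0; congr (_ *: (f _ - _)).
  by rewrite addrC /GRing.scale/= mulr1.
by case; rewrite /derivable /derive e => h1 h2; split.
Qed.

Lemma dotv_shift n (c x : 'rV[R]_n) t i :
  dotv c (x + t *: evec R i) = dotv c x + c ord0 i * t.
Proof.
rewrite /dotv; under eq_bigr do rewrite !mxE/= mulrDr.
rewrite big_split/=; congr (_ + _); rewrite (bigD1 i)//= eqxx mulr1 big1 ?addr0//.
by move=> j ji; rewrite (negbTE ji) !mulr0.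
Qed.

Lemma pbm_dotv n (c : 'rV[R]_n) : pbm (fun x => dotv c x).
Proof. by apply: pbm_sum => i; apply: pbmZ; exact: pbm_coord. Qed.

Lemma C1pbD_dotv n (f : 'rV[R]_n -> R) d (c : 'rV[R]_n) : C1pb f d ->
  C1pb (fun x => f x + dotv c x) (fun i x => d i x + c ord0 i).
Proof.
move=> [df cd mf md]; split.
- move=> i x; have dfx := df i x.
  have dc : is_derive x (evec R i) (fun x => dotv c x) (c ord0 i).
    apply: is_derive_directional.
    have -> : (fun t => dotv c (x + t *: evec R i)) = (fun t => dotv c x + c ord0 i * t).
      by apply/funext => t; rewrite dotv_shift.
    by apply: is_derive_eq; rewrite /GRing.scale/=; ring.
  exact: is_deriveD.
- by move=> i x t; apply: cvgD; [exact: cd|exact: cvg_cst].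
- by apply: pbmD => //; exact: pbm_dotv.
- by move=> i; apply: pbmD => //; exact: pbm_cst.
Qed.

End SmoothFunctions.

(** * Moments and square integrability *)

Section Moments.
Context {R : realType}.
Implicit Types (n : nat).

Lemma pbm_comp_coord n (h : R -> R) (i : 'I_n) : pbm1 h -> pbm (fun x : 'rV[R]_n => h (x ord0 i)).
Proof.
move=> [mh /pbound1P[K [k [K0 hK]]]]; split.
  rewrite /rmeasurable (_ : _ \o _ = h \o (fun s => tnth s i)).
    by apply: measurableT_comp => //; exact: measurable_tnth.
  by apply/funext => s /=; rewrite mxE.
exists K, k => x; rewrite (le_trans (hK _))// ler_wpM2l//.
have o0 (z : R) : 0 <= 1 + z ^+ 2 by exact: le_trans (le1_oneDsqr z).
apply: lerXn2r; rewrite ?nnegrE//; first exact: le_trans (polyw_ge1 _).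
rewrite /polyw (bigD1 i)//= ler_peMr//.
elim/big_ind: _ => // [a b a1 b1|j _]; last exact: le1_oneDsqr.
by rewrite -[1]mulr1 ler_pM.
Qed.

Lemma pbm_prod n (I : Type) (r : seq I) (f : I -> 'rV[R]_n -> R) :
  (forall i, pbm (f i)) -> pbm (fun x => \prod_(i <- r) f i x).
Proof.
move=> mf; elim: r => [|i r IH].
  rewrite (_ : (fun _ => _) = fun=> 1); first exact: pbm_cst.
  by apply/funext => x; rewrite big_nil.
rewrite (_ : (fun _ => _) = fun x => f i x * \prod_(j <- r) f j x); first exact: pbmM.
by apply/funext => x; rewrite big_cons.
Qed.

Lemma En_prod n (al : 'I_n -> R) (h : 'I_n -> R -> R) : (forall i, pbm1 (h i)) ->
  En al (fun x => \prod_i h i (x ord0 i)) = \prod_i E1 (al i) (h i).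
Proof.
elim: n al h => [|n IH] al h mh.
  rewrite big_ord0 -[RHS](En_cst al); congr (En al _).
  by apply/funext => x; rewrite big_ord0.
have mp m (k : 'I_m -> R -> R) : (forall i, pbm1 (k i)) -> pbm (fun x : 'rV[R]_m => \prod_i k i (x ord0 i)).
  by move=> mk; apply: pbm_prod => i; exact: (pbm_comp_coord i (mk i)).
rewrite EnS; last exact: mp.
rewrite big_ord_recl -(IH (fun i : 'I_n => al (lift ord0 i)) (fun i : 'I_n => h (lift ord0 i)))//.
rewrite [RHS]mulrC -E1Z//; congr (E1 _ _); apply/funext => t.
rewrite mulrC -EnZ; last by apply: (mp _ (fun i => h (lift ord0 i))) => i; exact: mh.
congr (En _ _); apply/funext => y; rewrite big_ord_recl cons_rv0; congr (_ * _).
by apply: eq_bigr => i _; rewrite cons_rvS.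
Qed.

Lemma En_coord1 n (al : 'I_n -> R) i (h : R -> R) : pbm1 h ->
  En al (fun x => h (x ord0 i)) = E1 (al i) h.
Proof.
move=> mh; pose H l := if l == i then h else fun=> 1.
have mH l : pbm1 (H l) by rewrite /H; case: (l == i) => //; exact: pbm1_cst.
transitivity (En al (fun x => \prod_l H l (x ord0 l))).
  congr (En _ _); apply/funext => x; rewrite (bigD1 i)//= /H eqxx big1 ?mulr1// => j.
  by move=> /negbTE ->.
rewrite En_prod// (bigD1 i)//= /H eqxx big1 ?mulr1// => j /negbTE ->.
by rewrite E1_cst.
Qed.

Lemma En_coord2 n (al : 'I_n -> R) i j (h k : R -> R) : i != j -> pbm1 h -> pbm1 k ->
  En al (fun x => h (x ord0 i) * k (x ord0 j)) = E1 (al i) h * E1 (al j) k.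
Proof.
move=> ij mh mk; pose H l := if l == i then h else if l == j then k else fun=> 1.
have mH l : pbm1 (H l).
  by rewrite /H; case: (l == i) => //; case: (l == j) => //; exact: pbm1_cst.
have ji : j != i by rewrite eq_sym.
have Hi : H i = h by rewrite /H eqxx.
have Hj : H j = k by rewrite /H (negbTE ji) eqxx.
have H1 l : (l != i) && (l != j) -> H l = fun=> 1.
  by rewrite /H => /andP[/negbTE -> /negbTE ->].
transitivity (En al (fun x => \prod_l H l (x ord0 l))).
  congr (En _ _); apply/funext => x; rewrite (bigD1 i)//= (bigD1 j)//=.
  by rewrite Hi Hj big1 ?mulr1// => l /H1 ->.
rewrite (En_prod _ mH) (bigD1 i isT)/= (bigD1 j ji)/= Hi Hj.
have -> : \prod_(l < n | (l != i) && (l != j)) E1 (al l) (H l) = 1.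
  by apply: big1 => l /H1 ->; exact: E1_cst.
by move: (E1 (al i) h) (E1 (al j) k) => A B; rewrite mulr1.
Qed.

(** The coordinate x_i has mean 0 and second moment 1 and is independent of the others, which need
    not be centred. *)
Lemma En_coord_dotv n (al : 'I_n -> R) i (c : 'rV[R]_n) : al i = 0 ->
  En al (fun x => x ord0 i * dotv c x) = c ord0 i.
Proof.
move=> ai.
have mm l : pbm (fun x : 'rV[R]_n => x ord0 i * x ord0 l) by apply: pbmM; exact: pbm_coord.
transitivity (En al (fun x => \sum_l c ord0 l * (x ord0 i * x ord0 l))).
  congr (En _ _); apply/funext => x; rewrite /dotv mulr_sumr.
  by apply: eq_bigr => l _; rewrite mulrCA.
rewrite En_sum; last by move=> l; exact: pbmZ.
rewrite (bigD1 i)//= big1 ?addr0.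
  rewrite EnZ//; have := En_coord1 al i (pbm1X 2 (@pbm1_id R)).
  by rewrite ai E1_gauss2 /= => ->; rewrite mulr1.
move=> l li; rewrite EnZ// (En_coord2 al _ (@pbm1_id R) (@pbm1_id R)); last by rewrite eq_sym.
by rewrite ai E1_gauss1 mul0r mulr0.
Qed.

End Moments.

(** * Square integrable functions and their limits *)

Section SquareIntegrable.
Context {R : realType}.
Variables (n : nat) (al : 'I_n -> R).
Implicit Types f g h : 'rV[R]_n -> R.

Definition Pint f := rmeasurable f /\ (Pn al).-integrable setT (fun s => (f (rv_of_tuple s))%:E).

Definition sqint f := rmeasurable f /\ Pint (fun x => f x ^+ 2).

Lemma PintE f : Pint f -> muA al f = (En al f)%:E.
Proof.
move=> [mf jf]; rewrite integrable_muA// fineK//.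
exact: integrable_fin_num.
Qed.

Lemma Pint_le f g : rmeasurable f -> Pint g -> (forall x, `|f x| <= g x) -> Pint f.
Proof.
move=> mf [mg ig] fg; split => //.
apply: le_integrable ig => //; first exact: rmeasurable_EFin.
by move=> s _; rewrite /= lee_fin (le_trans (fg _))// ler_norm.
Qed.

Lemma pbm_Pint f : pbm f -> Pint f.
Proof. by move=> mf; split; [case: mf|exact: pbm_integrable]. Qed.

Lemma PintD f g : Pint f -> Pint g -> Pint (fun x => f x + g x).
Proof.
move=> [mf jf] [mg ig]; split; first exact: measurable_funD.
by under eq_fun do rewrite EFinD; exact: integrableD.
Qed.

Lemma PintZ (c : R) f : Pint f -> Pint (fun x => c * f x).
Proof.
move=> [mf jf]; split; first exact: measurable_funM.
by under eq_fun do rewrite EFinM; exact: integrableZl.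
Qed.

Lemma Pint_sum (I : Type) (r : seq I) (f : I -> 'rV[R]_n -> R) :
  (forall i, Pint (f i)) -> Pint (fun x => \sum_(i <- r) f i x).
Proof.
move=> mf; elim: r => [|i r IH].
  rewrite (_ : (fun _ => _) = fun=> 0); first exact/pbm_Pint/pbm_cst.
  by apply/funext => x; rewrite big_nil.
rewrite (_ : (fun _ => _) = fun x => f i x + \sum_(j <- r) f j x); first exact: PintD.
by apply/funext => x; rewrite big_cons.
Qed.

Lemma PEnD f g : Pint f -> Pint g -> En al (fun x => f x + g x) = En al f + En al g.
Proof. by move=> [_ ?] [_ ?]; rewrite /En RintegralD. Qed.

Lemma PEnZ c f : Pint f -> En al (fun x => c * f x) = c * En al f.
Proof. by move=> [_ ?]; rewrite /En RintegralZl. Qed.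

Lemma PEn_sum (I : Type) (r : seq I) (f : I -> 'rV[R]_n -> R) :
  (forall i, Pint (f i)) -> En al (fun x => \sum_(i <- r) f i x) = \sum_(i <- r) En al (f i).
Proof.
move=> mf; elim: r => [|i r IH].
  rewrite big_nil -[RHS](En_cst al); congr (En al _); apply/funext => x; by rewrite big_nil.
rewrite big_cons -IH -PEnD//; last exact: Pint_sum.
by congr (En al _); apply/funext => x; rewrite big_cons.
Qed.

Lemma PEn_le f g : Pint f -> Pint g -> (forall x, f x <= g x) -> En al f <= En al g.
Proof. by move=> [_ ?] [_ ?] fg; apply: le_Rintegral. Qed.

Lemma pbm_sqint f : pbm f -> sqint f.
Proof. by move=> mf; split; [case: mf|apply: pbm_Pint; exact: pbmX]. Qed.

Lemma sqintM f g : sqint f -> sqint g -> Pint (fun x => f x * g x).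
Proof.
move=> [mf f2] [mg g2]; apply: Pint_le (PintD f2 g2) _; first exact: measurable_funM.
move=> x; rewrite normrM -[f x ^+ 2]real_normK ?num_real// -[g x ^+ 2]real_normK ?num_real//.
have := sqr_ge0 (`|f x| - `|g x|); have := normr_ge0 (f x); have := normr_ge0 (g x); nra.
Qed.

Lemma sqintD f g : sqint f -> sqint g -> sqint (fun x => f x + g x).
Proof.
move=> sf sg; split; first by case: sf => ? _; case: sg => ? _; exact: measurable_funD.
rewrite (_ : (fun _ => _) = (fun x => (f x ^+ 2 + g x ^+ 2) + 2 * (f x * g x))); last first.
  by apply/funext => x; ring.
apply: PintD; first by case: sf => _ ?; case: sg => _ ?; exact: PintD.
by apply: PintZ; exact: sqintM.
Qed.

Lemma sqintZ c f : sqint f -> sqint (fun x => c * f x).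
Proof.
move=> [mf f2]; split; first exact: measurable_funM.
rewrite (_ : (fun _ => _) = (fun x => c ^+ 2 * f x ^+ 2)); first exact: PintZ.
by apply/funext => x; ring.
Qed.

Lemma sqintB f g : sqint f -> sqint g -> sqint (fun x => f x - g x).
Proof.
move=> sf sg; have := sqintD sf (sqintZ (-1) sg).
by under eq_fun do rewrite mulN1r.
Qed.

Lemma sqint_Pint f : sqint f -> Pint f.
Proof.
move=> sf; have := sqintM sf (pbm_sqint (pbm_cst n 1)).
by under eq_fun do rewrite mulr1.
Qed.

Lemma sqr_En_le f h : sqint f -> sqint h ->
  En al (fun x => f x * h x) ^+ 2 <= En al (fun x => f x ^+ 2) * En al (fun x => h x ^+ 2).
Proof.
move=> sf sh; have [mf f2] := sf; have [mh h2] := sh.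
have fh := sqintM sf sh.
set A := En al (fun x => f x ^+ 2); set B := En al (fun x => h x ^+ 2).
set C := En al (fun x => f x * h x).
have key (s t : R) : 0 <= s ^+ 2 * A + 2 * s * t * C + t ^+ 2 * B.
  have -> : s ^+ 2 * A + 2 * s * t * C + t ^+ 2 * B = En al (fun x => (s * f x + t * h x) ^+ 2).
    rewrite /A /B /C -!PEnZ// -!PEnD//.
    - by congr (En al _); apply/funext => x; ring.
    - by apply: PintD; exact: PintZ.
    - exact: PintZ.
    - exact: PintZ.
    - exact: PintZ.
  by apply: En_ge0 => x; exact: sqr_ge0.
have A0 : 0 <= A by have := key 1 0; nra.
have B0 : 0 <= B by have := key 0 1; nra.
have [B00|Bn0] := eqVneq B 0.
  (* For B = 0 this choice turns the quadratic form into -C^2. *)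
  have := key C (- (A + 1)/2); rewrite B00 mulr0 addr0; nra.
(* The minimizer up to scaling: the form becomes B (A B - C^2). *)
have := key B (- C).
have -> : B ^+ 2 * A + 2 * B * - C * C + (- C) ^+ 2 * B = B * (A * B - C ^+ 2) by ring.
by rewrite pmulr_rge0 ?subr_ge0// lt_neqAle eq_sym Bn0.
Qed.

Lemma sqr_cvg0 (a_ b_ : nat -> R) : (forall k, a_ k ^+ 2 <= b_ k) ->
  b_ @ \oo --> (0 : R) -> a_ @ \oo --> (0 : R).
Proof.
move=> ab b0; apply/cvgr0Pnorm_le => e e0; near=> k.
rewrite -(@ler_pXn2r _ 2)// ?nnegrE// ?(ltW e0)// real_normK ?num_real//.
rewrite (le_trans (ab k))//; near: k.
by apply: (cvgr_le 0) => //; exact: exprn_gt0.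
Unshelve. all: by end_near. Qed.

Variables (phi : nat -> 'rV[R]_n -> R) (u : 'rV[R]_n -> R).
Hypotheses (sphi : forall k, sqint (phi k)) (su : sqint u).
Hypothesis phiu : (fun k => En al (fun x => (phi k x - u x) ^+ 2)) @ \oo --> (0 : R).

Lemma cvg_En_mul h : sqint h ->
  (fun k => En al (fun x => phi k x * h x)) @ \oo --> En al (fun x => u x * h x).
Proof.
move=> sh; apply/subr_cvg0.
apply: (@sqr_cvg0 _ (fun k => En al (fun x => (phi k x - u x) ^+ 2) * En al (fun x => h x ^+ 2))).
  move=> k; rewrite [X in X ^+ 2 <= _](_ : _ = En al (fun x => (phi k x - u x) * h x)).
    by apply: sqr_En_le => //; exact: sqintB.
  have p1 := sqintM (sphi k) sh; have p2 := PintZ (-1) (sqintM su sh).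
  rewrite /= -mulN1r -PEnZ; last exact: sqintM.
  by rewrite -PEnD//; congr (En al _); apply/funext => x; ring.
by rewrite -[X in _ --> X](mul0r (En al (fun x => h x ^+ 2))); apply: cvgM => //; exact: cvg_cst.
Qed.

(** Write phi^2 = (phi - u)^2 + 2 phi u - u^2, where the middle term converges by pairing with the
    fixed function [u]. *)
Lemma cvg_En_sqr : (fun k => En al (fun x => phi k x ^+ 2)) @ \oo --> En al (fun x => u x ^+ 2).
Proof.
have -> : (fun k => En al (fun x => phi k x ^+ 2)) =
   (fun k => En al (fun x => (phi k x - u x) ^+ 2) + (2 * En al (fun x => phi k x * u x) + - En al (fun x => u x ^+ 2))).
  apply/funext => k.
  have [_ p1] := sqintB (sphi k) su; have p2 := PintZ 2 (sqintM (sphi k) su).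
  have [_ u2] := su; have p3 := PintZ (-1) u2.
  rewrite -mulN1r -!PEnZ//; last exact: sqintM.
  rewrite -!PEnD//; last exact: PintD.
  by congr (En al _); apply/funext => x; ring.
rewrite [X in _ --> X](_ : _ = 0 + (2 * En al (fun x => u x * u x) + - En al (fun x => u x ^+ 2))); last first.
  rewrite (_ : (fun x => u x * u x) = (fun x => u x ^+ 2)); first by ring.
  by apply/funext => x; rewrite expr2.
apply: cvgD => //; apply: cvgD; last exact: cvg_cst.
by apply: cvgM; [exact: cvg_cst|exact: cvg_En_mul].
Qed.

End SquareIntegrable.

(** * The stability inequality *)

Section Inequality.
Context {R : realType}.
Variables (n : nat) (al : 'I_n -> R).
Hypothesis al0 : forall i, 0 <= al i.

(** Both sides are continuous in L^2. The approximants may grow polynomially, since a linear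
    function is going to be added to the elements of N_*. *)
Lemma poincare_limit (f_ : nat -> 'rV[R]_n -> R) (d_ : nat -> 'I_n -> 'rV[R]_n -> R)
    (f : 'rV[R]_n -> R) (G : 'I_n -> 'rV[R]_n -> R) :
  (forall k, C1pb (f_ k) (d_ k)) -> sqint al f -> (forall i, sqint al (G i)) ->
  (fun k => En al (fun x => (f_ k x - f x) ^+ 2)) @ \oo --> (0 : R) ->
  (forall i, (fun k => En al (fun x => (d_ k i x - G i x) ^+ 2)) @ \oo --> (0 : R)) ->
  En al (fun x => f x ^+ 2) <= En al f ^+ 2 + 2^-1 * \sum_i En al (fun x => G i x ^+ 2)
   + 2^-1 * \sum_i (if al i == 0 then En al (fun x => x ord0 i * f x) ^+ 2 else 0).
Proof.
move=> hf sf sG cf cG.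
have sf_ k : sqint al (f_ k) by apply: pbm_sqint; case: (hf k).
have sd_ k i : sqint al (d_ k i) by apply: pbm_sqint; case: (hf k).
have c1 := cvg_En_sqr sf_ sf cf.
have c2 : (fun k => En al (f_ k)) @ \oo --> En al f.
  have := cvg_En_mul sf_ sf cf (pbm_sqint al (pbm_cst n 1)).
  rewrite (_ : (fun k => _) = (fun k => En al (f_ k))); last first.
    by apply/funext => k; congr (En al _); apply/funext => x; rewrite mulr1.
  by rewrite (_ : (fun x => f x * 1) = f)//; apply/funext => x; rewrite mulr1.
have c3 i : (fun k => En al (fun x => x ord0 i * f_ k x)) @ \oo --> En al (fun x => x ord0 i * f x).
  have := cvg_En_mul sf_ sf cf (pbm_sqint al (@pbm_coord R n i)).
  rewrite (_ : (fun k => _) = (fun k => En al (fun x => x ord0 i * f_ k x))); last first.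
    by apply/funext => k; congr (En al _); apply/funext => x; rewrite mulrC.
  rewrite (_ : (fun x => f x * x ord0 i) = fun x => x ord0 i * f x)//.
  by apply/funext => x; rewrite mulrC.
have sq (a_ : nat -> R) (l : R) : a_ @ \oo --> l -> (fun k => a_ k ^+ 2) @ \oo --> l ^+ 2.
  move=> al'; rewrite (_ : (fun k => a_ k ^+ 2) = fun k => a_ k * a_ k).
    by rewrite expr2; exact: cvgM.
  by apply/funext => k; rewrite expr2.
have csum (a_ : 'I_n -> nat -> R) (l : 'I_n -> R) : (forall i, a_ i @ \oo --> l i) ->
    (fun k => \sum_i a_ i k) @ \oo --> \sum_i l i.
  move=> h; elim: (index_enum 'I_n) => [|i r IH].
    by under eq_fun do rewrite big_nil; rewrite big_nil; exact: cvg_cst.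
  under eq_fun do rewrite big_cons.
  by rewrite big_cons; apply: cvgD.
have c4 : (fun k => En al (f_ k) ^+ 2 + 2^-1 * \sum_i En al (fun x => d_ k i x ^+ 2)
   + 2^-1 * \sum_i (if al i == 0 then En al (fun x => x ord0 i * f_ k x) ^+ 2 else 0)) @ \oo -->
   En al f ^+ 2 + 2^-1 * \sum_i En al (fun x => G i x ^+ 2)
   + 2^-1 * \sum_i (if al i == 0 then En al (fun x => x ord0 i * f x) ^+ 2 else 0).
  apply: cvgD.
    apply: cvgD; first exact: sq.
    apply: cvgM; first exact: cvg_cst.
    apply: (csum (fun i k => En al (fun x => d_ k i x ^+ 2))) => i.
    exact: (cvg_En_sqr (fun k => sd_ k i) (sG i) (cG i)).
  apply: cvgM; first exact: cvg_cst.
  apply: (csum (fun i k => if al i == 0 then En al (fun x => x ord0 i * f_ k x) ^+ 2 else 0)) => i.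
  by case: (al i == 0); [exact: sq|exact: cvg_cst].
apply: (ler_cvg_to c1 c4); near=> k; exact: poincare_product.
Unshelve. all: by end_near. Qed.

(** The variance on the left contributes 2 c2 + Vl; after cancellation what remains to be shown is 2
    c02 <= c2 + Vl, the sum of the last two hypotheses. *)
Lemma deficit_arith (Eu2 m Sg2 Scg c2 c02 Vl : R) :
  Eu2 - m ^+ 2 + 2 * c2 + Vl <= 2^-1 * (Sg2 + 2 * Scg + c2) + 2^-1 * (4 * c02) ->
  c02 <= c2 -> c02 <= Vl ->
  2^-1 * (Sg2 - 2 * Scg + c2) <= Sg2 - (Eu2 - m ^+ 2).
Proof. lra. Qed.

Lemma stability_L2 (u : 'rV[R]_n -> R) (g : 'I_n -> 'rV[R]_n -> R) (c : 'rV[R]_n) :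
  sqint al u -> (forall i, sqint al (g i)) ->
  (forall i, c ord0 i = En al (fun x => (u x - En al u) * x ord0 i)) ->
  (En al (fun x => (u x + dotv c x) ^+ 2) <= En al (fun x => u x + dotv c x) ^+ 2
     + 2^-1 * \sum_i En al (fun x => (g i x + c ord0 i) ^+ 2)
     + 2^-1 * \sum_i (if al i == 0 then En al (fun x => x ord0 i * (u x + dotv c x)) ^+ 2 else 0)) ->
  2^-1 * \sum_i En al (fun x => (g i x - c ord0 i) ^+ 2) <=
    \sum_i En al (fun x => g i x ^+ 2) - En al (fun x => (u x - En al u) ^+ 2).
Proof.
move=> su sg cE key.
pose m := En al u; pose L := fun x : 'rV[R]_n => dotv c x.
have mL : pbm L by exact: pbm_dotv.
have sL : sqint al L by exact: pbm_sqint.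
have iu : Pint al u by exact: sqint_Pint.
have iL : Pint al L by exact: sqint_Pint.
have icst (a : R) : Pint al (fun=> a) by apply: pbm_Pint; exact: pbm_cst.
have ix i : Pint al (fun x => x ord0 i) by apply: pbm_Pint; exact: pbm_coord.
have sx i : sqint al (fun x => x ord0 i) by apply: pbm_sqint; exact: pbm_coord.
have [mu' iu2] := su; have [mL' iL2] := sL.
have iuL := sqintM su sL.
have iux i : Pint al (fun x => u x * x ord0 i) by exact: sqintM.
have e1 : En al (fun x => (u x - m) ^+ 2) = En al (fun x => u x ^+ 2) - m ^+ 2.
  transitivity (En al (fun x => u x ^+ 2 + ((- 2 * m) * u x + m ^+ 2))).
    by congr (En al _); apply/funext => x; ring.
  rewrite PEnD//; last by apply: PintD => //; exact: PintZ.
  by rewrite PEnD//; [rewrite PEnZ// En_cst /m; ring|exact: PintZ].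
have cE' i : c ord0 i = En al (fun x => u x * x ord0 i) - m * En al (fun x => x ord0 i).
  rewrite cE; transitivity (En al (fun x => u x * x ord0 i + (- m) * x ord0 i)).
    by congr (En al _); apply/funext => x; rewrite /m; ring.
  by rewrite PEnD//; [rewrite PEnZ// mulNr|exact: PintZ].
have uxE i : En al (fun x => u x * x ord0 i) = c ord0 i + m * En al (fun x => x ord0 i).
  by rewrite cE'; ring.
have eL : En al L = \sum_i c ord0 i * En al (fun x => x ord0 i).
  rewrite PEn_sum; last by move=> i; exact: PintZ.
  by apply: eq_bigr => i _; rewrite PEnZ.
pose c2 := \sum_i c ord0 i ^+ 2.
have euL : En al (fun x => u x * L x) = c2 + m * En al L.
  transitivity (En al (fun x => \sum_i c ord0 i * (u x * x ord0 i))).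
    congr (En al _); apply/funext => x; rewrite /L /dotv mulr_sumr.
    by apply: eq_bigr => i _; rewrite mulrCA.
  rewrite PEn_sum; last by move=> i; exact: PintZ.
  rewrite eL mulr_sumr -big_split/=; apply: eq_bigr => i _.
  by rewrite PEnZ// uxE; ring.
have e2 : En al (fun x => (u x + L x) ^+ 2) = En al (fun x => u x ^+ 2) + 2 * (c2 + m * En al L) + En al (fun x => L x ^+ 2).
  transitivity (En al (fun x => (u x ^+ 2 + 2 * (u x * L x)) + L x ^+ 2)).
    by congr (En al _); apply/funext => x; ring.
  have i2 := PintZ 2 iuL; have i3 := PintD iu2 i2.
  by rewrite (PEnD i3 iL2) (PEnD iu2 i2) (PEnZ _ iuL) euL.
have e3 : En al (fun x => u x + L x) = m + En al L by rewrite (PEnD iu iL).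
have e4 (s : R) i : En al (fun x => (g i x + s * c ord0 i) ^+ 2) =
    En al (fun x => g i x ^+ 2) + 2 * s * (c ord0 i * En al (g i)) + s ^+ 2 * c ord0 i ^+ 2.
  have [_ ig2] := sg i; have ig := sqint_Pint (sg i).
  transitivity (En al (fun x => (g i x ^+ 2 + (2 * s * c ord0 i) * g i x) + s ^+ 2 * c ord0 i ^+ 2)).
    by congr (En al _); apply/funext => x; ring.
  have i2 := PintZ (2 * s * c ord0 i) ig; have i3 := PintD ig2 i2.
  by rewrite (PEnD i3 (icst _)) (PEnD ig2 i2) (PEnZ _ ig) En_cst; ring.
have E1x i : al i = 0 -> En al (fun x => x ord0 i) = 0.
  by move=> ai; rewrite (En_coord1 al i (@pbm1_id R)) ai E1_gauss1.
have e5 i : al i = 0 -> En al (fun x => x ord0 i * L x) = c ord0 i.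
  exact: En_coord_dotv.
(* Since x_i is centred, [u] contributes [c_i], and the linear function contributes [c_i] once more;
   squared, this gives the factor 4 in [s3]. *)
have e6 i : al i = 0 -> En al (fun x => x ord0 i * (u x + L x)) = 2 * c ord0 i.
  move=> ai; transitivity (En al (fun x => u x * x ord0 i + x ord0 i * L x)).
    by congr (En al _); apply/funext => x; ring.
  rewrite (PEnD (iux i) (sqintM (sx i) sL)) e5//.
  have := cE' i; rewrite (E1x i ai) mulr0 subr0 => <-; ring.
pose c02 := \sum_i (if al i == 0 then c ord0 i ^+ 2 else 0).
have b1 : c02 <= c2.
  by apply: ler_sum => i _; case: ifP => // _; exact: sqr_ge0.
(* Bessel for c.x; with positive exponents the coordinates are neither centred nor normalized, so
   only this bound on the variance is used. *)
have b2 : c02 <= En al (fun x => L x ^+ 2) - En al L ^+ 2.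
  rewrite lerBrDl; apply: le_trans (bessel al mL); rewrite lerD2l.
  by apply: ler_sum => i _; case: eqP => // ai; rewrite e5.
have s1 : \sum_i En al (fun x => (g i x + c ord0 i) ^+ 2) =
  \sum_i En al (fun x => g i x ^+ 2) + 2 * \sum_i (c ord0 i * En al (g i)) + c2.
  rewrite mulr_sumr -!big_split/=; apply: eq_bigr => i _.
  have := e4 1 i; rewrite expr1n !mul1r mulr1 => <-.
  by congr (En al _); apply/funext => x; rewrite mul1r.
have s2 : \sum_i En al (fun x => (g i x - c ord0 i) ^+ 2) =
  \sum_i En al (fun x => g i x ^+ 2) - 2 * \sum_i (c ord0 i * En al (g i)) + c2.
  rewrite -mulNr mulr_sumr -!big_split/=; apply: eq_bigr => i _.
  have := e4 (-1) i; rewrite sqrrN expr1n mul1r mulrN1 => <-.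
  by congr (En al _); apply/funext => x; rewrite mulN1r.
have s3 : \sum_i (if al i == 0 then En al (fun x => x ord0 i * (u x + L x)) ^+ 2 else 0) = 4 * c02.
  rewrite mulr_sumr; apply: eq_bigr => i _; case: eqP => [ai|_]; last by rewrite mulr0.
  by rewrite e6//; ring.
rewrite -/m e1 s2; apply: (deficit_arith _ b1 b2).
move: key; rewrite -/L e2 e3 s1 s3.
move: (En al L) (En al (fun x => L x ^+ 2)) (En al (fun x => u x ^+ 2)) (\sum_i En al (fun x => g i x ^+ 2)) (\sum_i (c ord0 i * En al (g i))).
by clear; move=> eL eL2 eu2 sg2 scg; lra.
Qed.

Theorem stability_XA (u : 'rV[R]_n -> R) (g : 'rV[R]_n -> 'rV[R]_n) : XA al u g ->
  (muA al (fun x => sqnormv (g x)) - muA al (fun x => ((u x - rmuA al u) ^+ 2)%R)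
   >= (2^-1)%:E * muA al (fun x => sqnormv (g x - cvec al u)%R))%E.
Proof.
move=> [mu' mg u2 g2 [phi [Nphi [cphi cgrad]]]].
have Pint_sq f : rmeasurable f -> (muA al (fun x => (f x ^+ 2)%R) < +oo)%E -> sqint al f.
  move=> mf; have mf2 : rmeasurable (fun x => f x ^+ 2) by exact: measurable_funX.
  rewrite ge0_muA//; last by move=> x; exact: sqr_ge0.
  move=> foo; split => //; split => //; apply/integrableP; split; first exact: (rmeasurable_EFin mf2).
  by under eq_integral do rewrite /= ger0_norm ?sqr_ge0//.
have su : sqint al u by exact: Pint_sq.
pose gi (i : 'I_n) x := g x ord0 i.
have mgi i : rmeasurable (gi i) by exact: mg.
have msum : rmeasurable (fun x => sqnormv (g x)).
  by apply: measurable_sum => i; apply: measurable_funX; exact: mgi.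
have sgi i : sqint al (gi i).
  apply: Pint_sq => //; apply: le_lt_trans g2.
  have mi2 : rmeasurable (fun x => gi i x ^+ 2) by apply: measurable_funX; exact: mgi.
  rewrite !ge0_muA//.
  - apply: ge0_le_integral => //.
    + by move=> s _; rewrite lee_fin sqr_ge0.
    + exact: (rmeasurable_EFin mi2).
    + exact: (rmeasurable_EFin msum).
    + move=> s _; rewrite lee_fin /sqnormv (bigD1 i)//= lerDl sumr_ge0// => j _.
      exact: sqr_ge0.
  - by move=> x; apply: sumr_ge0 => j _; exact: sqr_ge0.
  - by move=> x; exact: sqr_ge0.
have hphi k : C1pb (phi k) (fun i => 'D_(evec R i) (phi k)).
  by have [s1 s2 _] := Nphi k; exact: smooth_compact_C1pb.
have sphi k : sqint al (phi k) by apply: pbm_sqint; case: (hphi k).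
have sdphi k i : sqint al ('D_(evec R i) (phi k)) by apply: pbm_sqint; case: (hphi k).
have iu := sqint_Pint su.
have rmuAE : rmuA al u = En al u by rewrite /rmuA PintE.
set c := cvec al u.
have cE i : c ord0 i = En al (fun x => (u x - En al u) * x ord0 i).
  rewrite mxE rmuAE /rmuA PintE//.
  apply: sqintM; last by apply: pbm_sqint; exact: pbm_coord.
  by apply: sqintB => //; apply: pbm_sqint; exact: pbm_cst.
(* Convergence to 0 in the extended reals is passed to real expectations, which are finite for every
   [k] by square integrability. *)
have cu : (fun k => En al (fun x => (phi k x - u x) ^+ 2)) @ \oo --> (0 : R).
  have [_] : (\forall k \near \oo, muA al (fun x => (phi k x - u x) ^+ 2) \is a fin_num) /\
     fine \o (fun k => muA al (fun x => (phi k x - u x) ^+ 2)) @ \oo --> (0 : R).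
    exact/fine_cvgP.
  rewrite (_ : fine \o _ = (fun k => En al (fun x => (phi k x - u x) ^+ 2)))//.
  by apply/funext => k /=; rewrite PintE//; have [] := sqintB (sphi k) su.
have igr k : Pint al (fun x => sqnormv (grad (phi k) x - g x)).
  rewrite (_ : (fun _ => _) = fun x => \sum_i ('D_(evec R i) (phi k) x - gi i x) ^+ 2).
    by apply: Pint_sum => i; have [] := sqintB (sdphi k i) (sgi i).
  by apply/funext => x; apply: eq_bigr => i _; rewrite !mxE.
have cg i : (fun k => En al (fun x => ('D_(evec R i) (phi k) x - gi i x) ^+ 2)) @ \oo --> (0 : R).
  have [_ h] : (\forall k \near \oo, muA al (fun x => sqnormv (grad (phi k) x - g x)) \is a fin_num) /\
     fine \o (fun k => muA al (fun x => sqnormv (grad (phi k) x - g x))) @ \oo --> (0 : R).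
    exact/fine_cvgP.
  apply: (squeeze_cvgr _ (cvg_cst 0) h); near=> k.
  rewrite En_ge0 => [|x]; last exact: sqr_ge0.
  rewrite /= PintE//; apply: PEn_le => //; first by have [] := sqintB (sdphi k i) (sgi i).
  move=> x; rewrite /sqnormv (bigD1 i)//= !mxE lerDl sumr_ge0// => j _.
  exact: sqr_ge0.
(* The vector [c] is that of the limit [u], the same for all [k], so it cancels from the differences
   to the limit. *)
have key := @poincare_limit (fun k x => phi k x + dotv c x)
  (fun k i x => 'D_(evec R i) (phi k) x + c ord0 i)
  (fun x => u x + dotv c x) (fun i x => gi i x + c ord0 i).
have {key} := stability_L2 su sgi cE (key _ _ _ _ _).
have -> : muA al (fun x => ((u x - rmuA al u) ^+ 2)%R) = (En al (fun x => (u x - En al u) ^+ 2))%:E.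
  rewrite rmuAE PintE//; have [] : sqint al (fun x => u x - En al u) => //.
  by apply: sqintB => //; apply: pbm_sqint; exact: pbm_cst.
have -> : muA al (fun x => sqnormv (g x)) = (\sum_i En al (fun x => gi i x ^+ 2))%:E.
  rewrite PintE; first by rewrite PEn_sum// => i; have [] := sgi i.
  by apply: Pint_sum => i; have [] := sgi i.
have sgc i : sqint al (fun x => gi i x - c ord0 i).
  by apply: sqintB => //; apply: pbm_sqint; exact: pbm_cst.
have -> : muA al (fun x => sqnormv (g x - c)) = (\sum_i En al (fun x => (gi i x - c ord0 i) ^+ 2))%:E.
  rewrite (_ : (fun x => sqnormv (g x - c)) = fun x => \sum_i (gi i x - c ord0 i) ^+ 2); last first.
    by apply/funext => x; apply: eq_bigr => i _; rewrite !mxE.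
  rewrite PintE; first by rewrite PEn_sum// => i; have [] := sgc i.
  by apply: Pint_sum => i; have [] := sgc i.
rewrite -EFinB -EFinM lee_fin; apply.
- by move=> k; exact: C1pbD_dotv.
- by apply: sqintD => //; apply: pbm_sqint; exact: pbm_dotv.
- by move=> i; apply: sqintD => //; apply: pbm_sqint; exact: pbm_cst.
- rewrite (_ : (fun k => _) = (fun k => En al (fun x => (phi k x - u x) ^+ 2)))//.
  by apply/funext => k; congr (En al _); apply/funext => x; ring.
- move=> i; rewrite (_ : (fun k => _) = (fun k => En al (fun x => ('D_(evec R i) (phi k) x - gi i x) ^+ 2)))//.
  by apply/funext => k; congr (En al _); apply/funext => x; ring.
Unshelve. all: by end_near. Qed.

End Inequality.

(** * The extremal function *)

Section Bump.
Context {R : realType}.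
Implicit Types (s t x b : R) (k : nat).

(** The classical function exp(-1/s), flat at 0, together with the powers of 1/s that its
    derivatives bring in. *)
Definition flat_exp k s : R := if 0 < s then s^-1 ^+ k * expR (- s^-1) else 0.

Lemma flat_exp_ge0 k s : 0 <= flat_exp k s.
Proof.
rewrite /flat_exp; case: ifP => // s0.
by rewrite mulr_ge0 ?expR_ge0// exprn_ge0// invr_ge0 ltW.
Qed.

(** With y = 1/s and j = k + 1, the bound y/j <= exp(y/j) raised to the power j controls y^j; the
    exponent is [k.+1] so that j is nonzero. *)
Lemma flat_exp_le k : exists2 C : R, 0 <= C & forall s, flat_exp k s <= C.
Proof.
pose j : R := k.+1%:R; have j0 : 0 < j by rewrite ltr0n.
exists (1 + j ^+ k.+1); first by rewrite addr_ge0// exprn_ge0// ltW.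
move=> s; rewrite /flat_exp; case: ifP => s0; last by rewrite addr_ge0// exprn_ge0// ltW.
set y := s^-1; have y0 : 0 < y by rewrite invr_gt0.
have h : y ^+ k.+1 <= j ^+ k.+1 * expR y.
  have -> : y = (y / j) * j by rewrite divfK ?gt_eqF.
  rewrite /j expRM_natr -/j -exprMn (mulrC (y / j)) ; apply: lerXn2r.
  - by rewrite nnegrE mulr_ge0// ?divr_ge0 ?ltW.
  - by rewrite nnegrE mulr_ge0 ?expR_ge0// ltW.
  - by rewrite ler_pM2l// (le_trans _ (expR_ge1Dx _))// lerDr.
have h' : y ^+ k <= 1 + y ^+ k.+1.
  have [y1|y1] := leP y 1.
    rewrite (@le_trans _ _ 1)//; first by rewrite exprn_ile1 ?(ltW y0).
    by rewrite lerDl exprn_ge0// ltW.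
  by rewrite (@le_trans _ _ (y ^+ k.+1))// ?lerDr// ler_weXn2l// ltW.
rewrite expRN ler_pdivrMr ?expR_gt0// (le_trans h')// mulrDl mul1r lerD//.
by rewrite (le_trans _ (expR_ge1Dx _))// lerDl ltW.
Qed.

Lemma flat_expS k s : flat_exp k s = s * flat_exp k.+1 s.
Proof.
rewrite /flat_exp; case: ifPn => [s0|_]; last by rewrite mulr0.
by rewrite exprS !mulrA divff ?mul1r// gt_eqF.
Qed.

Lemma is_derive_flat_exp k s :
  is_derive s 1 (flat_exp k) (flat_exp k.+2 s - k%:R * flat_exp k.+1 s).
Proof.
have [s0|s0|s0] := ltgtP s 0.
- apply: (@near_eq_is_derive _ _ _ (cst 0)).
    near=> y; rewrite /flat_exp ifF//; apply/negbTE; rewrite -leNgt ltW//.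
    near: y; exact: lt_nbhsl.
  by rewrite /flat_exp ltNge (ltW s0)/= mulr0 subr0; exact: is_derive_cst.
- apply: (@near_eq_is_derive _ _ _ (fun s => s^-1 ^+ k * expR (- s^-1))).
    near=> y; rewrite /flat_exp ifT//.
    near: y; exact: lt_nbhsr.
  have sN0 : s != 0 by rewrite gt_eqF.
  have dV : is_derive s 1 (fun s : R => s^-1) (- s ^- 2 *: 1).
    exact: (@is_deriveV _ id _ _ _ sN0 (is_derive_id s 1)).
  have dVk : is_derive s 1 (fun s : R => s^-1 ^+ k) ((k%:R * s^-1 ^+ k.-1) *: (- s ^- 2 *: 1)).
    rewrite (_ : (fun s : R => s^-1 ^+ k) = (fun s : R => s^-1) ^+ k).
      exact: is_deriveX.
    by apply/funext => y; rewrite exprfctE.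
  apply: is_derive_eq.
  rewrite /flat_exp s0 /GRing.scale/=.
  case: k {dVk} => [|k] /=; first by rewrite expr0; field.
  by rewrite !exprS -/(_ ^+ k); field.
- rewrite s0.
  have [C C0 hC] := flat_exp_le k.+2.
  have h0 l : flat_exp l 0 = 0 by rewrite /flat_exp ltxx.
  rewrite !h0 mulr0 subr0.
  suff h : h^-1 *: (flat_exp k (h *: (1 : R) + 0) - flat_exp k 0) @[h --> 0^'] --> (0 : R).
    by split; [apply/cvg_ex; exists 0|exact/cvg_lim].
  apply/cvgr0Pnorm_le => e e0; near=> h.
  have hN0 : h != 0 by near: h; exact: nbhs_dnbhs_neq.
  (* Two factors h come out of the numerator, so the quotient is h times a bounded function. *)
  rewrite h0 subr0 addr0 /GRing.scale/= mulr1 flat_expS flat_expS.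
  rewrite (mulKf hN0) normrM (ger0_norm (flat_exp_ge0 _ _)).
  rewrite mulrC (@le_trans _ _ (C * `|h|))//.
    by rewrite ler_wpM2r.
  have : `|h| <= e / (C + 1).
    near: h; apply: dnbhs0_le.
    by rewrite divr_gt0// ltr_wpDl.
  rewrite ler_pdivlMr; last by rewrite ltr_wpDl.
  have := normr_ge0 h; nra.
Unshelve. all: by end_near. Qed.

(* This class of functions is stable under derivation, whence the smoothness of the cutoffs. *)
Definition bump_sum b (l : seq ({poly R} * nat)) x : R :=
  \sum_(q <- l) q.1.[x] * flat_exp q.2 (1 - b * x ^+ 2).

(** Product and chain rule on each term: the first entry differentiates the polynomial, the other
    two come from [is_derive_flat_exp] times the inner derivative -2 b x. *)
Definition bump_deriv b (l : seq ({poly R} * nat)) : seq ({poly R} * nat) :=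
  flatten [seq [:: (q.1^`(), q.2); (- (2 * b) *: ('X * q.1), q.2.+2);
                   ((2 * b * q.2%:R) *: ('X * q.1), q.2.+1)] | q <- l].

Lemma is_derive_bump_sum b l x :
  is_derive x 1 (bump_sum b l) (bump_sum b (bump_deriv b l) x).
Proof.
elim: l => [|[p k] l IH].
  rewrite /bump_sum/= big_nil (_ : (fun x => _) = cst 0); first exact: is_derive_cst.
  by apply/funext => y; rewrite big_nil.
have -> : bump_sum b ((p, k) :: l) = (fun x => p.[x] * flat_exp k (1 - b * x ^+ 2) + bump_sum b l x).
  by apply/funext => y; rewrite /bump_sum big_cons.
have dt := is_derive_flat_exp k (1 - b * x ^+ 2).
have dq : is_derive x 1 (fun x => 1 - b * x ^+ 2) (- (2 * b * x)).
  by apply: is_derive_eq; rewrite /GRing.scale/=; ring.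
have dc : is_derive x 1 (flat_exp k \o (fun x => 1 - b * x ^+ 2))
    ((flat_exp k.+2 (1 - b * x ^+ 2) - k%:R * flat_exp k.+1 (1 - b * x ^+ 2)) * - (2 * b * x)).
  exact: is_derive1_comp.
have dp := is_derive_poly p x.
have dpc := @is_deriveM _ _ _ _ _ _ _ _ dp dc.
have h := @is_deriveD _ _ _ _ _ _ _ _ _ dpc IH.
have e : bump_sum b (bump_deriv b ((p, k) :: l)) x =
  p.[x] *: ((flat_exp k.+2 (1 - b * x ^+ 2) - k%:R * flat_exp k.+1 (1 - b * x ^+ 2)) * - (2 * b * x)) +
  flat_exp k (1 - b * x ^+ 2) *: p^`().[x] + bump_sum b (bump_deriv b l) x; last first.
  by rewrite e; exact: h.
rewrite /bump_sum /bump_deriv /= !big_cons /= !hornerE /GRing.scale/=; ring.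
Qed.

Definition bump_iter b p j x := bump_sum b (iter j (bump_deriv b) [:: (p, 0%N)]) x.

Lemma is_derive_bump_iter b p j x :
  is_derive x 1 (bump_iter b p j) (bump_iter b p j.+1 x).
Proof. by rewrite /bump_iter iterS; exact: is_derive_bump_sum. Qed.

Lemma bump_iter0 b p x : bump_iter b p 0 x = p.[x] * flat_exp 0 (1 - b * x ^+ 2).
Proof. by rewrite /bump_iter /bump_sum /= big_seq1. Qed.

Lemma bump_iter1 b p x : bump_iter b p 1 x =
  p^`().[x] * flat_exp 0 (1 - b * x ^+ 2) - 2 * b * x * p.[x] * flat_exp 2 (1 - b * x ^+ 2).
Proof.
rewrite /bump_iter /bump_sum /bump_deriv /= !big_cons big_nil/= !hornerE /=.
by rewrite !addr0 !mulNr.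
Qed.

End Bump.

(** * Smoothness of products of functions of one coordinate *)

Section ProductFunctions.
Context {R : realType}.
Variables (n : nat) (psi : 'I_n -> nat -> R -> R).
Hypothesis dpsi : forall j k (x : R), is_derive x 1 (psi j k) (psi j k.+1 x).

(** The multi-index [m] records orders of derivation, so a partial derivative raises one entry and
    all iterated ones stay in this form. *)
Definition prodf (m : 'I_n -> nat) (x : 'rV[R]_n) := \prod_j psi j (m j) (x ord0 j).

Lemma is_derive_prodf m i x :
  is_derive x (evec R i) (prodf m) (prodf (fun j => m j + (j == i))%N x).
Proof.
apply: is_derive_directional.
pose P := \prod_(j < n | j != i) psi j (m j) (x ord0 j).
have -> : (fun t : R => prodf m (x + t *: evec R i)) =
   (fun t => psi i (m i) (x ord0 i + t) * P).
  apply/funext => t; rewrite /prodf (bigD1 i)//= !mxE/= eqxx mulr1; congr (_ * _).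
  by apply: eq_bigr => j ji; rewrite !mxE/= (negbTE ji) mulr0 addr0.
have -> : prodf (fun j => m j + (j == i))%N x = psi i (m i).+1 (x ord0 i) * P.
  rewrite /prodf (bigD1 i)//= eqxx addn1; congr (_ * _).
  by apply: eq_bigr => j ji; rewrite (negbTE ji) addn0.
have d1 : is_derive (0 : R) 1 (fun t => x ord0 i + t) 1.
  have := is_deriveD (is_derive_cst (x ord0 i) (0 : R) 1) (is_derive_id (0 : R) 1).
  by rewrite add0r.
have d2 := dpsi i (m i) (x ord0 i + 0).
have d3 : is_derive (0 : R) 1 (psi i (m i) \o (fun t => x ord0 i + t)) (psi i (m i).+1 (x ord0 i + 0) * 1).
  exact: is_derive1_comp.
rewrite addr0 mulr1 in d3.
have d4 := is_deriveM d3 (is_derive_cst P (0 : R) 1).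
have <- : (psi i (m i) \o [eta +%R (x ord0 i)]) 0 *: 0 + P *: psi i (m i).+1 (x ord0 i) =
    psi i (m i).+1 (x ord0 i) * P by rewrite scaler0 add0r [RHS]mulrC.
exact: d4.
Qed.

Lemma continuous_prodf m : continuous (prodf m).
Proof.
have h (r : seq 'I_n) : continuous (fun x : 'rV[R]_n => \prod_(j <- r) psi j (m j) (x ord0 j)).
  elim: r => [|j r IH].
    have -> : (fun x : 'rV[R]_n => \prod_(j <- [::]) psi j (m j) (x ord0 j)) = cst 1.
      by apply/funext => y; rewrite big_nil.
    exact: cst_continuous.
  have -> : (fun x : 'rV[R]_n => \prod_(l <- j :: r) psi l (m l) (x ord0 l)) =
      (fun x => psi j (m j) (x ord0 j) * \prod_(l <- r) psi l (m l) (x ord0 l)).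
    by apply/funext => y; rewrite big_cons.
  move=> x; suff h : {for x, continuous (fun x : 'rV[R]_n => psi j (m j) (x ord0 j))}.
    exact: (cvgM h (IH x)).
  apply: (@continuous_comp _ _ _ (fun x : 'rV[R]_n => x ord0 j) (psi j (m j)) x).
    exact: coord_continuous.
  apply: differentiable_continuous; apply/derivable1_diffP.
  by case: (dpsi j (m j) (x ord0 j)).
exact: h.
Qed.

Lemma pder_prodf s m : pder s (prodf m) = prodf (fun j => m j + count_mem j s)%N.
Proof.
elim: s => [|i s IH] /=.
  by congr prodf; apply/funext => j; rewrite addn0.
apply/funext => x; rewrite IH.
have [_ ->] := is_derive_prodf (fun j => m j + count_mem j s)%N i x.
by congr (prodf _ x); apply/funext => j; rewrite eq_sym -addnA (addnC (count_mem j s)).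
Qed.

Lemma smooth_prodf m : smooth (prodf m).
Proof.
move=> s; rewrite pder_prodf; split; first exact: continuous_prodf.
by move=> i x; case: (is_derive_prodf (fun j => m j + count_mem j s)%N i x).
Qed.

End ProductFunctions.

(** * Estimates for the cutoff *)

Section Cutoff.
Context {R : realType}.
Implicit Types (b x : R).

(** The factor e normalizes the value at 0 to 1. *)
Definition cutoff b x : R := expR 1 * flat_exp 0 (1 - b * x ^+ 2).

Definition dcutoff b x : R := - (2 * b * x * (expR 1 * flat_exp 2 (1 - b * x ^+ 2))).

Lemma cutoffE b x : 0 < 1 - b * x ^+ 2 -> cutoff b x = expR (1 - (1 - b * x ^+ 2)^-1).
Proof. by move=> s0; rewrite /cutoff /flat_exp s0 expr0 mul1r -expRD. Qed.

Lemma cutoff_ge0 b x : 0 <= cutoff b x.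
Proof. by rewrite mulr_ge0 ?expR_ge0// flat_exp_ge0. Qed.

Lemma cutoff_out b x : 1 <= b * x ^+ 2 -> cutoff b x = 0.
Proof. by move=> h; rewrite /cutoff /flat_exp ifF ?mulr0//; apply/negbTE; rewrite -leNgt subr_le0. Qed.

Lemma cutoff_le1 b x : 0 <= b -> cutoff b x <= 1.
Proof.
move=> b0; have [h|h] := leP 1 (b * x ^+ 2); first by rewrite cutoff_out.
have s0 : 0 < 1 - b * x ^+ 2 by rewrite subr_gt0.
rewrite cutoffE// -[leRHS]expR0 ler_expR subr_le0 invf_ge1// gerBl.
by rewrite mulr_ge0// sqr_ge0.
Qed.

(** With q = b x^2 the bound is trivial once 2q >= 1. Otherwise exp(1 - y) >= 2 - y for y = 1/(1 -
    q), and y <= 1 + 2q. *)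
Lemma cutoff_sub1 b x : 0 <= b -> 1 - cutoff b x <= 2 * (b * x ^+ 2).
Proof.
move=> b0; have q0 : 0 <= b * x ^+ 2 by rewrite mulr_ge0// sqr_ge0.
have [h|h] := leP 1 (2 * (b * x ^+ 2)).
  by rewrite (le_trans _ h)// gerBl cutoff_ge0.
have s0 : 0 < 1 - b * x ^+ 2 by move: h q0; lra.
rewrite cutoffE//; set y := _^-1.
have h1 := expR_ge1Dx (1 - y).
have : y <= 1 + 2 * (b * x ^+ 2).
  rewrite -[y]mul1r ler_pdivrMr//; move: (b * x ^+ 2) q0 h => q; nra.
by move: h1; lra.
Qed.

Lemma dcutoff_le : exists2 C : R, 0 <= C &
  forall b x, 0 <= b -> `|dcutoff b x| <= b * (C * `|x|).
Proof.
have [C C0 hC] := @flat_exp_le R 2.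
exists (2 * expR 1 * C) => [|b x b0]; first by rewrite !mulr_ge0// expR_ge0.
rewrite normrN !normrM (ger0_norm b0) (ger0_norm (expR_ge0 1)) (ger0_norm (flat_exp_ge0 _ _)).
rewrite (ger0_norm (ler0n R 2)).
have := hC (1 - b * x ^+ 2); move: (flat_exp 2 _) => F FC.
rewrite [leRHS](_ : _ = 2 * b * `|x| * (expR 1 * C)); last by ring.
by rewrite ler_wpM2l// ?mulr_ge0// ler_wpM2l// expR_ge0.
Qed.

Lemma dcutoff0 b : dcutoff b 0 = 0.
Proof. by rewrite /dcutoff mulr0 mul0r oppr0. Qed.

Lemma prod_itv01 (I : Type) (r : seq I) (P : pred I) (a : I -> R) : (forall i, 0 <= a i <= 1) ->
  0 <= \prod_(i <- r | P i) a i <= 1.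
Proof.
move=> h; apply: (big_ind (fun y : R => 0 <= y <= 1)) => //; first by rewrite ler01 lexx.
by move=> y z /andP[? ?] /andP[? ?]; rewrite mulr_ge0//= mulr_ile1.
Qed.

Lemma one_sub_prod_le (I : Type) (r : seq I) (a : I -> R) : (forall i, 0 <= a i <= 1) ->
  1 - \prod_(i <- r) a i <= \sum_(i <- r) (1 - a i).
Proof.
move=> h; elim: r => [|i r IH]; first by rewrite !big_nil subrr.
rewrite !big_cons; have := h i; have := prod_itv01 r xpredT h; move: IH.
move: (\prod_(_ <- _) _) (\sum_(_ <- _) _) (a i) => p s c.
by move=> ? /andP[? ?] /andP[? ?]; nra.
Qed.

End Cutoff.

(** * Truncations of the Hermite polynomial *)

Section Approximation.
Context {R : realType}.
Variables (n : nat) (i0 : 'I_n).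
Implicit Types (b : R) (x : 'rV[R]_n).

Definition hermite2 x : R := x ord0 i0 ^+ 2 - 1.

Definition grad_hermite2 x : 'rV[R]_n := \row_i (if i == i0 then 2 * x ord0 i else 0).

Definition fac (j : 'I_n) (t : R) := if j == i0 then t ^+ 2 - 1 else 1.
Definition dfac (j : 'I_n) (t : R) := if j == i0 then 2 * t else 0.

(** [k] is the order of derivation; the normalizing factor e of the cutoff is moved into the
    polynomial so that the factor is a [bump_iter]. *)
Definition trunc_factor b (j : 'I_n) (k : nat) : R -> R :=
  bump_iter b (if j == i0 then expR 1 *: ('X^2 - 1%:P) else (expR 1)%:P) k.

Definition trunc b := prodf (trunc_factor b) (fun=> 0%N).

Lemma trunc_factor0 b j t : trunc_factor b j 0 t = fac j t * cutoff b t.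
Proof.
rewrite /trunc_factor bump_iter0 /fac /cutoff; case: ifP => _.
  by rewrite hornerZ hornerD hornerN hornerXn hornerC; ring.
by rewrite hornerC; ring.
Qed.

Lemma trunc_factor1 b j t :
  trunc_factor b j 1 t = dfac j t * cutoff b t + fac j t * dcutoff b t.
Proof.
rewrite /trunc_factor bump_iter1 /fac /dfac /cutoff /dcutoff; case: ifP => _.
  rewrite derivZ derivB derivXn derivC subr0 !hornerZ hornerMn hornerD hornerN !hornerXn hornerC.
  by rewrite -[t ^+ 1 *+ 2]mulr_natl; ring.
by rewrite derivC !hornerC; ring.
Qed.

Lemma is_derive_trunc_factor b j k (t : R) :
  is_derive t 1 (trunc_factor b j k) (trunc_factor b j k.+1 t).
Proof. exact: is_derive_bump_iter. Qed.

Lemma prod_fac x : \prod_j fac j (x ord0 j) = hermite2 x.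
Proof.
rewrite (bigD1 i0)//= /fac eqxx big1 ?mulr1// => j /negbTE ->; by [].
Qed.

Lemma truncE b x : trunc b x = hermite2 x * \prod_j cutoff b (x ord0 j).
Proof.
rewrite /trunc /prodf -prod_fac -big_split/=.
by apply: eq_bigr => j _; rewrite trunc_factor0.
Qed.

Lemma derive_trunc b i x : 'D_(evec R i) (trunc b) x =
  dfac i (x ord0 i) * \prod_j cutoff b (x ord0 j) +
  hermite2 x * (dcutoff b (x ord0 i) * \prod_(j | j != i) cutoff b (x ord0 j)).
Proof.
have [_ ->] := is_derive_prodf (@is_derive_trunc_factor b) (fun=> 0%N) i x.
rewrite /prodf (bigD1 i)//= eqxx trunc_factor1.
have -> : hermite2 x = fac i (x ord0 i) * \prod_(j | j != i) fac j (x ord0 j).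
  by rewrite -prod_fac (bigD1 i).
have -> : \prod_j cutoff b (x ord0 j) =
    cutoff b (x ord0 i) * \prod_(j | j != i) cutoff b (x ord0 j) by rewrite (bigD1 i).
under eq_bigr => j ji do rewrite add0n (negbTE ji) trunc_factor0.
rewrite big_split/=.
(* Off [i0] the derivative of the factor is 0, and at [i0] all remaining polynomial factors are
   1. *)
have -> : dfac i (x ord0 i) * (cutoff b (x ord0 i) * \prod_(j < n | j != i) cutoff b (x ord0 j)) =
  dfac i (x ord0 i) * \prod_(j < n | j != i) fac j (x ord0 j) *
  (cutoff b (x ord0 i) * \prod_(j < n | j != i) cutoff b (x ord0 j)).
  rewrite /dfac; case: ifPn => [/eqP ->|_]; last by rewrite !mul0r.
  rewrite (_ : \prod_(j < n | j != i0) fac j (x ord0 j) = 1) ?mulr1//.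
  by apply: big1 => j ji; rewrite /fac (negbTE ji).
by ring.
Qed.

Lemma smooth_trunc b : smooth (trunc b).
Proof. exact: (smooth_prodf (@is_derive_trunc_factor b)). Qed.

Lemma trunc_support b : 0 < b -> exists M : R, forall x, M < `|x| -> trunc b x = 0.
Proof.
(* If |x_j| exceeds both 1 and 1/b, then x_j^2 >= 1/b and the cutoff in x_j vanishes; the sum avoids
   a square root. *)
move=> b0; exists (1 + b^-1) => x Mx.
have [j hj] : exists j, 1 + b^-1 < `|x ord0 j|.
  apply: contrapT => /forallNP h; move: Mx; apply/negP; rewrite -leNgt [leLHS]mx_normrE.
  apply: bigmax_le => [|[i j] _ /=]; first by rewrite addr_ge0// invr_ge0 ltW.
  by rewrite ord1 leNgt; apply/negP; exact: h.
rewrite truncE (bigD1 j)//= cutoff_out ?mul0r ?mulr0//.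
rewrite -[x ord0 j ^+ 2]real_normK ?num_real//.
have v0 : 0 < b^-1 by rewrite invr_gt0.
have bv : b * b^-1 = 1 by rewrite divff// gt_eqF.
have : 1 * b^-1 <= `|x ord0 j| ^+ 2.
  rewrite expr2; apply: ler_pM => //; first exact: ltW.
    by rewrite (le_trans _ (ltW hj))// lerDl ltW.
  by rewrite (le_trans _ (ltW hj))// lerDr.
rewrite mul1r => h; rewrite -bv; by apply: ler_wpM2l => //; exact: ltW.
Qed.

Lemma Nstar_trunc (al : 'I_n -> R) b : al i0 = 0 -> 0 < b -> Nstar al (trunc b).
Proof.
move=> ai b0; split; [exact: smooth_trunc|exact: trunc_support|].
move=> i x aix _ xi0; rewrite derive_trunc.
have {}xi0 : x ord0 i = 0 by exact: xi0.
have ii : i != i0 by apply: contraTneq aix => ->; rewrite ai ltxx.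
by rewrite /dfac (negbTE ii) mul0r add0r xi0 dcutoff0 mul0r mulr0.
Qed.

Definition sqsum x : R := \sum_j 2 * x ord0 j ^+ 2.

Lemma cutoff_itv b (t : R) : 0 <= b -> 0 <= cutoff b t <= 1.
Proof. by move=> b0; rewrite cutoff_ge0 cutoff_le1. Qed.

Lemma cutoff_prod_le b x : 0 <= b ->
  0 <= 1 - \prod_j cutoff b (x ord0 j) <= b * sqsum x.
Proof.
move=> b0; have h j := cutoff_itv (x ord0 j) b0.
apply/andP; split.
  by rewrite subr_ge0; case/andP: (prod_itv01 (index_enum 'I_n) xpredT h).
apply: (le_trans (one_sub_prod_le (index_enum 'I_n) h)).
rewrite /sqsum mulr_sumr; apply: ler_sum => j _.
by rewrite mulrCA cutoff_sub1.
Qed.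

(** The error is [b] times a majorant free of [b]. Replacing |H| by 1 + H^2 keeps that majorant
    polynomial, hence integrable. *)
Lemma trunc_sub_le b x : 0 <= b ->
  `|trunc b x - hermite2 x| <= b * ((1 + hermite2 x ^+ 2) * sqsum x).
Proof.
move=> b0; have /andP[h1 h2] := cutoff_prod_le x b0.
rewrite truncE -[X in _ - X]mulr1 -mulrBr normrM [X in _ * X]distrC (ger0_norm h1).
rewrite mulrCA; apply: ler_pM => //; exact: normr_le_oneDsqr.
Qed.

Lemma derive_trunc_sub_le : exists2 C : R, 0 <= C & forall b i x, 0 <= b ->
  `|'D_(evec R i) (trunc b) x - grad_hermite2 x ord0 i| <=
  b * ((1 + dfac i (x ord0 i) ^+ 2) * sqsum x +
       C * ((1 + hermite2 x ^+ 2) * (1 + x ord0 i ^+ 2))).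
Proof.
have [C C0 hC] := @dcutoff_le R; exists C => // b i x b0.
have /andP[h1 h2] := cutoff_prod_le x b0.
have h j := cutoff_itv (x ord0 j) b0.
have /andP[p0 p1] := prod_itv01 (index_enum 'I_n) (fun j => j != i) h.
rewrite derive_trunc mxE -/(dfac i (x ord0 i)).
set P := \prod_j _ in h1 h2 *; set Q := \prod_(j | _) _ in p0 p1 *.
rewrite (_ : _ - _ = - (dfac i (x ord0 i) * (1 - P)) + hermite2 x * (dcutoff b (x ord0 i) * Q)); last by ring.
apply: (le_trans (ler_normD _ _)); rewrite [leRHS]mulrDr; apply: lerD.
  rewrite normrN normrM (ger0_norm h1) mulrCA; apply: ler_pM => //.
  exact: normr_le_oneDsqr.
rewrite normrM normrM (ger0_norm p0).
rewrite [leRHS](_ : _ = (1 + hermite2 x ^+ 2) * (b * (C * (1 + x ord0 i ^+ 2)))); last by ring.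
apply: ler_pM => //; [by rewrite mulr_ge0|exact: normr_le_oneDsqr|].
rewrite -[leRHS]mulr1; apply: ler_pM => //.
apply: (le_trans (hC b (x ord0 i) b0)); apply: ler_wpM2l => //; apply: ler_wpM2l => //.
exact: normr_le_oneDsqr.
Qed.

End Approximation.

(** * Membership in [XA], equality and nonlinearity *)

Section Extremal.
Context {R : realType}.
Variables (n : nat) (al : 'I_n -> R) (i0 : 'I_n).

Lemma muA_cvg0 (F : nat -> 'rV[R]_n -> R) (b : nat -> R) (H : 'rV[R]_n -> R) :
  (forall k, rmeasurable (F k)) -> pbm H -> (forall k x, 0 <= F k x <= b k * H x) ->
  b @ \oo --> (0 : R) -> (fun k => muA al (F k)) @ \oo --> 0%E.
Proof.
move=> mF mH FH b0.
have iH k : Pint al (fun x => b k * H x) by apply: PintZ; exact: pbm_Pint.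
have iF k : Pint al (F k).
  apply: Pint_le (mF k) (iH k) _ => x.
  by have /andP[h1 h2] := FH k x; rewrite ger0_norm.
have -> : (fun k => muA al (F k)) = (fun k => (En al (F k))%:E).
  by apply/funext => k; exact: PintE.
apply/fine_cvgP; split; first by near=> k.
have bH : (fun k => b k * En al H) @ \oo --> (0 : R).
  by rewrite -[X in _ --> X](mul0r (En al H)); apply: cvgM => //; exact: cvg_cst.
apply: (squeeze_cvgr _ (cvg_cst 0) bH); near=> k => /=.
apply/andP; split; first by apply: En_ge0 => x; case/andP: (FH k x).
rewrite -(PEnZ _ (pbm_Pint al mH)); apply: PEn_le => // x.
by case/andP: (FH k x).
Unshelve. all: by end_near. Qed.

(** Since b^2 <= b, squared errors also fit the linear scale that [muA_cvg0] expects. *)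
Lemma sqr_le_scale (b t h : R) : 0 <= b <= 1 -> `|t| <= b * h -> t ^+ 2 <= b * h ^+ 2.
Proof.
move=> /andP[b0 b1] th; rewrite -[t ^+ 2]real_normK ?num_real//.
apply: (@le_trans _ _ ((b * h) ^+ 2)).
  by apply: lerXn2r => //; rewrite nnegrE// (le_trans _ th).
rewrite exprMn ler_wpM2r ?sqr_ge0// expr2 -[leRHS]mulr1.
exact: ler_wpM2l.
Qed.

Lemma pbm_hermite2 : pbm (hermite2 i0 : 'rV[R]_n -> R).
Proof.
rewrite /hermite2; apply: pbmD; last exact: pbm_cst.
by apply: pbmX; exact: pbm_coord.
Qed.

Lemma pbm_grad_hermite2 i : pbm (fun x : 'rV[R]_n => grad_hermite2 i0 x ord0 i).
Proof.
have -> : (fun x : 'rV[R]_n => grad_hermite2 i0 x ord0 i) =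
    (fun x => (if i == i0 then 2 else 0) * x ord0 i); last first.
  by apply: pbmZ; exact: pbm_coord.
by apply/funext => x; rewrite mxE; case: ifP => _; rewrite ?mul0r.
Qed.

Lemma pbm_sqsum : pbm (fun x : 'rV[R]_n => sqsum x).
Proof. by apply: pbm_sum => j; apply: pbmZ; apply: pbmX; exact: pbm_coord. Qed.

Hypothesis ai : al i0 = 0.

Lemma hermite2_XA : XA al (hermite2 i0) (grad_hermite2 i0).
Proof.
have pu := pbm_hermite2; have pg := pbm_grad_hermite2.
split.
- by case: pu.
- by move=> i; case: (pg i).
- by rewrite PintE ?ltry//; apply: pbm_Pint; exact: pbmX.
- rewrite /sqnormv PintE ?ltry//; apply: pbm_Pint; apply: pbm_sum => i; exact: pbmX.
pose b k : R := k.+1%:R^-1.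
have b0 k : 0 < b k by rewrite invr_gt0 ltr0n.
have b1 k : 0 <= b k <= 1 by rewrite ltW//= invf_le1 ?ltr0n// ler1n.
exists (fun k => trunc i0 (b k)); split; first by move=> k; exact: Nstar_trunc.
have cb : b @ \oo --> (0 : R) by exact: cvg_harmonic.
have one_sqr f : pbm f -> pbm (fun x : 'rV[R]_n => 1 + f x ^+ 2).
  by move=> mf; apply: pbmD; [exact: pbm_cst|exact: pbmX].
split.
  pose H (x : 'rV[R]_n) := ((1 + hermite2 i0 x ^+ 2) * sqsum x) ^+ 2.
  have mH : pbm H.
    apply: pbmX; apply: pbmM; [exact: one_sqr|exact: pbm_sqsum].
  apply: (@muA_cvg0 _ b H) => // [k|k x].
    apply: measurable_funX; apply: measurable_funB; last by case: pu.
    apply: continuous_rmeasurable; exact: (proj1 (smooth_trunc i0 (b k) [::])).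
  rewrite sqr_ge0/=; apply: sqr_le_scale => //; apply: trunc_sub_le.
  exact: ltW.
have [C C0 hC] := @derive_trunc_sub_le R n i0.
pose K i (x : 'rV[R]_n) := (1 + dfac i0 i (x ord0 i) ^+ 2) * sqsum x +
       C * ((1 + hermite2 i0 x ^+ 2) * (1 + x ord0 i ^+ 2)).
pose H (x : 'rV[R]_n) := \sum_i K i x ^+ 2.
have mH : pbm H.
  apply: pbm_sum => i; apply: pbmX; apply: pbmD.
    apply: pbmM; last exact: pbm_sqsum.
    apply: one_sqr; have := pg i.
    by congr pbm; apply/funext => x; rewrite mxE.
  apply: pbmZ; apply: pbmM; apply: one_sqr => //; exact: pbm_coord.
apply: (@muA_cvg0 _ b H) => // [k|k x].
  apply: measurable_sum => i; apply: measurable_funX.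
  have h : rmeasurable (fun x => 'D_(evec R i) (trunc i0 (b k)) x - grad_hermite2 i0 x ord0 i).
    apply: measurable_funB; last by case: (pg i).
    exact: (@continuous_rmeasurable R n _ (proj1 (smooth_trunc i0 (b k) [:: i]))).
  by move: h; rewrite /rmeasurable; congr measurable_fun; apply/funext => s /=; rewrite !mxE.
rewrite /sqnormv sumr_ge0/= => [|i _]; last exact: sqr_ge0.
rewrite /H mulr_sumr; apply: ler_sum => i _; apply: sqr_le_scale => //.
have := hC (b k) i x (ltW (b0 k)); rewrite !mxE; exact.
Qed.

Lemma E1_gauss4 : E1 0 (fun t : R => t ^+ 4) = 3.
Proof. by rewrite (E1_gaussX 2) E1_gauss2 mulr1. Qed.

Lemma E1_gauss3 : E1 0 (fun t : R => t ^+ 3) = 0.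
Proof.
by rewrite (E1_gaussX 1) (_ : (fun x : R => x ^+ 1) = id) ?E1_gauss1 ?mulr0.
Qed.

Lemma E1_hermite2 : E1 0 (fun t : R => t ^+ 2 - 1) = 0.
Proof.
rewrite (E1D _ (pbm1X 2 (@pbm1_id R)) (pbm1_cst _)) E1_cst E1_gauss2.
by rewrite subrr.
Qed.

Lemma pbm1_hermite2 : pbm1 (fun t : R => t ^+ 2 - 1).
Proof. by apply: pbm1D; [apply: pbm1X; exact: pbm1_id|exact: pbm1_cst]. Qed.

Lemma En_hermite2 : En al (hermite2 i0) = 0.
Proof. by rewrite (En_coord1 al i0 pbm1_hermite2) ai E1_hermite2. Qed.

Lemma En_hermite2_sqr : En al (fun x => hermite2 i0 x ^+ 2) = 2.
Proof.
rewrite (En_coord1 al i0 (pbm1X 2 pbm1_hermite2)) ai.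
have p k : pbm1 (fun t : R => t ^+ k) by apply: pbm1X; exact: pbm1_id.
have p2 := pbm1D (pbm1Z (- 2) (p 2)) (pbm1_cst (1 : R)).
transitivity (E1 0 (fun t : R => t ^+ 4 + ((- 2) * t ^+ 2 + 1))).
  by congr (E1 _ _); apply/funext => t; ring.
rewrite (E1D _ (p 4) p2) (E1D _ (pbm1Z (- 2) (p 2)) (pbm1_cst (1 : R))) (E1Z _ _ (p 2)).
rewrite E1_gauss4 E1_gauss2 E1_cst; ring.
Qed.

Lemma En_hermite2_coord j : En al (fun x => hermite2 i0 x * x ord0 j) = 0.
Proof.
have [->|ij] := eqVneq j i0; last first.
  rewrite eq_sym in ij; rewrite (En_coord2 al ij pbm1_hermite2 (@pbm1_id R)) ai E1_hermite2.
  by rewrite mul0r.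
have p k : pbm1 (fun t : R => t ^+ k) by apply: pbm1X; exact: pbm1_id.
have p1 : pbm1 (fun t : R => (- 1) * t) by apply: pbm1Z; exact: pbm1_id.
rewrite (En_coord1 al i0 (pbm1M pbm1_hermite2 (@pbm1_id R))) ai.
transitivity (E1 0 (fun t : R => t ^+ 3 + (- 1) * t)).
  by congr (E1 _ _); apply/funext => t; ring.
rewrite (E1D _ (p 3) p1) (E1Z _ _ (@pbm1_id R)) E1_gauss1 E1_gauss3.
by rewrite mulr0 addr0.
Qed.

Lemma muA_grad_hermite2 : muA al (fun x => sqnormv (grad_hermite2 i0 x)) = 4%:E.
Proof.
have p : pbm (fun x : 'rV[R]_n => x ord0 i0 ^+ 2) by apply: pbmX; exact: pbm_coord.
have -> : (fun x : 'rV[R]_n => sqnormv (grad_hermite2 i0 x)) = fun x => 4 * x ord0 i0 ^+ 2.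
  apply/funext => x; rewrite /sqnormv (bigD1 i0)//= mxE eqxx big1 => [|j ji].
    by ring.
  by rewrite mxE (negbTE ji) expr0n.
rewrite PintE; last by apply: PintZ; exact: pbm_Pint.
rewrite (EnZ _ _ p).
rewrite (En_coord1 al i0 (pbm1X 2 (@pbm1_id R))) ai E1_gauss2.
by rewrite mulr1.
Qed.

Lemma rmuA_hermite2 : rmuA al (hermite2 i0) = 0.
Proof. by rewrite /rmuA PintE ?En_hermite2//; apply: pbm_Pint; exact: pbm_hermite2. Qed.

Lemma cvec_hermite2 : cvec al (hermite2 i0) = 0.
Proof.
apply/rowP => j; rewrite !mxE rmuA_hermite2 /rmuA.
have -> : (fun x : 'rV[R]_n => (hermite2 i0 x - 0) * Defs.coord x j) = fun x => hermite2 i0 x * x ord0 j.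
  by apply/funext => x; rewrite subr0.
rewrite PintE ?En_hermite2_coord//; apply: pbm_Pint; apply: pbmM.
  exact: pbm_hermite2.
exact: pbm_coord.
Qed.

(** The polynomial is orthogonal to 1 and to the coordinates, so mean and [cvec] vanish and the
    identity reads 4 - 2 = 4/2. *)
Lemma hermite2_equality :
  (muA al (fun x => sqnormv (grad_hermite2 i0 x))
   - muA al (fun x => ((hermite2 i0 x - rmuA al (hermite2 i0)) ^+ 2)%R)
   = (2^-1)%:E * muA al (fun x => sqnormv (grad_hermite2 i0 x - cvec al (hermite2 i0))%R))%E.
Proof.
rewrite cvec_hermite2 rmuA_hermite2.
under [X in (_ * muA _ X)%E]eq_fun do rewrite subr0.
under [X in (_ - muA _ X)%E]eq_fun do rewrite subr0.
rewrite muA_grad_hermite2 PintE; last by apply: pbm_Pint; apply: pbmX; exact: pbm_hermite2.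
rewrite En_hermite2_sqr -EFinB -EFinM; congr EFin; lra.
Qed.

(** Elements of X_A are classes modulo null sets, so nonlinearity is a positive L^2 distance. By
    orthogonality its square is 2 plus the squared norm of the affine function. *)
Lemma hermite2_not_affine (a : R) (c : 'rV[R]_n) :
  muA al (fun x => ((hermite2 i0 x - (a + dotv c x)) ^+ 2)%R) != 0%E.
Proof.
pose u : 'rV[R]_n -> R := hermite2 i0.
have pu : pbm u := pbm_hermite2.
pose l x := a + dotv c x.
have pl : pbm l by apply: pbmD; [exact: pbm_cst|exact: pbm_dotv].
have pN1 f : pbm f -> pbm (fun x : 'rV[R]_n => (- 1) * f x) by exact: pbmZ.
have pp : pbm (fun x => (u x - l x) ^+ 2).
  apply: pbmX; have := pbmD pu (pN1 _ pl).
  by congr pbm; apply/funext => x; rewrite mulN1r.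
rewrite PintE; last exact: pbm_Pint.
apply/eqP => -[e].
have pxj j : pbm (fun x => c ord0 j * (u x * x ord0 j)).
  by apply: pbmZ; apply: pbmM => //; exact: pbm_coord.
have eul : En al (fun x => u x * l x) = 0.
  transitivity (En al (fun x => a * u x + \sum_j c ord0 j * (u x * x ord0 j))).
    congr (En al _); apply/funext => x; rewrite /l /dotv mulrDr mulr_sumr mulrC.
    by congr (_ + _); apply: eq_bigr => j _; rewrite mulrCA.
  rewrite (EnD _ (pbmZ a pu) (pbm_sum _ pxj)) (EnZ _ _ pu) En_hermite2.
  rewrite mulr0 add0r (En_sum _ _ pxj) big1// => j _.
  rewrite EnZ; last by apply: pbmM => //; exact: pbm_coord.
  by rewrite En_hermite2_coord mulr0.
have pu2 := pbmX 2 pu; have pl2 := pbmX 2 pl.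
have pul := pbmZ (- 2) (pbmM pu pl); have pD := pbmD pul pl2.
have e2 : En al (fun x => (u x - l x) ^+ 2) = 2 + En al (fun x => l x ^+ 2).
  transitivity (En al (fun x => u x ^+ 2 + ((- 2) * (u x * l x) + l x ^+ 2))).
    by congr (En al _); apply/funext => x; ring.
  rewrite (EnD _ pu2 pD) (EnD _ pul pl2) (EnZ _ _ (pbmM pu pl)) eul En_hermite2_sqr.
  by rewrite mulr0 add0r.
have := En_ge0 al (fun x => sqr_ge0 (l x)).
have e3 : En al (fun x => (u x - l x) ^+ 2) = 0 by exact: e.
move: e2; rewrite e3; move: (En al (fun x => l x ^+ 2)) => E eE E0.
have : (2 : R) + E = 0 by rewrite -eE.
have : (0 : R) < 2 + E by rewrite ltr_wpDr.
by move=> /[swap] ->; rewrite ltxx.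
Qed.

End Extremal.

Theorem theorem1p3 (R : realType) (N : nat) (alpha : 'I_N -> R)
  (alpha_ge0 : forall i, 0 <= alpha i) :
  (forall (u : 'rV[R]_N -> R) (g : 'rV[R]_N -> 'rV[R]_N),
     XA alpha u g ->
     (muA alpha (fun x => sqnormv (g x))
      - muA alpha (fun x => ((u x - rmuA alpha u) ^+ 2)%R)
      >= (2^-1)%:E * muA alpha (fun x => sqnormv (g x - cvec alpha u)%R))%E)
  /\
  ((exists i, alpha i = 0) ->
   exists (u : 'rV[R]_N -> R) (g : 'rV[R]_N -> 'rV[R]_N),
     [/\ XA alpha u g,
         (forall (a : R) (b : 'rV[R]_N),
            muA alpha (fun x => ((u x - (a + dotv b x)) ^+ 2)%R) != 0%E) &
         (muA alpha (fun x => sqnormv (g x))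
          - muA alpha (fun x => ((u x - rmuA alpha u) ^+ 2)%R)
          = (2^-1)%:E * muA alpha (fun x => sqnormv (g x - cvec alpha u)%R))%E]).
Proof.
split; first by move=> u g; exact: stability_XA.
move=> [i ai]; exists (hermite2 i), (grad_hermite2 i); split.
- exact: hermite2_XA.
- exact: hermite2_not_affine.
- exact: hermite2_equality.
Qed.
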